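(* Let $T>0$ and $r>0$. Consider the infinite server queue in the random environment $Z$ described in the context, with number of active jobs $N^{\varepsilon}$, and let $N$ be the limiting process defined there. Let $X^{\varepsilon}$ be the solution on $[0,T]$ of the storage equation with constant service rate $r$ driven by $N^{\varepsilon}$ with $X^{\varepsilon}(0)=0$, $$\mathrm{d}X^{\varepsilon}(t)=N^{\varepsilon}(t)\,\mathrm{d}t-r\,\mathbf 1_{\{X^{\varepsilon}(t)>0\}}\,\mathrm{d}t ,$$ understood in the reflected (Skorohod) sense given in the context. Then, $\mathbb P_Z$-almost surely, as $\varepsilon\to0$, $X^{\varepsilon}$ converges in distribution (in the space $C_T$ of continuous functions on $[0,T]$) to a process $X$ such that $X$ solves the storage equation driven by $N$, $$\mathrm{d}X(t)=N(t)\,\mathrm{d}t-r\,\mathbf 1_{\{X(t)>0\}}\,\mathrm{d}t,\qquad X(0)=0,$$ understood in the same reflected sense.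
   Context: All random elements live on a probability space $(\Omega,\mathcal F,\mathbb P)$ with expectation $\mathbb E$. Environment. $Z=\{Z_t;\,t\ge 0\}$ is an $\mathbb{R}^d$-valued stochastic process with initial distribution $\rho_0$ and a unique invariant probability measure $\pi$. It is strongly ergodic with rate $\kappa>0$ in the following sense: for the function $\psi$ below there is a finite random variable $C=C_\psi(\omega)>0$ such that, $\mathbb P$-almost surely, for all $t>0$, $\left|\frac1t\int_0^t\psi(Z_u)\,\mathrm{d}u-\bar\psi\right|\le \frac{C}{(1+t)^{\kappa}}$, where $\bar\psi=\int_{\mathbb{R}^d}\psi(z)\,\pi(\mathrm{d}z)$. Quenched probability. $\mathbb{P}_Z(\cdot)=\mathbb{P}(\cdot\mid Z)$ and $\mathbb{E}_Z[\cdot]=\mathbb{E}[\cdot\mid Z]$. ''$\mathbb P_Z$-almost surely, convergence in distribution holds'' means: for $\mathbb P$-almost every realization of $Z$, the laws under $\mathbb P_Z$ converge weakly. Arrivals. $\lambda:\mathbb{R}_+\to\mathbb{R}_+$ and $\psi:\mathbb{R}^d\to\mathbb{R}_+$ are continuous and bounded by a constant $K>0$, and $\psi$ is positive and Lipschitz. For each $\varepsilon>0$, conditionally on $Z$ the arrival times $\{\Gamma_k^{\varepsilon};\,k\ge1\}$ are the points of a Poisson process on $\mathbb{R}_+$ with nonhomogeneous intensity $s\mapsto\lambda(s)\psi(Z_{s/\varepsilon})$. Services. $\nu(s,\mathrm{d}y)$ is a probability kernel from $\mathbb{R}_+$ to $\mathbb{R}_+$. Conditionally on $Z$ and the arrival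 times, the service times $\{L_k^{\varepsilon};\,k\ge1\}$ are independent and $L_k^{\varepsilon}$ has law $\nu(\Gamma_k^{\varepsilon},\mathrm{d}y)$. The complementary cumulative distribution function $\bar F_s(y)=\int_y^\infty\nu(s,\mathrm{d}\tau)=\nu(s,(y,\infty))$, $y\ge 0$, satisfies, for some $\alpha>0$ and $c>0$: $\bar F_s(y)\le c\,(y^{-\alpha}\wedge 1)$ for all $y,s>0$, and $|\bar F_s(y)-\bar F_t(y)|\le c(1+y)^{-1-\alpha}(t-s)$ for all $0<s<t$ and $y>0$. Queue. $N^{\varepsilon}(t)=\sum_{k\ge1}\mathbf 1_{\{\Gamma_k^{\varepsilon}<t<\Gamma_k^{\varepsilon}+L_k^{\varepsilon}\}}$. Limit. $M=\sum_{k\ge1}\delta_{(\Gamma_k,L_k)}$ is a Poisson point process on $\mathbb{R}_+\times\mathbb{R}_+$ with (deterministic) mean measure $\tilde\nu(\mathrm{d}s,\mathrm{d}y)=\bar\psi\,\lambda(s)\,\nu(s,\mathrm{d}y)\,\mathrm{d}s$, and $N(t)=\sum_{k\ge1}\mathbf 1_{\{\Gamma_k<t<\Gamma_k+L_k\}}$; $N$ is independent of $N^{\varepsilon}$. Storage equation (reflected sense). For a path $n:[0,T]\to\mathbb{R}_+$ that is bounded and measurable, a continuous function $x:[0,T]\to\mathbb{R}_+$ solves $\mathrm{d}x=n\,\mathrm{d}t-r\mathbf 1_{\{x>0\}}\mathrm{d}t$, $x(0)=0$, if there is a continuous nondecreasing function $\ell:[0,T]\to\mathbb{R}_+$ with $\ell(0)=0$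 such that $x(t)=\int_0^tn(s)\,\mathrm{d}s-rt+\ell(t)\ge0$ for all $t\in[0,T]$ and $\int_0^T\mathbf 1_{\{x(t)>0\}}\,\mathrm{d}\ell(t)=0$. $C_T$ carries the uniform topology. *)

(* Defs.v *)
From HB Require Import structures.
From mathcomp Require Import all_boot all_order all_algebra.
From mathcomp Require Import all_classical all_reals all_analysis.
From mathcomp Require Import measurable_realfun.
Import Order.TTheory GRing.Theory Num.Theory.
Import numFieldNormedType.Exports.

Set Implicit Arguments.
Unset Strict Implicit.
Unset Printing Implicit Defensive.

Local Open Scope classical_set_scope.
Local Open Scope ring_scope.

Definition Rd (R : realType) (d : nat) := g_sigma_algebraType (@open 'rV[R]_d).

Section sigma_fields.
Context {Om I : Type} {dE} {E : measurableType dE}.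

Definition sigma_family (D : set I) (Y : I -> Om -> E) : set (set Om) :=
  <<s \bigcup_(i in D) preimage_set_system setT (Y i) measurable >>.

End sigma_fields.

Section conditioning.
Local Open Scope ereal_scope.
Context {dO} {Om : measurableType dO} {R : realType} (P : probability Om R).

Definition regular_conditional_probability (G : set (set Om))
    (Q : Om -> probability Om R) : Prop :=
  forall A, measurable A ->
    (forall B : set (\bar R), measurable B -> G ((Q ^~ A) @^-1` B)) /\
    (forall B, G B -> \int[P]_(w in B) Q w A = P (A `&` B)).

Definition independent_sigma_fields (G H : set (set Om)) : Prop :=
  forall A B, G A -> H B -> P (A `&` B) = P A * P B.

End conditioning.

Section environment.
Local Open Scope ereal_scope.
Context {dO} {Om : measurableType dO} {R : realType} (P : probability Om R).
Context {dE} {E : measurableType dE}.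

(* [p t] is the time-homogeneous transition kernel of [Z] over a lapse [t];
   only one-step conditioning is required, not the Markov property. *)
Definition transition_kernels (p : R -> R.-pker E ~> E) (Z : R -> Om -> E) :
    Prop :=
  forall s t : R, (0 <= s)%R -> (0 <= t)%R ->
  forall A B : set E, measurable A -> measurable B ->
    P (Z s @^-1` A `&` Z (s + t)%R @^-1` B)
      = \int[P]_(w in Z s @^-1` A) p t (Z s w) B.

Definition invariant_probability (p : R -> R.-pker E ~> E)
    (pi : probability E R) : Prop :=
  forall t : R, (0 <= t)%R ->
  forall B, measurable B -> \int[pi]_z p t z B = pi B.

Definition unique_invariant_probability (p : R -> R.-pker E ~> E)
    (pi : probability E R) : Prop :=
  invariant_probability p pi /\
  forall mu : probability E R, invariant_probability p mu ->
    forall B, measurable B -> mu B = pi B.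

Definition strongly_ergodic (Z : R -> Om -> E) (psi : E -> R)
    (pi : probability E R) (kappa : R) : Prop :=
  exists C : {mfun Om >-> R}, (forall w, (0 < C w)%R) /\
    {ae P, forall w, forall t : R, (0 < t)%R ->
      (`| t^-1 * (\int[lebesgue_measure]_(u in `[0%R, t]) psi (Z u w))
          - \int[pi]_z psi z | <= C w / (1 + t) `^ kappa)%R}.

End environment.

Section poisson.
Local Open Scope ereal_scope.
Context {dO} {Om : measurableType dO} {R : realType} (P : probability Om R).

(* The second argument of [poisson_prob] is a dummy. For rate 0 the law is the
   Dirac mass at 0, as it should be; [poisson_pmf] is not correct there. *)
Definition poisson_point_process {dE} {E : measurableType dE}
    (mu : set E -> \bar R) (xi : set E -> Om -> \bar R) : Prop :=
  [/\ forall B, measurable B -> measurable_fun setT (xi B),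
      forall B (n : nat), measurable B -> mu B < +oo ->
        P [set w | xi B w = n%:R%:E] = poisson_prob (fine (mu B)) 0 [set n]
    & forall (m : nat) (B : 'I_m -> set E) (A : 'I_m -> set (\bar R)),
        (forall i, measurable (B i)) -> (forall i, measurable (A i)) ->
        trivIset setT B ->
        P (\bigcap_i (xi (B i) @^-1` A i)) = \prod_i P (xi (B i) @^-1` A i)].

(* A Poisson process may have finitely many points, so arrival times are
   extended reals: [G k w = +oo] means that there is no [k]-th point. No
   ordering of the points is assumed. *)
Definition arrival_count (G : nat -> Om -> \bar R) (B : set R) (w : Om) :
    \bar R :=
  \sum_(0 <= k <oo) (\1_(EFin @` B) (G k w))%:E.

Definition marked_count (G : nat -> Om -> \bar R) (L : nat -> Om -> R)
    (B : set (R * R)) (w : Om) : \bar R :=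
  \sum_(0 <= k <oo)
    (\1_((fun p : R * R => (p.1%:E, p.2)) @` B) (G k w, L k w))%:E.

(* Given the arrival times [G], the marks of the actual (finite) arrivals are
   independent and the one at [s] has law [nu s]; nothing is required of [L k]
   when [G k = +oo]. *)
Definition independent_services (nu : R.-pker R ~> R)
    (G : nat -> Om -> \bar R) (L : nat -> Om -> R) : Prop :=
  forall (A : set Om), sigma_family setT G A ->
  forall (n : nat) (B : nat -> set R), (forall k, measurable (B k)) ->
    P (A `&` \bigcap_(k < n) [set w | G k w \is a fin_num -> B k (L k w)])
      = \int[P]_(w in A) \prod_(k < n)
          (if G k w is s%:E then nu s (B k) else 1).

Definition queue (G : nat -> Om -> \bar R) (L : nat -> Om -> R)
    (t : R) (w : Om) : \bar R :=
  \sum_(0 <= k <oo) ((G k w < t%:E < G k w + (L k w)%:E)%E%:R)%:E.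

End poisson.

Section queue_parameters.
Context {R : realType}.

Definition Fbar (nu : R.-pker R ~> R) (s y : R) : R :=
  fine (nu s `]y, +oo[%classic).

Definition arrival_mean (lam : R -> R) (z : R -> R) (B : set R) : \bar R :=
  (\int[lebesgue_measure]_(s in B `&` `[0%R, +oo[) (lam s * z s)%:E)%E.

Definition limit_mean (psibar : R) (lam : R -> R) (nu : R.-pker R ~> R)
    (B : set (R * R)) : \bar R :=
  (\int[lebesgue_measure]_(s in `[0%R, +oo[)
     ((psibar * lam s)%:E * nu s (xsection B s)))%E.

End queue_parameters.

Section storage.
Context {R : realType}.

(* The regulator on [0, T] is extended by constants to a continuous
   nondecreasing function on the line, so that its Lebesgue-Stieltjes measure
   is available. *)
Definition solves_storage (T r : R) (n : R -> \bar R) (x : R -> R) : Prop :=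
  [/\ measurable_fun `[0, T] n,
      exists K : R, forall t, 0 <= t <= T -> (0 <= n t <= K%:E)%E,
      {within `[0, T], continuous x} &
      exists l : cumulative R R,
      [/\ continuous l, l 0 = 0,
          forall t, 0 <= t <= T ->
            x t = fine (\int[lebesgue_measure]_(s in `[0%R, t]) n s)
                  - r * t + l t /\ 0 <= x t &
          (\int[lebesgue_stieltjes_measure l]_(t in `[0%R, T])
             (\1_[set s | (0 < x s)%R] t)%:E = 0)%E]].

(* Functions with the topology of uniform convergence on [0, T]; [CT] is the
   subspace of those continuous on [0, T], whose values elsewhere are
   invisible to the topology. *)
Definition path_space (T : R) := {uniform` `[0, T]%classic -> R}.

Definition CT (T : R) : set (path_space T) :=
  [set x | {within `[0, T], continuous (x : R -> R)}].

Definition random_element_CT {dO} {Om : measurableType dO} (T : R)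
    (X : Om -> path_space T) : Prop :=
  (forall w, CT (X w)) /\
  (forall U : set (path_space T), open U -> measurable (X @^-1` U)).

Definition cvg_in_distribution_CT (T : R) {J : Type} (F : set_system J)
    {d1} {Om1 : measurableType d1} (P1 : probability Om1 R)
    (X1 : J -> Om1 -> path_space T)
    {d2} {Om2 : measurableType d2} (P2 : probability Om2 R)
    (X2 : Om2 -> path_space T) : Prop :=
  forall f : path_space T -> R,
    {within @CT T, continuous f} ->
    (exists K : R, forall x, CT x -> `|f x| <= K) ->
    ('E_P1[f \o X1 j] @[j --> F] --> 'E_P2[f \o X2])%E.

End storage.

(* Main.v *)
Require Import Defs.
From HB Require Import structures.
From mathcomp Require Import all_boot all_order all_algebra.
From mathcomp Require Import all_classical all_reals all_analysis.
From mathcomp Require Import measurable_realfun.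
From mathcomp Require Import ring lra.
Import Order.TTheory GRing.Theory Num.Theory.
Import numFieldNormedType.Exports.

(** The storage path up to time [T] is a function of the set of marked points
    [(arrival, service)] with arrival in [[0, T]]: the cumulated input
    [\int_0^t N(s) ds] adds up the times spent in the system by the jobs, and the
    solution of the storage equation is the Skorokhod reflection of the
    cumulated input minus [r t]. So it suffices to prove that the quenched laws
    of the marked points converge, and this convergence turns out to be strong
    enough, namely setwise, to need only the measurability of the functional,
    not its continuity.

    Given the environment, the marked points form a Poisson configuration whose
    intensity [mu_e (ds, dy) = lam s * psi (Z (s / e)) nu (s, dy) ds] oscillates
    with [e]. Strong ergodicity turns the fast oscillation into an average:
    [mu_e B] converges to [mu B], where [mu] has the constant [\int psi dpi] in
    place of [psi (Z (s / e))], for every Borel set [B] of the plane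
    ([cvg_integral_time_average]). The probability that no point falls in [B]
    is [exp (- mu_e B)] ([points_void_prob]), so all void probabilities
    converge. They determine the law of a configuration
    since the void events form a pi-system. Moreover [mu_e] is at most the
    intensity [mubar] with the constant rate [K ^ 2], and the Poisson law of any
    intensity below [mubar] is dominated by one finite measure, the Poisson
    cloud of [mubar] ([poisson_law_le]). Domination and convergence on a
    pi-system give convergence of the laws on every measurable set
    ([setwise_cvg]) and of the expectations of all bounded measurable functionals
    ([poisson_law_cvg]).

    The void probabilities of the prelimit come from the formula
    [E \prod_k h (G_k) = exp (- \int (1 - h) dm)] for the points [G_k] of a Poisson
    process of intensity [m], where [1 - h s] is the probability that the mark of
    a point at [s] hits [B] ([cvg_arrival_product], [marks_product]). For the
    limit they are part of the definition of a Poisson process.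

    What remains is to write the storage path as a measurable functional of a
    configuration, observed through void events only. Almost surely the
    arrivals in [[0, T]] are finitely many and distinct
    ([simple_arrivals_ae]), so they are separated by a fine partition of
    [[0, T]], and the cumulated input is a supremum over partitions of sums over
    the cells of the largest presence in the cell ([cumulated]). It is Lipschitz
    in time. Its reflection is then Lipschitz too, solves the storage equation
    ([reflect_path_solves]), and is the only solution ([storage_unique]); and
    Lipschitz paths depending measurably on each time are Borel random elements
    for the uniform topology ([random_element_of_coordinates]). *)

Set Implicit Arguments.
Unset Strict Implicit.
Unset Printing Implicit Defensive.

Local Open Scope classical_set_scope.
Local Open Scope ring_scope.

(** * Setwise convergence of dominated measures *)

Section setwise_convergence.
Context d (T : measurableType d) (R : realType).

Lemma fine_measureD (m : {finite_measure set T -> \bar R}) A B :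
  measurable A -> measurable B -> B `<=` A ->
  fine (m (A `\` B)) = fine (m A) - fine (m B).
Proof.
move=> mA mB BA.
have -> : m (A `\` B) = (m A - m B)%E.
  have mAoo : (m A < +oo)%E.
    by rewrite -ge0_fin_numE//; exact: fin_num_measure.
  by rewrite measureD// setIidr.
by rewrite fineB//; exact: fin_num_measure.
Qed.

Lemma fine_le_measure (m : {finite_measure set T -> \bar R}) A B :
  measurable A -> measurable B -> A `<=` B -> fine (m A) <= fine (m B).
Proof.
move=> mA mB AB; apply: fine_le; [exact: fin_num_measure..|].
by apply: le_measure; rewrite ?inE.
Qed.

Variables (nu_ : nat -> {finite_measure set T -> \bar R}).
Variables (nu tau : {finite_measure set T -> \bar R}).

Let cvgs A := fine (nu_ n A) @[n --> \oo] --> fine (nu A).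

(** Domination by one finite measure makes the tails of increasing unions
    uniformly small, so the sets on which the convergence holds form a
    lambda-system, and a generating pi-system decides. *)
Lemma setwise_cvg (G : set (set T)) :
  (forall n A, measurable A -> (nu_ n A <= tau A)%E) ->
  measurable = <<s G >> -> setI_closed G -> cvgs setT -> G `<=` cvgs ->
  forall A, measurable A -> cvgs A.
Proof.
move=> nu_tau GE GI cT Gc A mA.
suff H : <<s G >> `<=` [set A | measurable A /\ cvgs A].
  by move: mA; rewrite GE => /H[].
apply: lambda_system_subset => //; last first.
  by move=> B GB; split; [rewrite GE; exact: sub_gen_smallest|exact: Gc].
split => //.
- move=> B C CB [mB cB] [mC cC]; split; first exact: measurableD.
  rewrite /cvgs fine_measureD//; under eq_fun do rewrite fine_measureD//.
  exact: cvgB.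
- move=> F ndF FH; set U := \bigcup_k F k.
  have mF n : measurable (F n) by case: (FH n).
  have mU : measurable U by exact: bigcup_measurable.
  have FU n : F n `<=` U by exact: bigcup_sup.
  split => //.
  have cm (m : {finite_measure set T -> \bar R}) :
      fine (m (F n)) @[n --> \oo] --> fine (m U).
    apply: fine_cvg; rewrite fineK; last exact: fin_num_measure.
    exact: nondecreasing_cvg_mu.
  apply/cvgrPdist_lt => e e0.
  have e3 : 0 < e / 3 by rewrite divr_gt0.
  move/cvgrPdist_lt : (cm nu) => /(_ _ e3)[N1 _ /= H1].
  move/cvgrPdist_lt : (cm tau) => /(_ _ e3)[N2 _ /= H2].
  pose N := maxn N1 N2.
  have {}H1 : `|fine (nu U) - fine (nu (F N))| < e / 3.
    by apply: H1 => /=; exact: leq_maxl.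
  have {}H2 : fine (tau U) - fine (tau (F N)) < e / 3.
    apply: le_lt_trans (ler_norm _) _.
    by apply: H2 => /=; exact: leq_maxr.
  have [_ /cvgrPdist_lt/(_ _ e3)[N3 _ /= H3]] := FH N.
  near=> n.
  have {}H3 : `|fine (nu (F N)) - fine (nu_ n (F N))| < e / 3.
    by apply: H3 => /=; near: n; exact: nbhs_infty_ge.
  have H4 : 0 <= fine (nu_ n U) - fine (nu_ n (F N)) < e / 3.
    rewrite subr_ge0 fine_le_measure//= -fine_measureD//.
    apply: le_lt_trans H2; rewrite -fine_measureD//.
    have mD : measurable (U `\` F N) by exact: measurableD.
    apply: fine_le; [exact: fin_num_measure..|].
    exact: nu_tau.
  move: H1 H3 H4; rewrite !ltr_norml => /andP[? ?] /andP[? ?] /andP[? ?].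
  apply/andP; split; lra.
Unshelve. all: by end_near. Qed.

(** A function with values in [[0, M]] lies within [1 / k] of its quantization
    by the level sets [{H >= (j + 1) / k}], so setwise convergence passes to
    its integrals. *)
Lemma setwise_cvg_integral (H : T -> R) (M : R) :
  measurable_fun setT H -> (forall x, 0 <= H x <= M) ->
  (forall A, measurable A -> cvgs A) ->
  (\int[nu_ n]_x (H x)%:E)%E @[n --> \oo] --> (\int[nu]_x (H x)%:E)%E.
Proof.
move=> mH H0M cA.
pose lev k j := [set x | j.+1%:R / k.+1%:R <= H x].
have mlev k j : measurable (lev k j).
  have := mH measurableT _ (measurable_itv `[j.+1%:R / k.+1%:R, +oo[).
  rewrite setTI [_ @^-1` _](_ : _ = lev k j)//.
  by apply/seteqP; split => x /=; rewrite in_itv/= andbT.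
pose J k := Num.truncn (M * k.+1%:R).
pose Hk k x : R := \sum_(j < J k) k.+1%:R^-1 * \1_(lev k j) x.
have HkE k x : Hk k x <= H x <= Hk k x + k.+1%:R^-1.
  have kR : 0 < k.+1%:R :> R by [].
  have Hx0 : 0 <= H x by case/andP: (H0M x).
  have -> : Hk k x = (Num.truncn (H x * k.+1%:R))%:R / k.+1%:R.
    rewrite /Hk -big_distrr/= mulrC; congr (_ / _).
    have le1 : (Num.truncn (H x * k.+1%:R) <= J k)%N.
      by apply: le_truncn; rewrite ler_pM2r//; case/andP: (H0M x).
    rewrite -(subnKC le1) big_split_ord/= [X in _ + X]big1 ?addr0.
      under eq_bigr => i _.
        rewrite indicE mem_set; last by rewrite /lev/= ler_pdivrMr// -truncn_gt_nat.
        over.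
      by rewrite sumr_const card_ord.
    move=> i _; rewrite indicE memNset// /lev/= ler_pdivrMr// -truncn_gt_nat.
    by rewrite ltnNge leq_addr.
  rewrite -[X in _ <= _ <= _ + X]mul1r -mulrDl ler_pdivrMr// ler_pdivlMr//.
  by rewrite truncn_le mulr_ge0//= natr1 ltW// truncnS_gt.
have Hk0 k x : 0 <= Hk k x by apply: sumr_ge0 => j _; rewrite mulr_ge0.
have mHk k : measurable_fun setT (Hk k).
  by apply: measurable_sum => j; apply: measurable_funM => //; exact: measurable_indic.
have IHk (m : {finite_measure set T -> \bar R}) k :
    (\int[m]_x (Hk k x)%:E)%E = (\sum_(j < J k) k.+1%:R^-1 * fine (m (lev k j)))%:E.
  under eq_integral do rewrite -sumEFin.
  rewrite ge0_integral_sum//=; last first.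
    by move=> j; apply/measurable_EFinP; apply: measurable_funM => //; exact: measurable_indic.
  rewrite -sumEFin; apply: eq_bigr => j _.
  rewrite (integralZl_indic _ (fun=> lev k j))//; last first.
    by move=> /lt_geF; rewrite invr_ge0 ler0n.
  by rewrite integral_indic// setIT EFinM fineK//; exact: fin_num_measure.
pose S k (m : {finite_measure set T -> \bar R}) :=
  \sum_(j < J k) k.+1%:R^-1 * fine (m (lev k j)).
have IH : forall (m : {finite_measure set T -> \bar R}) k,
    exists2 I, (\int[m]_x (H x)%:E)%E = I%:E &
      S k m <= I <= S k m + k.+1%:R^-1 * fine (m setT).
  move=> m k.
  have H1 : (\int[m]_x (Hk k x)%:E <= \int[m]_x (H x)%:E)%E.
    apply: ge0_le_integral => //.
    - by move=> x _; rewrite lee_fin.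
    - exact/measurable_EFinP.
    - exact/measurable_EFinP.
    - by move=> x _; rewrite lee_fin; case/andP: (HkE k x).
  have H2 : (\int[m]_x (H x)%:E <= \int[m]_x (Hk k x)%:E + (k.+1%:R^-1 * fine (m setT))%:E)%E.
    have -> : (k.+1%:R^-1 * fine (m setT))%:E = (\int[m]_x (k.+1%:R^-1)%:E)%E.
      by rewrite integral_cst// EFinM fineK//; exact: fin_num_measure.
    rewrite -ge0_integralD//; last 2 first.
    - by move=> x _; rewrite lee_fin.
    - exact/measurable_EFinP.
    apply: ge0_le_integral => //.
    - by move=> x _; rewrite lee_fin; case/andP: (H0M x).
    - exact/measurable_EFinP.
    - by apply/measurable_EFinP; exact: measurable_funD.
    - by move=> x _; rewrite lee_fin; case/andP: (HkE k x).
  move: H1 H2; rewrite IHk.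
  case: (integral _ _ _) => [I| |]//; rewrite !lee_fin => h1 h2.
  by exists I => //; rewrite h1.
pose I (m : {finite_measure set T -> \bar R}) := fine (\int[m]_x (H x)%:E)%E.
have IE (m : {finite_measure set T -> \bar R}) : (\int[m]_x (H x)%:E)%E = (I m)%:E.
  by rewrite /I; have [J' -> _] := IH m 0%N.
rewrite IE; under eq_fun do rewrite IE.
apply: cvg_EFin; first by near=> n.
rewrite [X in X @ \oo --> _](_ : _ = I \o nu_); last by apply/funext => n.
apply/cvgrPdist_lt => e e0.
have B0 : 0 < fine (nu setT) + 1 by rewrite ltr_wpDl// fine_ge0.
have /cvgrPdist_lt/(_ _ ltr01)[N1 _ /= H1] := cA _ measurableT.
pose k := Num.truncn (3 * (fine (nu setT) + 1) / e).
have ke : k.+1%:R^-1 * (fine (nu setT) + 1) < e / 3.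
  have : 3 * (fine (nu setT) + 1) / e < k.+1%:R by exact: truncnS_gt.
  by rewrite ltr_pdivrMr// => h; rewrite mulrC ltr_pdivrMr//; lra.
have : S k (nu_ n) @[n --> \oo] --> S k nu.
  by apply: cvg_big => [|j _]; [exact: add_continuous|apply: cvgMr; exact: cA].
have e3 : 0 < e / 3 by rewrite divr_gt0.
move=> /cvgrPdist_lt/(_ _ e3)[N2 _ /= H2].
near=> n.
have {}H1 : `|fine (nu setT) - fine (nu_ n setT)| < 1.
  by apply: H1; near: n; exact: nbhs_infty_ge.
have {}H2 : `|S k nu - S k (nu_ n)| < e / 3.
  by apply: H2; near: n; exact: nbhs_infty_ge.
have [I1 + B1] := IH nu k; rewrite IE => -[I1E].
have [I2 + B2] := IH (nu_ n) k; rewrite IE => -[I2E].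
rewrite I1E I2E.
have B3 : k.+1%:R^-1 * fine (nu setT) < e / 3.
  by apply: le_lt_trans ke; rewrite ler_pM2l ?invr_gt0// lerDl.
have B4 : k.+1%:R^-1 * fine (nu_ n setT) < e / 3.
  apply: le_lt_trans ke; rewrite ler_pM2l ?invr_gt0//.
  by move: H1; rewrite ltr_norml => /andP[]; lra.
move: B1 B2 H2 B3 B4; rewrite !ltr_norml.
move: (k.+1%:R^-1 * _) (k.+1%:R^-1 * _) (S k nu) (S k (nu_ n)) => c1 c2 s1 s2.
move=> /andP[? ?] /andP[? ?] /andP[? ?] ? ?; clear ke B0 H1; apply/andP; split; lra.
Unshelve. all: by end_near. Qed.

End setwise_convergence.

(** * Time averages of an ergodic environment *)

(** The image measure, with the measurability proof as an argument: the
    structure of [pushforward] cannot be inferred from the map alone. *)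
Definition image_measure d d' (T1 : measurableType d) (T2 : measurableType d')
    (R : realType) (m : {measure set T1 -> \bar R}) (f : T1 -> T2)
    (mf : measurable_fun setT f) : {measure set T2 -> \bar R} :=
  measure_function_pushforward__canonical__measure_function_Measure m mf.

Section mixture.
Local Open Scope ereal_scope.
Context d1 d2 (S : measurableType d1) (E : measurableType d2) (R : realType).
Variables (mu : {measure set S -> \bar R}) (h : S -> R).
Variable k : S -> {measure set E -> \bar R}.
Import HBNNSimple.

(** One construction covers the measures with a density (Dirac kernels), the
    intensities of marked points and the laws weighted by a functional. *)
Definition mixture (h0 : forall s, (0 <= h s)%R)
    (mh : measurable_fun setT h)
    (mk : forall B, measurable B -> measurable_fun setT (k ^~ B))
    (hoo : \int[mu]_s ((h s)%:E * k s setT) < +oo) : set E -> \bar R :=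
  fun B => \int[mu]_s ((h s)%:E * k s B).

Hypotheses (h0 : forall s, (0 <= h s)%R) (mh : measurable_fun setT h)
  (mk : forall B, measurable B -> measurable_fun setT (k ^~ B))
  (hoo : \int[mu]_s ((h s)%:E * k s setT) < +oo).

Let mix := mixture h0 mh mk hoo.

Let hk0 s B : 0 <= (h s)%:E * k s B.
Proof. by rewrite mule_ge0// lee_fin. Qed.

Let mhk B : measurable B -> measurable_fun setT (fun s => (h s)%:E * k s B).
Proof.
by move=> mB; apply: emeasurable_funM; [exact/measurable_EFinP|exact: mk].
Qed.

Let mix0 : mix set0 = 0.
Proof. by apply: integral0_eq => s _; rewrite measure0 mule0. Qed.

Let mix_ge0 B : 0 <= mix B.
Proof. exact: integral_ge0. Qed.

Let mix_sigma_additive : semi_sigma_additive mix.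
Proof.
move=> F mF tF mUF.
rewrite [X in _ --> X](_ : _ = \sum_(n <oo) mix (F n)).
  by apply/cvg_closeP; split; [exact: is_cvg_nneseries|rewrite closeE].
rewrite -integral_nneseries//; last by move=> n; exact: mhk.
apply: eq_integral => s _; rewrite nneseriesZl//; congr (_ * _).
by apply/esym/cvg_lim => //; exact: measure_semi_sigma_additive.
Qed.

HB.instance Definition _ :=
  isMeasure.Build _ _ _ (mixture h0 mh mk hoo) mix0 mix_ge0 mix_sigma_additive.

Let mix_fin : fin_num_fun mix.
Proof.
move=> B mB; rewrite ge0_fin_numE//; apply: le_lt_trans hoo.
apply: ge0_le_integral => //; [exact: mhk|exact: mhk|].
by move=> s _; rewrite lee_wpmul2l ?lee_fin// le_measure// inE.
Qed.

HB.instance Definition _ :=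
  Measure_isFinite.Build _ _ _ (mixture h0 mh mk hoo) mix_fin.

Lemma ge0_integral_mixture (f : E -> R) :
  measurable_fun setT f -> (forall x, (0 <= f x)%R) ->
  \int[mixture h0 mh mk hoo]_x (f x)%:E
    = \int[mu]_s ((h s)%:E * \int[k s]_x (f x)%:E).
Proof.
move=> mf f0.
have mf' : measurable_fun setT (EFin \o f) by exact/measurable_EFinP.
pose f_ := nnsfun_approx measurableT mf'.
have f_f x : (f_ n x)%:E @[n --> \oo] --> (f x)%:E.
  by apply: (cvg_nnsfun_approx measurableT mf') => // ? _; rewrite lee_fin.
have f_nd x m n : (m <= n)%N -> (f_ m x)%:E <= (f_ n x)%:E.
  by move=> mn; rewrite lee_fin; exact/lefP/nd_nnsfun_approx.
have lim_int (m : {measure set E -> \bar R}) :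
    \int[m]_x (f x)%:E = limn (fun n => \int[m]_x (f_ n x)%:E).
  rewrite -monotone_convergence//.
  - by apply: eq_integral => x _; apply/esym/cvg_lim => //; exact: f_f.
  - by move=> n; exact/measurable_EFinP.
  - by move=> n x _; rewrite lee_fin.
  - by move=> x _ m1 m2; exact: f_nd.
have sfE (m : {measure set E -> \bar R}) n :
    \int[m]_x (f_ n x)%:E = \sum_(r \in range (f_ n)) r%:E * m (f_ n @^-1` [set r]).
  by rewrite integral_nnsfun// patch_setT sintegralE.
have r0 n r : range (f_ n) r -> (0 <= r)%R by move=> [x _ <-].
have mr n r : measurable_fun setT
    (fun s => r%:E * ((h s)%:E * k s (f_ n @^-1` [set r]))).
  by apply: emeasurable_funM => //; exact: mhk.
have swap n : \int[mixture h0 mh mk hoo]_x (f_ n x)%:E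
    = \int[mu]_s ((h s)%:E * \int[k s]_x (f_ n x)%:E).
  have E1 s : (h s)%:E * \int[k s]_x (f_ n x)%:E =
      \sum_(r \in range (f_ n)) (r%:E * ((h s)%:E * k s (f_ n @^-1` [set r]))).
    rewrite sfE ge0_mule_fsumr; last by move=> r; exact: nnsfun_mulemu_ge0.
    by apply: eq_fsbigr => r _; rewrite muleCA.
  rewrite sfE; under [RHS]eq_integral do rewrite E1.
  rewrite ge0_integral_fsum//; last first.
    move=> r s _; rewrite muleCA mule_ge0// ?lee_fin//; exact: nnsfun_mulemu_ge0.
  apply: eq_fsbigr => r /[!inE] /r0 r_ge0.
  by rewrite ge0_integralZl// ?lee_fin//; exact: mhk.
have mkf n : measurable_fun setT (fun s => \int[k s]_x (f_ n x)%:E).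
  under eq_fun do rewrite sfE.
  apply: emeasurable_fsum => // r; apply: emeasurable_funM => //; exact: mk.
have ndI s n1 n2 : (n1 <= n2)%N ->
    \int[k s]_x (f_ n1 x)%:E <= \int[k s]_x (f_ n2 x)%:E.
  move=> n12; apply: ge0_le_integral => //.
  - by move=> x _; rewrite lee_fin.
  - exact/measurable_EFinP.
  - exact/measurable_EFinP.
  - by move=> x _; exact: f_nd.
rewrite lim_int; under eq_fun do rewrite swap.
rewrite -monotone_convergence//.
- apply: eq_integral => s _; apply/cvg_lim => //.
  by apply: cvgeZl => //; rewrite lim_int;
    apply: ereal_nondecreasing_is_cvgn => ? ?; exact: ndI.
- by move=> n; apply: emeasurable_funM => //; exact/measurable_EFinP.
- by move=> n s _; rewrite mule_ge0 ?lee_fin// integral_ge0// => x _; rewrite lee_fin.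
- by move=> s _ n1 n2 n12; rewrite lee_wpmul2l ?lee_fin// ndI.
Qed.

End mixture.

Section time_averages.
Context (R : realType).
Local Notation mu := (@lebesgue_measure R).

Lemma measurable_nneg : measurable [set u : R | 0 <= u].
Proof.
rewrite [X in measurable X](_ : _ = `[0, +oo[%classic)//.
by apply/seteqP; split => x /=; rewrite in_itv/= andbT.
Qed.

Lemma lebesgue_measure_scale (e : R) (A : set R) : 0 < e -> measurable A ->
  mu A = (e%:E * mu (( *%R e) @^-1` A))%E.
Proof.
move=> e0 mA.
have me : measurable_fun [set: measurableTypeR R] ( *%R e : measurableTypeR R -> measurableTypeR R).
  exact: mulrl_measurable.
rewrite (lebesgue_measure_unique (mu := mscale (NngNum (ltW e0)) (image_measure mu me)))//.
move=> _ [[a b]] _ <-/=.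
rewrite /mscale/= /pushforward.
have -> : *%R e @^-1` [set` `]a, b]%R] = [set` `]a / e, b / e]%R].
  apply/seteqP; split => x /=; rewrite !in_itv/= ltr_pdivrMr// ler_pdivlMr// mulrC//.
rewrite !lebesgue_measure_itv/= !lte_fin ltr_pM2r ?invr_gt0//.
case: ifPn => _; last by rewrite mule0.
rewrite -EFinD -EFinM; congr EFin; field.
by rewrite gt_eqF.
Qed.

(** Time change [s = e u]: the occupation integral over [[0, t]] of the sped-up
    path is [e] times the one of the original path over [[0, t / e]]. *)
Lemma ge0_integral_time_change (z : R -> R) (e t : R) : 0 < e -> 0 <= t ->
  measurable_fun [set u : R | 0 <= u] z -> (forall u, 0 <= u -> 0 <= z u) ->
  (\int[mu]_(s in `[0%R, t]) (z (s / e)%R)%:E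
   = e%:E * \int[mu]_(u in `[0%R, (t / e)%R]) (z u)%:E)%E.
Proof.
move=> e0 t0 mz z0.
have me : measurable_fun [set: measurableTypeR R] ( *%R e : measurableTypeR R -> measurableTypeR R).
  exact: mulrl_measurable.
have mze : measurable_fun (`[0%R, t]%classic : set R) (fun s => (z (s / e))%:E).
  apply/measurable_EFinP; apply: (measurable_comp (F := [set u : R | 0 <= u])) => //.
  - exact: measurable_nneg.
  - by move=> _ [s /=] + <-; rewrite in_itv/= => /andP[s0 _]; rewrite divr_ge0// ltW.
  - by apply: measurable_funM => //; exact: measurable_id.
rewrite (eq_measure_integral (mscale (NngNum (ltW e0)) (image_measure mu me)))//; last first.
  by move=> A mA _; exact: lebesgue_measure_scale.
rewrite ge0_integral_mscale//; last first.
  move=> s /=; rewrite in_itv/= => /andP[s0 _]; rewrite lee_fin z0//.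
  by rewrite divr_ge0// ltW.
congr (_ * _)%E.
rewrite ge0_integral_pushforward//; last first.
  move=> s /=; rewrite inE/= in_itv/= => /andP[s0 _]; rewrite lee_fin z0//.
  by rewrite divr_ge0// ltW.
rewrite [X in integral _ X _](_ : _ = `[0, t / e]%classic); last first.
  apply/seteqP; split => x /=; rewrite !in_itv/= pmulr_rge0// ler_pdivlMr// mulrC//.
by apply: eq_integral => u _ /=; rewrite mulrAC divff ?mul1r// gt_eqF.
Qed.

Lemma bounded_integral_fin_num (f : R -> R) (K a b : R) :
  measurable_fun (`[a, b]%classic : set R) f -> (forall u, u \in `[a, b] -> 0 <= f u <= K) ->
  (\int[mu]_(u in `[a, b]) (f u)%:E)%E \is a fin_num.
Proof.
move=> mf fK; rewrite ge0_fin_numE; last first.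
  by apply: integral_ge0 => u /= uab; rewrite lee_fin; case/andP: (fK _ uab).
apply: (@le_lt_trans _ _ (\int[mu]_(u in `[a, b]) K%:E)%E).
  apply: ge0_le_integral => //.
  - by move=> u /= uab; rewrite lee_fin; case/andP: (fK _ uab).
  - exact/measurable_EFinP.
  - by move=> u /= uab; rewrite lee_fin; case/andP: (fK _ uab).
rewrite integral_cst//= lebesgue_measure_itv/=.
by case: ifP => _; rewrite -?EFinD -?EFinM ?mule0 ltry.
Qed.

(** The ergodic bound is applied to the original path over [[0, t / e]], whose
    length grows to infinity. *)
Lemma cvg_time_average (z : R -> R) (K C kappa zbar : R) (e_ : nat -> R) :
  measurable_fun [set u : R | 0 <= u] z -> (forall u, 0 <= u -> 0 <= z u <= K) ->
  0 < C -> 0 < kappa ->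
  (forall t, 0 < t -> `|t^-1 * (\int[mu]_(u in `[0, t]) z u)%R - zbar|
      <= C / (1 + t) `^ kappa) ->
  (forall n, 0 < e_ n) -> e_ n @[n --> \oo] --> 0 ->
  forall t, 0 <= t ->
  (\int[mu]_(s in `[0, t]) z (s / e_ n))%R @[n --> \oo] --> t * zbar.
Proof.
move=> mz zK C0 kappa0 erg e0 e_0 t t0.
have E n : (\int[mu]_(s in `[0, t]) z (s / e_ n))%R =
    e_ n * (\int[mu]_(u in `[0, t / e_ n]) z u)%R.
  rewrite /Rintegral ge0_integral_time_change//; last first.
    by move=> u u0; case/andP: (zK _ u0).
  rewrite fineM//; apply: (@bounded_integral_fin_num z K) => //.
    apply: measurable_funS mz; first exact: measurable_nneg.
    by move=> u; rewrite /= in_itv/= => /andP[].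
  by move=> u; rewrite in_itv/= => /andP[u0 _]; exact: zK.
have [->|tn0] := eqVneq t 0.
  rewrite mul0r set_itv1.
  under eq_fun do rewrite Rintegral_set1; exact: cvg_cst.
have {}t0 : 0 < t by rewrite lt_neqAle eq_sym tn0.
have B n : `|(\int[mu]_(s in `[0, t]) z (s / e_ n))%R - t * zbar| <=
    t * (C / (1 + t / e_ n) `^ kappa).
  have := erg _ (divr_gt0 t0 (e0 n)); rewrite E.
  move: (Rintegral _ _ _) => I.
  have -> : e_ n * I - t * zbar = t * ((t / e_ n)^-1 * I - zbar).
    by field; rewrite !gt_eqF.
  by rewrite normrM (gtr0_norm t0) ler_pM2l.
apply/cvgrPdist_le => eps eps0.
pose M := (t * C / eps) `^ kappa^-1.
have tCe : 0 < t * C / eps by rewrite divr_gt0// mulr_gt0.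
have M0 : 0 < M by rewrite powR_gt0.
have /cvgrPdist_le/(_ _ (divr_gt0 t0 M0)) e_small := e_0.
near=> n; rewrite distrC; apply: le_trans (B n) _.
have en : e_ n <= t / M.
  have : `|0 - e_ n| <= t / M by near: n.
  by rewrite sub0r normrN gtr0_norm.
have Me : M <= 1 + t / e_ n.
  rewrite ler_wpDl// ler_pdivlMr// mulrC -ler_pdivlMr//.
have p0 : 0 < (1 + t / e_ n) `^ kappa by rewrite powR_gt0// addr_gt0// divr_gt0.
rewrite mulrA ler_pdivrMr// [eps * _]mulrC -ler_pdivrMr//.
have -> : t * C / eps = M `^ kappa.
  by rewrite -powRrM mulVf ?gt_eqF// powRr1// ltW.
apply: ge0_ler_powR; rewrite ?nnegrE ?(ltW M0)//; first exact: ltW.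
by rewrite addr_ge0// divr_ge0// ltW.
Unshelve. all: by end_near. Qed.

End time_averages.

Section weak_limit_of_densities.
Context (R : realType).
Local Notation mu := (@lebesgue_measure R).

(** The measure with density [g] on [[0, T]], as the mixture of Dirac masses. *)
Lemma density_measure_exists (g : R -> R) (K T : R) :
  measurable_fun (`[0, T]%classic : set R) g ->
  (forall s, s \in `[0, T] -> 0 <= g s <= K) ->
  exists kap : {finite_measure set R -> \bar R}, forall f : R -> R,
    measurable_fun setT f -> (forall s, 0 <= f s) ->
    (\int[kap]_s (f s)%:E = \int[mu]_(s in `[0%R, T]) (g s * f s)%:E)%E.
Proof.
move=> mg gK; pose h : R -> R := g \_ `[0, T].
have h0 s : 0 <= h s.
  by rewrite /h patchE; case: ifPn => //; rewrite inE => /gK /andP[].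
have mh : measurable_fun setT h by exact/(measurable_restrictT _ _).1.
pose k (s : R) : {measure set R -> \bar R} := \d_s.
have mk B : measurable B -> measurable_fun setT (k ^~ B).
  by move=> mB; exact: measurable_fun_dirac.
have int_h (f : R -> R) :
    (\int[mu]_s ((h s)%:E * (f s)%:E) = \int[mu]_(s in `[0%R, T]) (g s * f s)%:E)%E.
  rewrite [RHS]integral_mkcond; apply: eq_integral => s _.
  by rewrite /h !patchE; case: ifPn => // _; rewrite mul0e.
have hoo : (\int[mu]_s ((h s)%:E * k s setT) < +oo)%E.
  under eq_integral do rewrite /k /= diracT.
  rewrite (int_h (cst 1)); under eq_integral do rewrite mulr1.
  by rewrite ltey_eq (bounded_integral_fin_num mg gK).
exists (mixture (S := measurableTypeR R) (mu := mu) (k := k) h0 mh mk hoo) => f mf f0.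
rewrite ge0_integral_mixture// -int_h; apply: eq_integral => s _; congr (_ * _)%E.
by rewrite integral_dirac//= ?diracT ?mul1e//; exact/measurable_EFinP.
Qed.

Lemma integral_ray0 (g : R -> R) (T t : R) : t <= 0 ->
  (\int[mu]_(s in `[0%R, T]) (g s * \1_(`]-oo, t[%classic) s)%:E = 0)%E.
Proof.
move=> t0; apply: integral0_eq => s /=; rewrite in_itv/= => /andP[s0 _].
by rewrite indicE memNset ?mulr0//= in_itv/=; apply/negP; rewrite -leNgt (le_trans t0).
Qed.

Lemma integral_ray (g : R -> R) (K T t : R) : 0 < t ->
  (forall s, s \in `[0, T] -> 0 <= g s <= K) ->
  measurable_fun (`[0, T]%classic : set R) g ->
  (\int[mu]_(s in `[0%R, T]) (g s * \1_(`]-oo, t[%classic) s)%:E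
   = \int[mu]_(s in `[0%R, Num.min t T]) (g s)%:E)%E.
Proof.
move=> t0 gK mg.
transitivity (\int[mu]_(s in `[0%R, T] `&` `]-oo, t[) (g s)%:E)%E.
  rewrite integral_mkcondr; apply: eq_integral => s _.
  by rewrite patchE indicE; case: ifPn => _; rewrite ?mulr1 ?mulr0.
have [tT|Tt] := leP t T; last first.
  congr integral; apply/seteqP; split => s /=; first by case.
  by move=> sT; split => //; move: sT; rewrite !in_itv/= => /andP[_ /le_lt_trans]; apply.
rewrite -integral_itv_bndo_bndc.
  congr integral; apply/seteqP; split => s /=; rewrite !in_itv/=.
    by move=> [/andP[-> _]].
  by move=> /andP[-> st]; split => //; rewrite (le_trans (ltW st)).
apply/measurable_EFinP; apply: measurable_funS mg => //.
by move=> s /=; rewrite !in_itv/= => /andP[-> /ltW/le_trans]; apply.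
Qed.

(** The measures with densities [z (s / e_ n)] converge on rays and are
    dominated by [K] times the Lebesgue measure; they converge setwise, so the
    weight [H] may be any bounded measurable function. *)
Lemma cvg_integral_time_average (z H : R -> R) (K M C kappa zbar T : R) (e_ : nat -> R) :
  measurable_fun [set u : R | 0 <= u] z -> (forall u, 0 <= u -> 0 <= z u <= K) ->
  0 < C -> 0 < kappa -> 0 <= T -> 0 <= zbar ->
  (forall t, 0 < t -> `|t^-1 * (\int[mu]_(u in `[0, t]) z u)%R - zbar|
      <= C / (1 + t) `^ kappa) ->
  (forall n, 0 < e_ n) -> e_ n @[n --> \oo] --> 0 ->
  measurable_fun setT H -> (forall s, 0 <= H s <= M) ->
  (\int[mu]_(s in `[0%R, T]) (z (s / e_ n)%R * H s)%:E)%E @[n --> \oo] -->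
  (\int[mu]_(s in `[0%R, T]) (zbar * H s)%:E)%E.
Proof.
move=> mz zK C0 kappa0 T0 zbar0 erg e0 e_0 mH HM.
have mze n : measurable_fun (`[0, T]%classic : set R) (fun s => z (s / e_ n)).
  apply: (measurable_comp (F := [set u : R | 0 <= u])) => //.
  - exact: measurable_nneg.
  - by move=> _ [s /=] + <-; rewrite in_itv/= => /andP[s0 _]; rewrite divr_ge0// ltW.
  - by apply: measurable_funM => //; exact: measurable_id.
have zeK n s : s \in `[0, T] -> 0 <= z (s / e_ n) <= K.
  by rewrite in_itv/= => /andP[s0 _]; apply: zK; rewrite divr_ge0// ltW.
have /choice[kap_ kap_E] n := density_measure_exists (mze n) (zeK n).
have zb s : s \in `[0, T] -> 0 <= zbar <= zbar by rewrite zbar0 lexx.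
have [kap kapE] := density_measure_exists (@measurable_cst _ _ _ _ (`[0, T]%classic : set R) zbar) zb.
have Kb s : s \in `[0, T] -> 0 <= K <= K.
  by move=> _; rewrite lexx andbT; case/andP: (zK _ (lexx 0)) => /le_trans; apply.
have [tau tauE] := density_measure_exists (@measurable_cst _ _ _ _ (`[0, T]%classic : set R) K) Kb.
have H0 s : 0 <= H s by case/andP: (HM s).
rewrite -kapE//; under eq_fun do rewrite -kap_E//.
apply: (setwise_cvg_integral mH HM).
have indE (k : {finite_measure set R -> \bar R}) A : measurable A ->
    k A = (\int[k]_s (\1_A s)%:E)%E.
  by move=> mA; rewrite integral_indic// setIT.
have ind0 (A : set R) s : 0 <= \1_A s :> R by [].
have fin_conv t : fine (kap_ n `]-oo, t[%classic) @[n --> \oo] --> fine (kap `]-oo, t[%classic).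
  have E1 : kap `]-oo, t[%classic =
      (\int[mu]_(s in `[0%R, T]) (zbar * \1_(`]-oo, t[%classic) s)%:E)%E.
    by rewrite indE// kapE.
  have E2 n : kap_ n `]-oo, t[%classic =
      (\int[mu]_(s in `[0%R, T]) (z (s / e_ n)%R * \1_(`]-oo, t[%classic) s)%:E)%E.
    by rewrite indE// kap_E.
  have [t0|t0] := leP t 0.
    have E3 : kap_ ^~ `]-oo, t[%classic = cst 0%E.
      by apply/funext => n; rewrite E2 (integral_ray0 (fun s => z (s / e_ n))).
    have -> : (fun n => fine (kap_ n `]-oo, t[%classic)) = fine \o cst 0%E by rewrite -E3.
    by rewrite E1 (integral_ray0 (cst zbar))//; exact: cvg_cst.
  have E4 := integral_ray t0 zb (@measurable_cst _ _ _ _ (`[0, T]%classic : set R) zbar).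
  rewrite E1 E4.
  have E3 n : kap_ n `]-oo, t[%classic =
      (\int[mu]_(s in `[0%R, Num.min t T]) (z (s / e_ n)%R)%:E)%E.
    by rewrite E2 (integral_ray t0 (zeK n) (mze n)).
  rewrite (_ : (fun n => fine (kap_ n `]-oo, t[%classic)) = fun n =>
      (\int[mu]_(s in `[0%R, Num.min t T]) (z (s / e_ n)))%R); last first.
    by apply/funext => n; rewrite E3.
  have t1 : 0 <= Num.min t T by rewrite le_min (ltW t0).
  have := cvg_time_average mz zK C0 kappa0 erg e0 e_0 t1.
  rewrite /Rintegral.
  congr (_ @[_ --> _] --> _).
  rewrite integral_cst//= lebesgue_measure_itv/= lte_fin.
  case: ltgtP t1 => // [_ _|<- _]; last by rewrite mul0r mule0.
  by rewrite -EFinD subr0 -EFinM/= mulrC.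
have cvgT : fine (kap_ n setT) @[n --> \oo] --> fine (kap setT).
  have setTE (k : {finite_measure set R -> \bar R}) (g : R -> R) :
      (forall f : R -> R, measurable_fun setT f -> (forall s, 0 <= f s) ->
    (\int[k]_s (f s)%:E = \int[mu]_(s in `[0%R, T]) (g s * f s)%:E)%E) ->
      k setT = k `]-oo, T + 1[%classic.
    move=> kE; rewrite !indE// !kE//.
    apply: eq_integral => s; rewrite inE/= in_itv/= => /andP[s0 sT].
    by rewrite !indicE mem_set//= mem_set//= in_itv/= ltr_pwDr.
  rewrite (setTE _ _ kapE); under eq_fun => n do rewrite (setTE _ _ (kap_E n)).
  exact: fin_conv.
apply: (setwise_cvg (tau := tau)).
- move=> n A mA; rewrite !indE// kap_E ?tauE//.
  apply: ge0_le_integral => //.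
  + by move=> s /= sT; rewrite lee_fin mulr_ge0//; case/andP: (zeK n s sT).
  + by apply/measurable_EFinP; apply: measurable_funM => //; exact: mze.
  + by apply/measurable_EFinP; exact: measurable_funM.
  + move=> s /= sT; rewrite lee_fin ler_wpM2r//; case/andP: (zeK n s sT) => //.
- exact: RGenInftyO.measurableE.
- move=> _ _ [x ->] [y ->]; exists (Num.min x y).
  by apply/seteqP; split => s /=; rewrite !in_itv/= lt_min => /andP.
- exact: cvgT.
- by move=> _ [x ->]; exact: fin_conv.
Qed.

End weak_limit_of_densities.

(** * Laws of Poisson configurations *)

Section configurations.
Context d (E : measurableType d).

Definition void (B : set E) : set (set E) := [set C | C `&` B = set0].

Definition void_events : set_system (set E) := void @` measurable.

(** Configurations are arbitrary subsets, without multiplicities, and the only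
    observables are the void events: this is what makes the avoidance
    probabilities determine a law. *)
Definition config := g_sigma_algebraType void_events.

Lemma measurable_void (B : set E) :
  measurable B -> measurable (void B : set config).
Proof. by move=> mB; apply: sub_sigma_algebra; exists B. Qed.

Lemma void0 : void set0 = setT.
Proof. by apply/seteqP; split => C //= _; rewrite /void/= setI0. Qed.

Lemma setI_void (A B : set E) : void A `&` void B = void (A `|` B).
Proof.
apply/seteqP; split => C; rewrite /void /= setIUr.
  by move=> [-> ->]; rewrite setU0.
by rewrite setU_eq0 => -[-> ->].
Qed.

Lemma setI_closed_void_events : setI_closed void_events.
Proof.
move=> _ _ [A mA <-] [B mB <-]; rewrite setI_void; exists (A `|` B) => //.
exact: measurableU.
Qed.

Lemma measurable_config (d' : measure_display) (S : measurableType d') (f : S -> config) :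
  (forall B, measurable B -> measurable (f @^-1` void B)) ->
  measurable_fun setT f.
Proof.
move=> mf; apply: (measurability (void_events : set (set config))) => //.
by move=> _ [_ [B mB <-] <-]; rewrite setTI; exact: mf.
Qed.

Definition add_point (Cx : config * E) : config := Cx.1 `|` [set Cx.2].

Lemma preimage_add_point_void B :
  add_point @^-1` void B = void B `*` ~` B.
Proof.
apply/seteqP; split => -[C x]; rewrite /void /add_point /= setIUl.
  rewrite setU_eq0 => -[-> xB]; split => // Bx.
  by have : (set0 : set E) x by rewrite -xB.
move=> [-> NBx]; rewrite set0U; apply/seteqP; split => // y [/= -> By].
exact: NBx.
Qed.

Lemma measurable_add_point : measurable_fun setT add_point.
Proof.
apply: measurable_config => B mB; rewrite preimage_add_point_void.
by apply: measurableX; [exact: measurable_void|exact: measurableC].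
Qed.

End configurations.

Section poisson_cloud.
Local Open Scope ereal_scope.
Context d (E : measurableType d) (R : realType).
Implicit Types mu : {finite_measure set E -> \bar R}.

(** The image of the product measure [mu^n] under [(x_1, ..., x_n)] mapped to
    [{x_1, ..., x_n}]. *)
Fixpoint sample mu n : {measure set (config E) -> \bar R} :=
  if n is m.+1 then image_measure (sample mu m \x mu) (@measurable_add_point _ E)
  else \d_(set0 : config E).

(** The Poisson law without its normalization [exp (- mu E)]. Unlike the law, it
    is nondecreasing in [mu]. *)
Definition poisson_cloud mu : set (config E) -> \bar R :=
  mseries (fun n => mscale ((n`!%:R^-1)%:nng)%R (sample mu n)) 0.

Lemma sample_void mu n B : measurable B ->
  sample mu n (void B) = (fine (mu (~` B)) ^+ n)%:E.
Proof.
move=> mB; elim: n => [|n ih]/=.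
  by rewrite diracE mem_set// /void/= set0I.
rewrite /pushforward preimage_add_point_void product_measure1E//; last 2 first.
- exact: measurable_void.
- exact: measurableC.
by rewrite ih exprSr EFinM fineK//; apply: fin_num_measure; exact: measurableC.
Qed.

Lemma le_sample mu mu' n A :
  (forall B, measurable B -> mu B <= mu' B) ->
  measurable A -> sample mu n A <= sample mu' n A.
Proof.
move=> le_mu; elim: n A => [//|n ih] A mA /=.
rewrite /pushforward; set A' := _ @^-1` A.
have mA' : measurable A' by rewrite -[A']setTI; exact: measurable_add_point.
rewrite /product_measure1.
apply: (@le_trans _ _ (\int[sample mu n]_C mu' (xsection A' C))).
  apply: ge0_le_integral => //.
  - exact: measurable_fun_xsection.
  - exact: measurable_fun_xsection.
  - by move=> C _; apply: le_mu; exact: measurable_xsection.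
by apply: ge0_le_measure_integral => //; exact: measurable_fun_xsection.
Qed.

Lemma nneseries_exp_coeff (x : R) :
  \sum_(0 <= n <oo) (exp_coeff x n)%:E = (expR x)%:E.
Proof.
rewrite /expR -EFin_lim; last exact: is_cvg_series_exp_coeff.
by congr (limn _); apply/funext => n; rewrite /= -sumEFin.
Qed.

Lemma poisson_cloud_void mu B : measurable B ->
  poisson_cloud mu (void B) = (expR (fine (mu (~` B))))%:E.
Proof.
move=> mB; rewrite /poisson_cloud /mseries.
rewrite (eq_eseriesr (g := fun n => (exp_coeff (fine (mu (~` B))) n)%:E)); last first.
  move=> n _; transitivity ((n`!%:R^-1)%:E * sample mu n (void B)) => //.
  by rewrite sample_void// -EFinM exp_coeffE/= mulrC.
exact: nneseries_exp_coeff.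
Qed.

Lemma poisson_cloud_fin mu : fin_num_fun (poisson_cloud mu).
Proof.
move=> A mA; rewrite ge0_fin_numE ?measure_ge0//.
apply: (@le_lt_trans _ _ (poisson_cloud mu setT)).
  by apply: le_measure; rewrite ?inE.
by rewrite -[setT]void0 poisson_cloud_void// ltry.
Qed.

HB.instance Definition _ mu := Measure.on (poisson_cloud mu).
HB.instance Definition _ mu :=
  Measure_isFinite.Build _ _ _ (poisson_cloud mu) (poisson_cloud_fin mu).

Lemma le_poisson_cloud mu mu' A :
  (forall B, measurable B -> mu B <= mu' B) ->
  measurable A -> poisson_cloud mu A <= poisson_cloud mu' A.
Proof.
move=> le_mu mA; apply: lee_nneseries => n _.
  by rewrite mule_ge0// lee_fin.
by apply: lee_wpmul2l; [rewrite lee_fin|exact: le_sample].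
Qed.

(** Void probabilities determine a law on configurations, since the void
    events form a pi-system; the normalized cloud has those of a Poisson
    process. *)
Lemma poisson_lawE mu (m : {finite_measure set (config E) -> \bar R}) A :
  (forall B, measurable B -> m (void B) = (expR (- fine (mu B)))%:E) ->
  measurable A -> m A = (expR (- fine (mu setT)))%:E * poisson_cloud mu A.
Proof.
move=> mV mA.
pose m' := mscale (NngNum (expR_ge0 (- fine (mu setT)))) (poisson_cloud mu).
rewrite -[RHS]/(m' A).
pose V : set (set (config E)) := @void_events _ E.
apply: (@measure_unique _ _ (config E) V (fun=> setT) _ _ _ _ m m') => //.
- exact: setI_closed_void_events.
- by move=> _; exists set0 => //; exact: void0.
- by rewrite bigcup_const//; exists 0%N.
- move=> _ [B mB <-]; apply: (eq_trans (mV B mB)).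
  transitivity ((expR (- fine (mu setT)))%:E * poisson_cloud mu (void B)) => //.
  rewrite poisson_cloud_void// -EFinM -expRD.
  by rewrite -setTD fine_measureD// addrA addNr add0r.
- by move=> _; rewrite -ge0_fin_numE//; exact: fin_num_measure.
Qed.

(** The clouds bound the Poisson laws uniformly over all smaller intensities,
    since the normalization is at most 1. *)
Lemma poisson_law_le mu mu' (m : {finite_measure set (config E) -> \bar R}) A :
  (forall B, measurable B -> mu B <= mu' B) ->
  (forall B, measurable B -> m (void B) = (expR (- fine (mu B)))%:E) ->
  measurable A -> m A <= poisson_cloud mu' A.
Proof.
move=> le_mu mV mA; rewrite (poisson_lawE mV)//.
apply: le_trans (le_poisson_cloud le_mu mA).
rewrite -[leRHS]mul1e lee_wpmul2r// lee_fin -expR0 ler_expR oppr_le0.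
by rewrite fine_ge0.
Qed.

End poisson_cloud.

Section poisson_convergence.
Context d (E : measurableType d) (R : realType).
Variables (mu_ : nat -> {finite_measure set E -> \bar R}).
Variables (mu mubar : {finite_measure set E -> \bar R}).
Variables (m_ : nat -> {finite_measure set (config E) -> \bar R}).
Variable m : {finite_measure set (config E) -> \bar R}.

(** Void probabilities converge on a pi-system, and one cloud dominates all the
    laws: the convergence is setwise, hence holds for functionals that are
    merely measurable. *)
Lemma poisson_law_cvg (H : config E -> R) (M : R) :
  (forall n B, measurable B -> (mu_ n B <= mubar B)%E) ->
  (forall B, measurable B -> fine (mu_ n B) @[n --> \oo] --> fine (mu B)) ->
  (forall n B, measurable B -> m_ n (void B) = (expR (- fine (mu_ n B)))%:E) ->
  (forall B, measurable B -> m (void B) = (expR (- fine (mu B)))%:E) ->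
  measurable_fun setT H -> (forall C, 0 <= H C <= M) ->
  (\int[m_ n]_C (H C)%:E)%E @[n --> \oo] --> (\int[m]_C (H C)%:E)%E.
Proof.
move=> le_mu cmu m_V mV mH HM.
apply: (setwise_cvg_integral mH HM).
have cV B : measurable B -> fine (m_ n (void B)) @[n --> \oo] --> fine (m (void B)).
  move=> mB; rewrite (mV _ mB).
  rewrite (_ : (fun n => fine (m_ n (void B))) =
      expR \o (fun n => - fine (mu_ n B))); last first.
    by apply/funext => n; rewrite /= (m_V _ _ mB).
  apply: continuous_cvg; first exact: continuous_expR.
  by apply: cvgN; exact: cmu.
apply: (setwise_cvg (tau := poisson_cloud mubar)).
- move=> n A mA; exact: (poisson_law_le (le_mu n) (m_V n)).
- by [].
- exact: setI_closed_void_events.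
- by rewrite -[setT](@void0 _ E); exact: cV.
- by move=> _ [B mB <-]; exact: cV.
Qed.

End poisson_convergence.

(** * Products over the points of a Poisson process *)

Section expectation_of_independent_products.
Local Open Scope ereal_scope.
Context d (Om : measurableType d) (R : realType) (P : probability Om R).

(** Independent real functionals: the events are integrated out one at a time,
    each step integrating [f j] against the law of [X j] weighted by the
    factors already processed. *)
Lemma integral_prod_independent m (X : 'I_m -> Om -> \bar R)
    (f : 'I_m -> \bar R -> R) :
  (forall i, measurable_fun setT (X i)) ->
  (forall i, measurable_fun setT (f i)) ->
  (forall i x, (0 <= f i x <= 1)%R) ->
  (forall A : 'I_m -> set (\bar R), (forall i, measurable (A i)) ->
    P (\bigcap_i (X i @^-1` A i)) = \prod_i P (X i @^-1` A i)) ->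
  \int[P]_w (\prod_i f i (X i w))%:E = \prod_i \int[P]_w (f i (X i w))%:E.
Proof.
move=> mX mf f01 ind.
pose Phi j (A : 'I_m -> set (\bar R)) (i : 'I_m) : Om -> R :=
  if (i < j)%N then f i \o X i else \1_(X i @^-1` A i).
have mPhi j A i : (forall i, measurable (A i)) -> measurable_fun setT (Phi j A i).
  move=> mA; rewrite /Phi; case: ifP => _; first exact: measurableT_comp.
  by apply: measurable_indic; rewrite -[_ @^-1` _]setTI; exact: mX.
have Phi01 j A i w : (0 <= Phi j A i w <= 1)%R.
  rewrite /Phi; case: ifP => _ /=; first exact: f01.
  by rewrite indicE; case: (_ \in _); rewrite ?lexx ?ler01.
have mprod (p : pred 'I_m) j A : (forall i, measurable (A i)) ->
    measurable_fun setT (fun w => \prod_(i | p i) Phi j A i w)%R.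
  move=> mA; under eq_fun do rewrite big_mkcond/=.
  apply: (@measurable_prod _ Om R setT 'I_m (index_enum 'I_m) (fun i w => if p i then Phi j A i w else 1%R)).
  by move=> i _; case: (p i); [exact: mPhi|exact: measurable_cst].
suff H j A : (forall i, measurable (A i)) -> (j <= m)%N ->
    \int[P]_w (\prod_i Phi j A i w)%:E = \prod_i \int[P]_w (Phi j A i w)%:E.
  have := H m (fun=> setT) (fun=> measurableT) (leqnn m).
  rewrite /Phi; under eq_integral do under eq_bigr do rewrite ltn_ord.
  by move=> ->; apply: eq_bigr => i _; rewrite ltn_ord.
elim: j A => [A mA _|j ih A mA jm].
  rewrite (eq_bigr (fun i => P (X i @^-1` A i))); last first.
    move=> i _; rewrite /Phi/= integral_indic// ?setIT//.
    by rewrite -[_ @^-1` _]setTI; exact: mX.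
  rewrite -ind// -[LHS]/(\int[P]_w (\prod_i \1_(X i @^-1` A i) w)%:E).
  have mI : measurable (\bigcap_i X i @^-1` A i).
    apply: fin_bigcap_measurable => // i _.
    by rewrite -[_ @^-1` _]setTI; exact: mX.
  rewrite -[X in P X]setIT -integral_indic//; apply: eq_integral => w _; congr EFin.
  rewrite indicE; have [|] := boolP (w \in _).
    by rewrite inE => wA; rewrite big1// => i _; rewrite /Phi/= indicE mem_set//; exact: wA.
  rewrite notin_setE => /existsNP[i /not_implyP[_ wAi]].
  by rewrite (bigD1 i)//= /Phi/= indicE memNset// mul0r.
pose i0 := Ordinal jm.
pose W w := (\prod_(i | i != i0) Phi j A i w)%R.
have PhiS A' i : i != i0 -> Phi j.+1 A' i = Phi j A' i.
  move=> ii0; rewrite /Phi ltnS leq_eqVlt.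
  by have /negPf -> : val i != j by apply: contra ii0 => /eqP ij; apply/eqP/val_inj.
pose c := \prod_(i | i != i0) \int[P]_w (Phi j A i w)%:E.
have intPhi i : 0 <= \int[P]_w (Phi j A i w)%:E <= 1.
  rewrite integral_ge0 /=; last by move=> w _; rewrite lee_fin; case/andP: (Phi01 j A i w).
  apply: (@le_trans _ _ (\int[P]_w (cst 1 w))); last first.
    by rewrite integral_cst// mul1e; exact: probability_le1.
  apply: ge0_le_integral => //.
  - by move=> w _; rewrite lee_fin; case/andP: (Phi01 j A i w).
  - exact/measurable_EFinP/mPhi.
  - by move=> w _; rewrite lee_fin; case/andP: (Phi01 j A i w).
have cE : c = (fine c)%:E.
  rewrite fineK// /c prode_fin_num// => i _.
  have /andP[i_ge0 i_le1] := intPhi i.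
  by rewrite ge0_fin_numE//; apply: le_lt_trans i_le1 _; rewrite ltry.
have c0 : (0 <= fine c)%R.
  by apply/fine_ge0/prode_ge0 => i _; case/andP: (intPhi i).
pose k w : {measure set (\bar R) -> \bar R} := \d_(X i0 w).
have W0 w : (0 <= W w)%R.
  by apply: prodr_ge0 => i _; case/andP: (Phi01 j A i w).
have mW : measurable_fun setT W by exact: mprod.
have mk B : measurable B -> measurable_fun setT (k ^~ B).
  move=> mB; rewrite [k ^~ B](_ : _ = EFin \o (\1_B \o X i0))//.
  apply/measurable_EFinP/measurableT_comp => //; exact: measurable_indic.
have WB B : measurable B -> \int[P]_w ((W w)%:E * k w B) = c * P (X i0 @^-1` B).
  move=> mB.
  pose A' i := if i == i0 then B else A i.
  have mA' i : measurable (A' i) by rewrite /A'; case: ifP.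
  have A'E i : i != i0 -> Phi j A' i = Phi j A i.
    by move=> /negPf ii0; rewrite /Phi /A' ii0.
  have A'0 : Phi j A' i0 = \1_(X i0 @^-1` B).
    by rewrite /Phi /A' eqxx ltnn.
  have := ih A' mA' (ltnW jm).
  rewrite (bigD1 i0)//= A'0 integral_indic//; last first.
    by rewrite -[_ @^-1` _]setTI; exact: mX.
  have -> : \prod_(i | i != i0) \int[P]_w (Phi j A' i w)%:E = c.
    by apply: eq_bigr => i ii0; rewrite A'E.
  rewrite setIT muleC => <-; apply: eq_integral => w _.
  rewrite (bigD1 i0)//= A'0 mulrC EFinM /W /k /= diracE indicE.
  by congr (_%:E * _); apply: eq_bigr => i ii0; rewrite A'E.
have hoo : \int[P]_w ((W w)%:E * k w setT) < +oo.
  by rewrite WB// preimage_setT probability_setT mule1 cE ltry.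
rewrite (bigD1 i0)//=.
have -> : \prod_(i | i != i0) \int[P]_w (Phi j.+1 A i w)%:E = c.
  by apply: eq_bigr => i ii0; rewrite PhiS.
rewrite muleC.
have fi0 : Phi j.+1 A i0 = f i0 \o X i0 by rewrite /Phi /= ltnSn.
transitivity (\int[mixture W0 mW mk hoo]_x (f i0 x)%:E).
  rewrite ge0_integral_mixture//; last by move=> x; case/andP: (f01 i0 x).
  apply: eq_integral => w _.
  rewrite integral_dirac//; last exact/measurable_EFinP.
  rewrite diracT mul1e -EFinM (bigD1 i0)//= fi0/= mulrC; congr ((_ * _)%:E).
  by apply: eq_bigr => i ii0; rewrite PhiS.
rewrite (eq_measure_integral (mscale (NngNum c0) (image_measure P (mX i0)))); last first.
  move=> B mB _; transitivity (c * P (X i0 @^-1` B)); first exact: WB.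
  by rewrite [X in X * _]cE.
rewrite ge0_integral_mscale//; last 2 first.
- exact/measurable_EFinP.
- by move=> x _; rewrite lee_fin; case/andP: (f01 i0 x).
rewrite [in RHS]cE; congr (_ * _).
rewrite ge0_integral_pushforward//; first by rewrite fi0 preimage_setT.
- exact/measurable_EFinP.
- by move=> x _; rewrite lee_fin; case/andP: (f01 i0 x).
Qed.

End expectation_of_independent_products.

Section poisson_counts.
Local Open Scope ereal_scope.
Context d (Om : measurableType d) (R : realType) (P : probability Om R).
Context dE (E : measurableType dE).
Variables (mean : set E -> \bar R) (xi : set E -> Om -> \bar R).
Hypothesis Pxi : poisson_point_process P mean xi.

Lemma poisson_prob_set1 (r : R) n : (0 <= r)%R ->
  poisson_prob r 0 [set n] = (expR (- r) * exp_coeff r n)%:E.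
Proof.
rewrite /poisson_prob exp_coeffE/= le_eqVlt => /predU1P[<-|r0].
  rewrite ltxx oppr0 expR0 mul1r diracE expr0n; case: n => [|n]/=.
    by rewrite mem_set// fact0 invr1 mulr1.
  by rewrite memNset// mulr0.
by rewrite r0 esum_set1 ?lee_fin ?poisson_pmf_ge0// /poisson_pmf r0; congr EFin; ring.
Qed.

Lemma measurable_count B : measurable B -> measurable_fun setT (xi B).
Proof. by case: Pxi => + _ _; exact. Qed.

Let measurable_count_eq B n : measurable B -> measurable [set w | xi B w = n%:R%:E].
Proof.
move=> mB; have := measurable_count mB measurableT (emeasurable_set1 n%:R%:E).
by rewrite setTI.
Qed.

Lemma poisson_count_eq B n : measurable B -> 0 <= mean B -> mean B < +oo ->
  P [set w | xi B w = n%:R%:E]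
    = (expR (- fine (mean B)) * exp_coeff (fine (mean B)) n)%:E.
Proof.
move=> mB B0 Boo; case: Pxi => _ -> // _.
by rewrite poisson_prob_set1// fine_ge0.
Qed.

Let trivIset_count B : trivIset setT (fun n => [set w | xi B w = n%:R%:E]).
Proof.
apply/trivIsetP => i j _ _ ij; apply/seteqP; split => // w [/= ->] [] /eqP.
by rewrite eqr_nat (negbTE ij).
Qed.

(** The Poisson weights add up to 1. *)
Lemma poisson_count_nat B : measurable B -> 0 <= mean B -> mean B < +oo ->
  {ae P, forall w, exists n : nat, xi B w = n%:R%:E}.
Proof.
move=> mB B0 Boo.
have mU : measurable (\bigcup_n [set w | xi B w = n%:R%:E]).
  by apply: bigcup_measurable => n _; exact: measurable_count_eq.
exists (~` \bigcup_n [set w | xi B w = n%:R%:E]); split.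
- exact: measurableC.
- rewrite probability_setC// measure_semi_bigcup//; last first.
    by move=> n; exact: measurable_count_eq.
  rewrite (eq_eseriesr (g := fun n => (expR (- fine (mean B)))%:E *
      (exp_coeff (fine (mean B)) n)%:E)); last first.
    by move=> n _; rewrite -EFinM; exact: poisson_count_eq.
  rewrite nneseriesZl//; last by move=> n _; rewrite lee_fin exp_coeff_ge0// fine_ge0.
  by rewrite nneseries_exp_coeff -EFinM -expRD addNr expR0 subee.
- by move=> w /= hw [n _ /= xin]; apply: hw; exists n.
Qed.

(** [u ^ N] as a total measurable function of an extended real count; the
    convention [0 `^ 0 = 1] is the one needed when [u = 0]. *)
Definition count_power (u : R) (x : \bar R) : R := u `^ `|fine x|.

Lemma measurable_count_power u : measurable_fun setT (count_power u).
Proof.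
apply: (measurableT_comp (measurable_powRr u)).
exact: measurableT_comp.
Qed.

Lemma count_power01 u x : (0 <= u <= 1)%R -> (0 <= count_power u x <= 1)%R.
Proof.
move=> /andP[u0 u1]; rewrite powR_ge0/=.
rewrite /count_power; have [->|un0] := eqVneq u 0%R.
  have [->|x0] := eqVneq (`|fine x|)%R 0%R; first by rewrite powRr0.
  by rewrite powR0.
rewrite -[leRHS](powRr0 u); apply: ger_powR => //.
by rewrite u1 lt_neqAle eq_sym un0 u0.
Qed.

Lemma count_powerE u n : (0 <= u)%R -> count_power u n%:R%:E = (u ^+ n)%R.
Proof. by move=> u0; rewrite /count_power/= ger0_norm// powR_mulrn. Qed.

Lemma poisson_generating B u : measurable B -> 0 <= mean B -> mean B < +oo ->
  (0 <= u <= 1)%R ->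
  \int[P]_w (count_power u (xi B w))%:E
    = (expR (- ((1 - u) * fine (mean B))))%:E.
Proof.
move=> mB B0 Boo u01.
set S := fun n : nat => [set w | xi B w = n%:R%:E].
have mS n : measurable (S n) by exact: measurable_count_eq.
have mU : measurable (\bigcup_n S n) by exact: bigcup_measurable.
have mf : measurable_fun setT (fun w => (count_power u (xi B w))%:E).
  apply/measurable_EFinP; apply: measurableT_comp; first exact: measurable_count_power.
  exact: measurable_count.
transitivity (\int[P]_(w in \bigcup_n S n) (count_power u (xi B w))%:E).
  rewrite [RHS]integral_mkcond; apply: ae_eq_integral => //.
    exact/(measurable_restrictT _ _).1/measurable_funTS.
  have := poisson_count_nat mB B0 Boo; apply: filterS => w [n xin] _.
  by rewrite patchE mem_set//; exists n.
have f0 w : 0 <= (count_power u (xi B w))%:E.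
  by rewrite lee_fin; case/andP: (count_power01 (xi B w) u01).
rewrite (ge0_integral_bigcup P mS (measurable_funTS mf) (fun w _ => f0 w)
  (@trivIset_count B)).
have /andP[u0 u1] := u01.
rewrite (eq_eseriesr (g := fun n => (expR (- fine (mean B)))%:E * (exp_coeff (u * fine (mean B)) n)%:E)).
  rewrite nneseriesZl; last by move=> n _; rewrite lee_fin exp_coeff_ge0// mulr_ge0// fine_ge0.
  rewrite nneseries_exp_coeff -EFinM -expRD; congr (expR _)%:E; ring.
move=> n _.
transitivity (\int[P]_(w in S n) (u ^+ n)%:E).
  by apply: eq_integral => w; rewrite inE => ->; rewrite count_powerE.
rewrite integral_cst//.
transitivity ((u ^+ n)%:E * (expR (- fine (mean B)) * exp_coeff (fine (mean B)) n)%:E).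
  by congr (_ * _); exact: poisson_count_eq.
rewrite -!EFinM; congr EFin.
by rewrite !exp_coeffE/= exprMn; ring.
Qed.

End poisson_counts.

Section bounded_integrals.
Context d (T : measurableType d) (R : realType).
Variable m : {finite_measure set T -> \bar R}.

Lemma integral_bounded_fin_num (f : T -> R) (M : R) : measurable_fun setT f ->
  (forall x, 0 <= f x <= M) -> (\int[m]_x (f x)%:E)%E \is a fin_num.
Proof.
move=> mf fM; rewrite ge0_fin_numE; last first.
  by apply: integral_ge0 => x _; rewrite lee_fin; case/andP: (fM x).
apply: (@le_lt_trans _ _ (\int[m]_x M%:E)%E).
  apply: ge0_le_integral => //.
  - by move=> x _; rewrite lee_fin; case/andP: (fM x).
  - exact/measurable_EFinP.
  - by move=> x _; rewrite lee_fin; case/andP: (fM x).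
rewrite integral_cst//= ltey_eq fin_numM//; exact: fin_num_measure.
Qed.

Lemma le_fine_integral (f g : T -> R) (M : R) :
  measurable_fun setT f -> measurable_fun setT g ->
  (forall x, 0 <= f x <= g x) -> (forall x, g x <= M) ->
  fine (\int[m]_x (f x)%:E)%E <= fine (\int[m]_x (g x)%:E)%E.
Proof.
move=> mf mg fg gM.
have g0 x : 0 <= g x by case/andP: (fg x) => /le_trans; apply.
apply: fine_le.
- apply: (integral_bounded_fin_num (M := M)) => // x.
  by case/andP: (fg x) => -> /=/le_trans; apply.
- by apply: (integral_bounded_fin_num (M := M)) => // x; rewrite g0 gM.
- apply: ge0_le_integral => //.
  + by move=> x _; rewrite lee_fin; case/andP: (fg x).
  + exact/measurable_EFinP.
  + exact/measurable_EFinP.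
  + by move=> x _; rewrite lee_fin; case/andP: (fg x).
Qed.

Lemma fine_integralDcst (f : T -> R) (M c : R) : measurable_fun setT f ->
  (forall x, 0 <= f x <= M) -> 0 <= c ->
  fine (\int[m]_x (f x + c)%:E)%E = fine (\int[m]_x (f x)%:E)%E + c * fine (m setT).
Proof.
move=> mf fM c0; under eq_integral do rewrite EFinD.
rewrite ge0_integralD//; last first.
- exact/measurable_EFinP.
- by move=> x _; rewrite lee_fin; case/andP: (fM x).
have mT : m setT \is a fin_num by exact: fin_num_measure.
rewrite integral_cst// fineD ?fin_numM//; first by rewrite fineM.
exact: integral_bounded_fin_num mf fM.
Qed.

End bounded_integrals.

Section arrival_products.
Local Open Scope ereal_scope.
Context d (Om : measurableType d) (R : realType) (P : probability Om R).
Variables (mean : set R -> \bar R) (G : nat -> Om -> \bar R).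
Hypothesis mG : forall k, measurable_fun setT (G k).
Hypothesis PG : poisson_point_process P mean (arrival_count G).
Variables (mu : {finite_measure set R -> \bar R}) (D0 : set R).
Hypothesis mD0 : measurable D0.
Hypothesis mean_mu : forall D, measurable D -> D `<=` D0 -> mean D = mu D.

(** Absent arrivals contribute the neutral factor 1. *)
Definition at_arrival (h : R -> R) (x : \bar R) : R :=
  if x is s%:E then h s else 1%R.

Lemma measurable_at_arrival (h : R -> R) :
  measurable_fun setT h -> measurable_fun setT (at_arrival h).
Proof.
move=> mh; rewrite (_ : at_arrival h = fun x => if x \is a fin_num then h (fine x) else 1%R).
  apply: measurable_fun_ifT => //.
    apply: (measurable_fun_bool true).
    exact/(emeasurable_fin_num measurableT (f := id)).
  exact: measurableT_comp.
by apply/funext => -[].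
Qed.

Lemma arrival_count_partial D w : arrival_count G D w =
  limn (fun n => (\sum_(k < n) (G k w \in EFin @` D))%:R%:E).
Proof.
rewrite /arrival_count; congr (limn _); apply/funext => n.
by rewrite big_mkord natr_sum -sumEFin.
Qed.

Lemma arrival_count_eventually D w (p : nat) :
  arrival_count G D w = p%:R%:E ->
  \forall n \near \oo, (\sum_(k < n) (G k w \in EFin @` D))%N = p.
Proof.
rewrite arrival_count_partial => E.
set u := fun n => (\sum_(k < n) (G k w \in EFin @` D))%N.
have u_nd : nondecreasing_seq (fun n => (u n)%:R%:E : \bar R).
  apply/nondecreasing_seqP => n; rewrite lee_fin ler_nat /u big_ord_recr/=.
  exact: leq_addr.
have /ereal_nondecreasing_is_cvgn : nondecreasing_seq (fun n => (u n)%:R%:E : \bar R) by [].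
rewrite /u => /[dup] h /cvg_ex[l hl].
have : (u n)%:R%:E @[n --> \oo] --> (p%:R%:E : \bar R) by rewrite -E; exact: h.
move=> /fine_cvgP[_] /cvgrPdist_lt/(_ 1%R ltr01); apply: filterS => n /=.
rewrite ltr_norml => /andP[h1 h2]; apply/eqP.
have : ((u n) < p.+1)%N by rewrite -(ltr_nat R) -natr1; lra.
have : (p < (u n).+1)%N by rewrite -(ltr_nat R) -natr1; lra.
by rewrite !ltnS eqn_leq => -> ->.
Qed.

(** A function with few values, given by the index [lv s] of the value at [s],
    and neutral outside [D0]. *)
Definition level_fun (lv : R -> nat) (u : nat -> R) (s : R) : R :=
  if s \in D0 then u (lv s) else 1%R.

Section finitely_many_values.
Variables (m : nat) (lv : R -> nat) (u : nat -> R).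
Hypothesis mlv : forall j, measurable (lv @^-1` [set j]).
Hypothesis lvm : forall s, (lv s < m)%N.
Hypothesis u01 : forall j, (0 <= u j <= 1)%R.

Let D j := D0 `&` lv @^-1` [set j].

Let mD j : measurable (D j). Proof. exact: measurableI. Qed.

Let hu := level_fun lv u.

Let prod_hu n w : (\prod_(k < n) at_arrival hu (G k w) =
  \prod_(j < m) u j ^+ (\sum_(k < n) (G k w \in EFin @` D j)))%R.
Proof.
have one (x : \bar R) : at_arrival hu x =
    (\prod_(j < m) u j ^+ (x \in EFin @` D j))%R.
  have in_EFin s (B : set R) : (s%:E \in EFin @` B) = (s \in B).
    apply/idP/idP; rewrite !inE; first by move=> [r Br [<-]].
    by move=> Bs; exists s.
  case: x => [s| |]; last 2 first.
  - rewrite big1// => j _; rewrite memNset ?expr0//.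
    by move=> [].
  - rewrite big1// => j _; rewrite memNset ?expr0//.
    by move=> [].
  rewrite /at_arrival /hu /level_fun; under eq_bigr do rewrite in_EFin.
  have [sD0|sD0] := boolP (s \in D0); last first.
    rewrite big1// => j _; rewrite memNset ?expr0// => -[/mem_set].
    by rewrite (negbTE sD0).
  rewrite (bigD1 (Ordinal (lvm s)))//= mem_set; last by split => //; rewrite -inE.
  rewrite expr1 big1 ?mulr1// => j jlv; rewrite memNset ?expr0// => -[_ /= lvj].
  by move/eqP : jlv; apply; apply/val_inj.
under eq_bigr do rewrite one.
rewrite exchange_big/=; apply: eq_bigr => j _.
by rewrite prodrXr.
Qed.

Let hu01 s : (0 <= hu s <= 1)%R.
Proof. by rewrite /hu /level_fun; case: ifP => _; [exact: u01|rewrite ler01 lexx]. Qed.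

Let huE s : (1 - hu s = \sum_(j < m) (1 - u j) * \1_(D j) s)%R.
Proof.
rewrite /hu /level_fun; case: ifPn => sD0.
  rewrite (bigD1 (Ordinal (lvm s)))//= indicE mem_set; last by split => //; rewrite -inE.
  rewrite mulr1 big1 ?addr0// => j jlv; rewrite indicE memNset ?mulr0// => -[_ /= lvj].
  by move/eqP : jlv; apply; apply/val_inj.
rewrite subrr big1// => j _; rewrite indicE memNset ?mulr0// => -[/mem_set].
by rewrite (negbTE sD0).
Qed.

Lemma measurable_level_fun : measurable_fun setT (level_fun lv u).
Proof.
rewrite (_ : level_fun lv u = fun s => (1 - \sum_(j < m) (1 - u j) * \1_(D j) s)%R); last first.
  by apply/funext => s; rewrite -huE /hu opprB addrC subrK.
apply: measurable_funB => //; apply: measurable_sum => j.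
by apply: measurable_funM => //; exact: measurable_indic.
Qed.

Let at01 n w : (0 <= \prod_(k < n) at_arrival hu (G k w) <= 1)%R.
Proof.
rewrite prodr_ge0/=; last by move=> k _; case: (G k w) => //= s; case/andP: (hu01 s).
by apply: prodr_ile1 => k _; case: (G k w) => [s| |]/=; rewrite ?hu01 ?ler01 ?lexx.
Qed.

(** The product is eventually that of the [u j ^ N_j], where the numbers [N_j] of
    points on the level sets are independent Poisson variables. *)
Lemma cvg_arrival_product_simple :
  \int[P]_w (\prod_(k < n) at_arrival (level_fun lv u) (G k w))%:E @[n --> \oo] -->
    (expR (- fine (\int[mu]_s (1 - level_fun lv u s)%:E)))%:E.
Proof.
rewrite -/hu; have meanD j : mean (D j) = mu (D j) by apply: mean_mu => // s [].
have mean0 j : 0 <= mean (D j) by rewrite meanD.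
have meanoo j : mean (D j) < +oo.
  by rewrite meanD -ge0_fin_numE//; exact: fin_num_measure.
pose f w := (\prod_(j < m) count_power (u j) (arrival_count G (D j) w))%R.
have -> : (expR (- fine (\int[mu]_s (1 - hu s)%:E)))%:E = \int[P]_w (f w)%:E.
  rewrite (integral_prod_independent (X := fun j => arrival_count G (D j))
    (f := fun j => count_power (u j))); last 4 first.
  - by move=> j; exact: (measurable_count PG).
  - by move=> j; exact: measurable_count_power.
  - by move=> j x; exact: count_power01.
  - move=> A mA; case: PG => _ _; apply => //.
    apply/trivIsetP => i j _ _ ij; apply/seteqP; split => // s [[_ /= lvi] [_ /= lvj]].
    by move/eqP : ij; apply; apply/val_inj; rewrite /= -lvi -lvj.
  rewrite (eq_bigr (fun j : 'I_m => (expR (- ((1 - u j) * fine (mu (D j)))))%:E)); last first.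
    by move=> j _; rewrite (poisson_generating PG)// meanD.
  rewrite prodEFin -expR_sum; congr (expR _)%:E.
  rewrite sumrN; congr (- _)%R.
  rewrite (eq_integral (fun s => \sum_(j < m) ((1 - u j) * \1_(D j) s)%:E)); last first.
    by move=> s _; rewrite sumEFin huE.
  rewrite ge0_integral_sum//; last 2 first.
  - by move=> j; apply/measurable_EFinP; exact: measurable_funM.
  - by move=> j s _; rewrite lee_fin mulr_ge0// subr_ge0; case/andP: (u01 j).
  rewrite [X in fine X](_ : _ = (\sum_(j < m) (1 - u j) * fine (mu (D j)))%:E)//.
  rewrite -sumEFin; apply: eq_bigr => j _.
  rewrite (integralZl_indic _ (fun=> D j))//; last first.
    by move/lt_geF; rewrite subr_ge0; case/andP: (u01 j) => _ ->.
  by rewrite integral_indic// setIT EFinM fineK//; exact: fin_num_measure.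
have mf_ n : measurable_fun setT (fun w => (\prod_(k < n) at_arrival hu (G k w))%:E).
  apply/measurable_EFinP.
  apply: (@measurable_prod _ Om R setT 'I_n (index_enum 'I_n) (fun k w => at_arrival hu (G k w))).
  by move=> k _; apply: measurableT_comp => //; apply: measurable_at_arrival; exact: measurable_level_fun.
have mf : measurable_fun setT (fun w => (f w)%:E).
  apply/measurable_EFinP.
  apply: (@measurable_prod _ Om R setT 'I_m (index_enum 'I_m)
    (fun j w => count_power (u j) (arrival_count G (D j) w))).
  move=> j _; apply: measurableT_comp; first exact: measurable_count_power.
  exact: (measurable_count PG).
have [] // := @dominated_convergence _ Om R P setT measurableT _ _ (cst 1) mf_ mf.
- have : {ae P, forall w, forall j : 'I_m, exists p : nat, arrival_count G (D j) w = p%:R%:E}.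
    by apply: filter_forall => j; exact: (poisson_count_nat PG).
  apply: filterS => w /choice[p pE] _; apply: cvg_near_cst.
  have : \forall n \near \oo, forall j : 'I_m,
      (\sum_(k < n) (G k w \in EFin @` D j))%N = p j.
    by apply: filter_forall => j; exact: arrival_count_eventually.
  apply: filterS => n nE; congr EFin; rewrite prod_hu; apply: eq_bigr => j _.
  by rewrite nE pE count_powerE//; case/andP: (u01 j).
- exact: finite_measure_integrable_cst.
- apply: aeW => w n _; rewrite /= lee_fin ger0_norm; by case/andP: (at01 n w).
Qed.

End finitely_many_values.

(** General factors are squeezed between two functions with finitely many
    values, constant on the level sets [j <= N h < j + 1]. *)
Lemma cvg_arrival_product (h : R -> R) : measurable_fun setT h ->
  (forall s, (0 <= h s <= 1)%R) -> (forall s, ~ D0 s -> h s = 1%R) ->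
  \int[P]_w (\prod_(k < n) at_arrival h (G k w))%:E @[n --> \oo] -->
    (expR (- fine (\int[mu]_s (1 - h s)%:E)))%:E.
Proof.
move=> mh h01 hD0.
pose I (f : R -> R) := fine (\int[mu]_s (1 - f s)%:E).
pose a (f : R -> R) n := fine (\int[P]_w (\prod_(k < n) at_arrival f (G k w))%:E).
have mprod (f : R -> R) n : measurable_fun setT f ->
    measurable_fun setT (fun w => \prod_(k < n) at_arrival f (G k w))%R.
  move=> mf.
  apply: (@measurable_prod _ Om R setT 'I_n (index_enum 'I_n) (fun k w => at_arrival f (G k w))).
  by move=> k _; apply: measurableT_comp => //; exact: measurable_at_arrival.
have prod01 (f : R -> R) n w : (forall s, (0 <= f s <= 1)%R) ->
    (0 <= \prod_(k < n) at_arrival f (G k w) <= 1)%R.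
  move=> f01; rewrite prodr_ge0/=; last by move=> k _; case: (G k w) => //= s; case/andP: (f01 s).
  by apply: prodr_ile1 => k _; case: (G k w) => [s| |]/=; rewrite ?f01 ?ler01 ?lexx.
have aE (f : R -> R) n : measurable_fun setT f -> (forall s, (0 <= f s <= 1)%R) ->
    \int[P]_w (\prod_(k < n) at_arrival f (G k w))%:E = (a f n)%:E.
  move=> mf f01; rewrite fineK//.
  by apply: (integral_bounded_fin_num P (M := 1)); [exact: mprod|move=> w; exact: prod01].
have a_le (f g : R -> R) n : measurable_fun setT f -> measurable_fun setT g ->
    (forall s, (0 <= f s <= g s)%R) -> (forall s, (g s <= 1)%R) -> (a f n <= a g n)%R.
  move=> mf mg fg g1.
  have g01 s : (0 <= g s <= 1)%R by rewrite g1 andbT; case/andP: (fg s) => /le_trans; apply.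
  apply: (le_fine_integral P (M := 1)).
  - exact: mprod.
  - exact: mprod.
  - move=> w; rewrite prodr_ge0/=; last by move=> k _; case: (G k w) => //= s; case/andP: (fg s).
    by apply: ler_prod => k _; case: (G k w) => [s| |]/=; rewrite ?fg ?ler01 ?lexx.
  - by move=> w; case/andP: (prod01 g n w g01).
under eq_fun do rewrite (aE _ _ mh h01).
apply: cvg_EFin; first by near=> n.
rewrite [X in X @ \oo --> _](_ : _ = a h); last by apply/funext => n.
apply/cvgrPdist_lt => e e0.
have expc : {for I h, continuous (fun x : R => expR (- x)%R)}.
  apply: continuous_comp; first exact: continuousN.
  exact: continuous_expR.
move/cvgrPdist_lt : expc => /(_ (e / 2)%R).
have e2 : (0 < e / 2)%R by rewrite divr_gt0.
move=> /(_ e2) [d' /= d'0 expd].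
pose M := fine (mu setT).
have M0 : (0 <= M)%R by exact: fine_ge0.
(* The mesh of the levels is chosen from the modulus [d'] of continuity of the
   exponential and from the total mass [M]. *)
pose N := (Num.truncn (M / d')).+1.
have N0 : (0 < N%:R :> R)%R by [].
have MN : (N%:R^-1 * M < d')%R.
  by rewrite mulrC ltr_pdivrMr// mulrC -ltr_pdivrMr//; exact: truncnS_gt.
pose lv s := Num.truncn (h s * N%:R).
have lv_itv s : ((lv s)%:R <= h s * N%:R < (lv s).+1%:R)%R.
  apply: truncn_itv; rewrite mulr_ge0//; by case/andP: (h01 s).
have mlv j : measurable (lv @^-1` [set j]).
  have mhN : measurable_fun setT (fun s => h s * N%:R)%R by exact: measurable_funM.
  have := mhN measurableT _ (measurable_itv `[j%:R, j.+1%:R[).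
  rewrite setTI [X in measurable X -> _](_ : _ = lv @^-1` [set j])//.
  apply/seteqP; split => s /=; rewrite in_itv/=.
    by move=> hj; apply: truncn_def.
  by move=> <-; exact: lv_itv.
have lvm s : (lv s < N.+1)%N.
  rewrite ltnS -(ler_nat R); have /andP[/le_trans lvs _] := lv_itv s; apply: lvs.
  by rewrite ler_piMl//; case/andP: (h01 s).
pose lo (j : nat) : R := Num.min 1%R (j%:R / N%:R)%R.
pose up (j : nat) : R := Num.min 1%R (j.+1%:R / N%:R)%R.
have lo01 j : (0 <= lo j <= 1)%R.
  by rewrite /lo ge_min lexx andbT le_min ler01/= divr_ge0.
have up01 j : (0 <= up j <= 1)%R.
  by rewrite /up ge_min lexx andbT le_min ler01/= divr_ge0.
pose hl := level_fun lv lo; pose hu := level_fun lv up.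
have lev01 u s : (forall j, (0 <= u j <= 1)%R) -> (0 <= level_fun lv u s <= 1)%R.
  by move=> u01; rewrite /level_fun; case: ifP => _; [exact: u01|rewrite ler01 lexx].
have hl_h s : (hl s <= h s)%R.
  rewrite /hl /level_fun; case: ifPn => [_|].
    by rewrite /lo ge_min ler_pdivrMr//; case/andP: (lv_itv s) => ->; rewrite orbT.
  by rewrite notin_setE => /hD0 ->.
have h_hu s : (h s <= hu s)%R.
  rewrite /hu /level_fun; case: ifPn => [_|_]; last by case/andP: (h01 s).
  rewrite /up le_min ler_pdivlMr//; case/andP: (lv_itv s) => _ /ltW ->.
  by rewrite andbT; case/andP: (h01 s).
have hu_hl s : (hu s <= hl s + N%:R^-1)%R.
  rewrite /hu /hl /level_fun; case: ifPn => _; last by rewrite lerDl invr_ge0.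
  rewrite /up /lo -[(lv s).+1%:R]natr1 mulrDl mul1r.
  have := N0; rewrite -invr_gt0; move: (N%:R^-1)%R ((lv s)%:R / N%:R)%R => y x y0.
  by rewrite addr_minl le_min !ge_min lerDl (ltW y0)/= lexx orbT.
have mhl : measurable_fun setT hl by apply: (@measurable_level_fun N.+1).
have mhu : measurable_fun setT hu by apply: (@measurable_level_fun N.+1).
have m1 (f : R -> R) : measurable_fun setT f -> measurable_fun setT (fun s => (1 - f s)%R).
  by move=> mf; exact: measurable_funB.
have I_le (f g : R -> R) : measurable_fun setT f -> measurable_fun setT g ->
    (forall s, (f s <= g s <= 1)%R) -> (forall s, (0 <= f s)%R) -> (I g <= I f)%R.
  move=> mf mg fg f0; apply: (le_fine_integral mu (M := 1)); [exact: m1|exact: m1|..].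
    by move=> s; case/andP: (fg s) => h1 h2; rewrite subr_ge0 h2 lerB.
  by move=> s; rewrite gerBl.
have I_le1 (f g : R -> R) : measurable_fun setT f -> measurable_fun setT g ->
    (forall s, (g s - N%:R^-1 <= f s <= 1)%R) -> (forall s, (0 <= g s <= 1)%R) ->
    (I f <= I g + N%:R^-1 * M)%R.
  move=> mf mg fg g01; rewrite /I /M -(fine_integralDcst mu (M := 1)) ?invr_ge0//; last 2 first.
  - exact: m1.
  - by move=> s; case/andP: (g01 s) => h1 h2; rewrite subr_ge0 h2 gerBl.
  apply: (le_fine_integral mu (M := 1 + N%:R^-1)%R).
  - exact: m1.
  - by apply: measurable_funD => //; exact: m1.
  - by move=> s; case/andP: (fg s) => h1 h2; apply/andP; split; lra.
  - by move=> s; case/andP: (g01 s) => h1 h2; rewrite lerD2r gerBl.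
have hl01 s : (0 <= hl s <= 1)%R by exact: lev01.
have hu01 s : (0 <= hu s <= 1)%R by exact: lev01.
have Il : (I h <= I hl <= I h + N%:R^-1 * M)%R.
  apply/andP; split.
    apply: I_le => // s; last by case/andP: (hl01 s).
    by rewrite hl_h; case/andP: (h01 s).
  apply: I_le1 => // s; apply/andP; split; last by case/andP: (hl01 s).
  by rewrite lerBlDr; apply: le_trans (hu_hl s).
have Iu : (I hu <= I h <= I hu + N%:R^-1 * M)%R.
  apply/andP; split.
    apply: I_le => // s; last by case/andP: (h01 s).
    by rewrite h_hu; case/andP: (hu01 s).
  apply: I_le1 => // s; apply/andP; split; last by case/andP: (h01 s).
  by rewrite lerBlDr; apply: le_trans (hu_hl s) _; rewrite lerD2r.
have near_exp f : (`|I h - I f| < d')%R -> (`|expR (- I h) - expR (- I f)| < e / 2)%R.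
  by move=> hf; exact: expd.
have cvg_a lev : (forall j, (0 <= lev j <= 1)%R) ->
    a (level_fun lv lev) n @[n --> \oo] --> expR (- I (level_fun lv lev)).
  move=> lev_01; have := cvg_arrival_product_simple mlv lvm lev_01.
  by move/fine_cvgP => [].
have /cvgrPdist_lt/(_ _ e2) cl := cvg_a _ lo01.
have /cvgrPdist_lt/(_ _ e2) cu := cvg_a _ up01.
have dl : (`|I h - I hl| < d')%R.
  by move: Il MN => /andP[]; move: (N%:R^-1 * M)%R => x *; rewrite ltr_norml; apply/andP; split; lra.
have du : (`|I h - I hu| < d')%R.
  by move: Iu MN => /andP[]; move: (N%:R^-1 * M)%R => x *; rewrite ltr_norml; apply/andP; split; lra.
have /ltr_normlP[el1 el2] := near_exp _ dl.
have /ltr_normlP[eu1 eu2] := near_exp _ du.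
near=> n.
have nl : (`|expR (- I hl) - a hl n| < e / 2)%R by near: n; exact: cl.
have nu : (`|expR (- I hu) - a hu n| < e / 2)%R by near: n; exact: cu.
have al : (a hl n <= a h n)%R.
  apply: a_le => // s; last by case/andP: (h01 s).
  by rewrite hl_h andbT; case/andP: (hl01 s).
have au : (a h n <= a hu n)%R.
  apply: a_le => // s; last by case/andP: (hu01 s).
  by rewrite h_hu andbT; case/andP: (h01 s).
move: nl nu; rewrite !ltr_norml => /andP[l1 l2] /andP[u1 u2].
move: l1 l2 u1 u2 eu1 eu2 el1 el2 al au.
move: (expR (- I h)) (expR (- I hl)) (expR (- I hu)) (a h n) (a hl n) (a hu n).
clear -e0 => x1 x2 x3 x4 x5 x6 *; apply/andP; split; lra.
Unshelve. all: by end_near. Qed.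

End arrival_products.

(** * Void probabilities of marked arrivals *)

Section marked_arrivals.
Local Open Scope ereal_scope.
Context d (Om : measurableType d) (R : realType) (P : probability Om R).
Variables (nu : R.-pker R ~> R) (G : nat -> Om -> \bar R) (L : nat -> Om -> R).
Hypothesis mG : forall k, measurable_fun setT (G k).
Hypothesis mL : forall k, measurable_fun setT (L k).
Hypothesis indL : independent_services P nu G L.

Definition mark_event (C : set (R * R)) k : set Om :=
  [set w | G k w \is a fin_num -> C (fine (G k w), L k w)].

Definition mark_prob (C : set (R * R)) (x : \bar R) : \bar R :=
  if x is s%:E then nu s (xsection C s) else 1.

Let sG := sigma_family setT G.

Let sG_measurable A : sG A -> measurable A.
Proof.
apply: smallest_sub; first exact: sigma_algebra_measurable.
by move=> _ [k _ [B mB <-]]; exact: mG.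
Qed.

Let sG_preimage k (B : set (\bar R)) : measurable B -> sG (G k @^-1` B).
Proof.
by move=> mB; apply: sub_sigma_algebra; exists k => //; exists B => //; rewrite setTI.
Qed.

Let sGI A B : sG A -> sG B -> sG (A `&` B).
Proof.
move=> sA sB.
exact: (@measurableI _ (g_sigma_algebraType (\bigcup_(i in setT) preimage_set_system setT (G i) measurable))).
Qed.

Let sGD A B : sG A -> sG B -> sG (A `\` B).
Proof.
move=> sA sB.
exact: (@measurableD _ (g_sigma_algebraType (\bigcup_(i in setT) preimage_set_system setT (G i) measurable))).
Qed.

Let mpair (s : R) : measurable_fun setT (pair s : R -> R * R).
Proof. exact: pair1_measurable. Qed.

Let pairk (s : R) : {measure set (R * R) -> \bar R} := image_measure (nu s) (mpair s).

Let pairkE s X : pairk s X = nu s (xsection X s).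
Proof. by rewrite xsectionE. Qed.

Lemma measurable_kernel_section (X : set (R * R)) : measurable X ->
  measurable_fun setT (fun s => nu s (xsection X s)).
Proof.
by move=> mX; apply: measurable_fun_xsection_finite_kernel; rewrite inE.
Qed.

Lemma mark_prob_itv C x : measurable C -> 0 <= mark_prob C x <= 1.
Proof.
move=> mC; case: x => [s| |]/=; rewrite ?lee01 ?lexx//.
rewrite measure_ge0 /= -(@prob_kernel _ _ _ _ _ nu s).
by apply: le_measure; rewrite ?inE//; exact: measurable_xsection.
Qed.

Lemma mark_probE C x : measurable C -> mark_prob C x = (fine (mark_prob C x))%:E.
Proof.
move=> mC; have /andP[h0 h1] := mark_prob_itv x mC.
by rewrite fineK// ge0_fin_numE//; apply: le_lt_trans h1 _; rewrite ltry.
Qed.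

Lemma measurable_mark_prob C : measurable C -> measurable_fun setT (mark_prob C).
Proof.
move=> mC.
rewrite (_ : mark_prob C = fun x => if x \is a fin_num then
    nu (fine x) (xsection C (fine x)) else 1); last by apply/funext => -[].
apply: measurable_fun_ifT => //.
  apply: (measurable_fun_bool true).
  exact/(emeasurable_fin_num measurableT (f := id)).
apply: (measurableT_comp (f := fun s => nu s (xsection C s))) => //.
exact: measurable_kernel_section.
Qed.

Let formula n A (C : nat -> set (R * R)) :=
  P (A `&` \bigcap_(k < n) mark_event (C k) k)
  = \int[P]_(w in A) \prod_(k < n) mark_prob (C k) (G k w).

Let subst (C : nat -> set (R * R)) j X k := if k == j then X else C k.

Let mpoint k : measurable_fun setT (fun w => (fine (G k w), L k w)).
Proof.
by apply/measurable_fun_pair => //; exact: measurableT_comp.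
Qed.

Let sG_fin k : sG [set w | G k w \is a fin_num].
Proof.
rewrite -[X in sG X]/(G k @^-1` [set x | x \is a fin_num]).
apply: sG_preimage; have := emeasurable_fin_num measurableT (@measurable_id _ (\bar R) setT).
by rewrite setTI.
Qed.

Let measurable_point_preimage C k : measurable C ->
  measurable ((fun w => (fine (G k w), L k w)) @^-1` C).
Proof. by move=> mC; rewrite -[_ @^-1` _]setTI; exact: mpoint. Qed.

Lemma measurable_mark_event C k : measurable C -> measurable (mark_event C k).
Proof.
move=> mC; rewrite (_ : mark_event C k = ~` [set w | G k w \is a fin_num] `|`
    (fun w => (fine (G k w), L k w)) @^-1` C).
  apply: measurableU; last exact: measurable_point_preimage.
  by apply: measurableC; exact: sG_measurable.
apply/seteqP; split => w.
  by move=> h; have [wf|] := boolP (G k w \is a fin_num); [right; exact: h|left; exact/negP].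
by move=> [h /h []|h _].
Qed.

(** Freeing the [j]-th mark: as a function of the set allowed for the point
    [(G j, L j)], both sides are finite measures on the plane, and they agree on
    rectangles because the arrival part of a rectangle can be moved into the
    conditioning event. *)
Let formula_step n j :
  (forall A C, sG A -> (forall k, measurable (C k)) ->
    (forall k, (j <= k)%N -> exists2 D, measurable D & C k = setT `*` D) ->
    formula n A C) ->
  (forall A C, sG A -> (forall k, measurable (C k)) ->
    (forall k, (j < k)%N -> exists2 D, measurable D & C k = setT `*` D) ->
    formula n A C).
Proof.
move=> ih A C sA mC rC.
have ihX B D : sG B -> measurable D -> formula n B (subst C j (setT `*` D)).
  move=> sB mD; apply: ih => //.
    by move=> k; rewrite /subst; case: ifP => // _; exact: measurableX.
  move=> k; rewrite leq_eqVlt /subst => /predU1P[->|jk].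
    by rewrite eqxx; exists D.
  by rewrite gtn_eqF//; exact: rC.
have [nj|jn] := leqP n j.
  have := ihX A setT sA measurableT; rewrite /formula.
  have e k : (k < n)%N -> subst C j (setT `*` setT) k = C k.
    by move=> kn; rewrite /subst ltn_eqF// (leq_trans kn).
  rewrite (eq_bigcapr (G := fun k => mark_event (C k) k)); last by move=> k /= kn; rewrite e.
  by move=> ->; apply: eq_integral => w _; apply: eq_bigr => k _; rewrite e.
pose E := \bigcap_(k in [set k | (k < n)%N /\ k != j]) mark_event (C k) k.
pose W w := \prod_(k < n | k != Ordinal jn) mark_prob (C k) (G k w).
have evE X : \bigcap_(k < n) mark_event (subst C j X k) k = mark_event X j `&` E.
  apply/seteqP; split => w.
    move=> h; split; first by have := h j jn; rewrite /subst eqxx.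
    by move=> k [kn /negPf kj]; have := h k kn; rewrite /subst kj.
  move=> [hj hE] k /= kn; rewrite /subst; case: eqVneq => [-> //|kj].
  by apply: hE; split.
have prodE X w : \prod_(k < n) mark_prob (subst C j X k) (G k w) = mark_prob X (G j w) * W w.
  rewrite (bigD1 (Ordinal jn))//= /subst eqxx; congr (_ * _).
  apply: eq_bigr => k kj; case: eqP => // kj'.
  by move/eqP : kj; case; apply/val_inj.
pose phi B X := P (B `&` (mark_event X j `&` E)) = \int[P]_(w in B) (mark_prob X (G j w) * W w).
have phiE B X : formula n B (subst C j X) <-> phi B X.
  rewrite /formula /phi evE; split => [->|->]; [|apply/esym];
    by apply: eq_integral => w _; rewrite prodE.
have phi_rect B D : sG B -> measurable D -> phi B (setT `*` D).
  by move=> sB mD; apply/phiE; exact: ihX.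
suff : phi A (C j).
  move/phiE; rewrite /formula.
  have e k : subst C j (C j) k = C k by rewrite /subst; case: eqVneq => // ->.
  rewrite (eq_bigcapr (G := fun k => mark_event (C k) k)); last by move=> k /= kn; rewrite e.
  by move=> ->; apply: eq_integral => w _; apply: eq_bigr => k _; rewrite e.
pose F := [set w | G j w \is a fin_num].
have sF : sG F by exact: sG_fin.
have mA := sG_measurable sA; have mF := sG_measurable sF.
have mE : measurable E.
  by apply: bigcap_measurableType => k _; exact: measurable_mark_event.
pose W' w := (\prod_(k < n | k != Ordinal jn) fine (mark_prob (C k) (G k w)))%R.
have WE w : W w = (W' w)%:E.
  by rewrite /W /W' -prodEFin; apply: eq_bigr => k _; rewrite -mark_probE.
have mW : measurable_fun setT W.
  rewrite (_ : W = EFin \o W'); last exact/funext.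
  apply/measurable_EFinP; rewrite /W'; under eq_fun do rewrite big_mkcond/=.
  apply: (@measurable_prod _ Om R setT 'I_n (index_enum 'I_n) (fun k w =>
    if k != Ordinal jn then fine (mark_prob (C k) (G k w)) else 1%R)).
  move=> k _; case: (k != _) => //; apply: measurableT_comp => //.
  by apply: measurableT_comp => //; exact: measurable_mark_prob.
have W01 w : 0 <= W w <= 1.
  have f01 k : (0 <= fine (mark_prob (C k) (G k w)) <= 1)%R.
    by rewrite -!lee_fin -mark_probE//; exact: mark_prob_itv.
  rewrite WE !lee_fin prodr_ge0/=; last by move=> k _; case/andP: (f01 k).
  by apply: prodr_ile1.
have Wfin w : W w = (fine (W w))%:E.
  rewrite fineK// ge0_fin_numE; first by case/andP: (W01 w) => _ /le_lt_trans; apply; rewrite ltry.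
  by case/andP: (W01 w).
have mphi X : measurable X -> measurable_fun setT (fun w => mark_prob X (G j w) * W w).
  move=> mX; apply: emeasurable_funM => //.
  by apply: measurableT_comp; [exact: measurable_mark_prob|].
have phi0 X w : measurable X -> 0 <= mark_prob X (G j w) * W w.
  by move=> mX; rewrite mule_ge0//; [case/andP: (mark_prob_itv (G j w) mX)|case/andP: (W01 w)].
suff phiF : phi (A `&` F) (C j).
  have phiNF : phi (A `\` F) (C j).
    have := phi_rect (A `\` F) setT (sGD sA sF) measurableT.
    rewrite /phi.
    have e X : (A `\` F) `&` (mark_event X j `&` E) = (A `\` F) `&` E.
      apply/seteqP; split => w [[Aw Fw]]; first by move=> [].
      by move=> Ew; split => //; split => // /Fw.
    rewrite !e => ->; apply: eq_integral => w; rewrite inE => -[_ Fw].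
    by rewrite /mark_prob; move: Fw; rewrite /F/=; case: (G j w).
  rewrite /phi -(setUIDK A F).
  have mC' : measurable (mark_event (C j) j `&` E).
    by apply: measurableI => //; exact: measurable_mark_event.
  have dAF : (A `&` F) `&` (A `\` F) = set0.
    by apply/seteqP; split => // w [[_ Fw] [_ /(_ Fw)]].
  rewrite setIUl measureU//; last 3 first.
  - by apply: measurableI => //; exact: measurableI.
  - by apply: measurableI => //; exact: measurableD.
  - by apply/seteqP; split => // w [[[_ Fw] _] [[_ /(_ Fw)]]].
  rewrite ge0_integral_setU//=; last 5 first.
  - exact: measurableI.
  - exact: measurableD.
  - by apply: measurable_funTS; exact: mphi.
  - by move=> w _; exact: phi0.
  - by rewrite disj_set2E dAF.
  by rewrite -phiF -phiNF.
pose gam w := (fine (G j w), L j w).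
have mAFE : measurable ((A `&` F) `&` E) by apply: measurableI => //; exact: measurableI.
pose m1 := image_measure (mrestr P mAFE) (mpoint j).
pose h w := (fine (W w) * \1_(A `&` F) w)%R.
have h0 w : (0 <= h w)%R.
  by rewrite /h mulr_ge0// fine_ge0//; case/andP: (W01 w).
have mh : measurable_fun setT h.
  apply: measurable_funM; first exact: measurableT_comp.
  by apply: measurable_indic; exact: measurableI.
pose k w : {measure set (R * R) -> \bar R} := pairk (fine (G j w)).
have mk X : measurable X -> measurable_fun setT (k ^~ X).
  move=> mX; under eq_fun do rewrite /k pairkE.
  apply: (measurableT_comp (f := fun s => nu s (xsection X s))) => //.
    exact: measurable_kernel_section.
  exact: measurableT_comp.
have kE X : \int[P]_w ((h w)%:E * k w X) =
    \int[P]_(w in A `&` F) (mark_prob X (G j w) * W w).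
  rewrite [RHS]integral_mkcond; apply: eq_integral => w _.
  rewrite patchE /h indicE; case: ifPn => [|_]; last by rewrite mulr0 mul0e.
  rewrite inE mulr1 -Wfin muleC => -[_ Fw]; congr (_ * _).
  by rewrite /k pairkE /mark_prob; move: Fw; rewrite /F/=; case: (G j w).
have hoo : \int[P]_w ((h w)%:E * k w setT) < +oo.
  rewrite kE; apply: (@le_lt_trans _ _ (P (A `&` F `&` (mark_event (setT `*` setT) j `&` E)))).
    rewrite -[setT in X in X <= _]setXTT.
    by rewrite -(phi_rect (A `&` F) setT (sGI sA sF) measurableT).
  apply: le_lt_trans (probability_le1 _ _) _; last by rewrite ltry.
  apply: measurableI; [exact: measurableI|apply: measurableI => //].
  by apply: measurable_mark_event; exact: measurableX.
have m1E X : m1 X = P (A `&` F `&` (mark_event X j `&` E)).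
  rewrite /m1 /image_measure/= /pushforward /mrestr; congr (P _).
  apply/seteqP; split => w.
    by move=> [Xw [[Aw Fw] Ew]]; split => //; split.
  by move=> [[Aw Fw] [Xw Ew]]; split => //; exact: Xw.
have m12 X : measurable X -> m1 X = mixture h0 mh mk hoo X.
  pose Rect : set (set (R * R)) := [set B `*` D | B in measurable & D in measurable].
  apply: (@measure_unique _ _ _ Rect (fun=> setT) _ _ _ _ m1 (mixture h0 mh mk hoo)) => //.
  - exact: measurable_prod_measurableType.
  - move=> _ _ [B1 mB1 [D1 mD1 <-]] [B2 mB2 [D2 mD2 <-]]; rewrite -setXI.
    exists (B1 `&` B2); first exact: measurableI.
    by exists (D1 `&` D2) => //; exact: measurableI.
  - by move=> _; exists setT => //; exists setT => //; rewrite setXTT.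
  - by rewrite bigcup_const//; exists 0%N.
  - move=> _ [B mB [D mD <-]].
    pose FB := F `&` (G j @^-1` (EFin @` B)).
    have sFB : sG FB.
      apply: sGI => //; apply: sG_preimage; exact: measurable_image_EFin.
    rewrite m1E [RHS]kE.
    have -> : A `&` F `&` (mark_event (B `*` D) j `&` E) =
        A `&` FB `&` (mark_event (setT `*` D) j `&` E).
      apply/seteqP; split => w.
        move=> [[Aw Fw] [hw Ew]]; have [/= Bw Dw] := hw Fw.
        have FBw : FB w by split => //; exists (fine (G j w)) => //; rewrite fineK.
        exact: (conj (conj Aw FBw) (conj (fun=> conj I Dw) Ew)).
      move=> [[Aw [Fw [s Bs Gs]]] [hw Ew]]; split; first by split.
      split => // /hw [_ Dw].
      by split => //=; rewrite -Gs.
    rewrite (phi_rect (A `&` FB) D (sGI sA sFB) mD).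
    rewrite [LHS]integral_mkcond [RHS]integral_mkcond; apply: eq_integral => w _.
    rewrite !patchE; have [|] := pselect ((A `&` FB) w).
      move=> [Aw [Fw [s Bs Gs]]]; rewrite !mem_set//; last first.
        by split => //; split => //; exists s.
      rewrite -Gs /mark_prob; congr (_ * _).
      by rewrite !in_xsectionX// inE.
    move=> NAFB; rewrite memNset//; case: ifPn => //; rewrite inE => -[Aw Fw].
    have NB : ~ B (fine (G j w)).
      move=> Bw; apply: NAFB; split => //; split => //.
      by exists (fine (G j w)) => //; rewrite fineK.
    move: NB Fw; rewrite /F/= /mark_prob; case: (G j w) => // s /= NBs _.
    by rewrite notin_xsectionX ?measure0 ?mul0e// notin_setE.
  - move=> _; rewrite m1E; apply: le_lt_trans (probability_le1 _ _) _; last by rewrite ltry.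
    apply: measurableI; [exact: measurableI|apply: measurableI => //].
    exact: measurable_mark_event.
by rewrite /phi -m1E m12// [LHS]kE.
Qed.

(** The independence of the services is given for sets that constrain the mark
    only; the sets of points are freed one coordinate at a time. *)
Lemma marks_product n A (C : nat -> set (R * R)) :
  sG A -> (forall k, measurable (C k)) ->
  P (A `&` \bigcap_(k < n) mark_event (C k) k)
  = \int[P]_(w in A) \prod_(k < n) mark_prob (C k) (G k w).
Proof.
move=> sA mC.
have H j : forall A C, sG A -> (forall k, measurable (C k)) ->
    (forall k, (j <= k)%N -> exists2 D, measurable D & C k = setT `*` D) ->
    formula n A C.
  elim: j => [{}A {}C {}sA {}mC|j]; last exact: formula_step.
  move=> /(_ _ (leq0n _)) rC.
  have /choice[D hD] : forall k, exists D, measurable D /\ C k = setT `*` D.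
    by move=> k; have [D mD CD] := rC k; exists D.
  have mD k : measurable (D k) by case: (hD k).
  have CD k : C k = setT `*` D k by case: (hD k).
  rewrite /formula.
  have := indL sA n mD.
  rewrite (eq_bigcapr (G := fun k => mark_event (C k) k)); last first.
    move=> k _; apply/seteqP; split => w; rewrite /mark_event CD/=.
      by move=> h /h.
    by move=> h /h [].
  move=> ->; apply: eq_integral => w _; apply: eq_bigr => k _.
  by rewrite /mark_prob CD; case: (G k w) => // s; rewrite in_xsectionX// inE.
pose C' k := if (k < n)%N then C k else setT `*` setT.
have := H n A C' sA; rewrite /formula.
have e k : (k < n)%N -> C' k = C k by move=> kn; rewrite /C' kn.
rewrite (eq_bigcapr (G := fun k => mark_event (C k) k)); last by move=> k /= kn; rewrite e.
move=> ->.
- by apply: eq_integral => w _; apply: eq_bigr => k _; rewrite e.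
- by move=> k; rewrite /C'; case: ifP => // _; exact: measurableX.
- by move=> k nk; exists setT => //; rewrite /C' ltnNge nk.
Qed.

End marked_arrivals.

Section marked_measure.
Context (R : realType) (nu : R.-pker R ~> R).
Local Notation mu := (@lebesgue_measure R).

Definition mark_mass (B : set (R * R)) (s : R) : R := fine (nu s (xsection B s)).

Lemma mark_mass_fin B s : measurable B -> nu s (xsection B s) = (mark_mass B s)%:E.
Proof.
move=> mB; have /andP[h0 h1] := mark_prob_itv nu s%:E mB.
by rewrite /mark_mass fineK// ge0_fin_numE//; apply: le_lt_trans h1 _; rewrite ltry.
Qed.

Lemma mark_mass01 B s : measurable B -> 0 <= mark_mass B s <= 1.
Proof.
by move=> mB; rewrite -!lee_fin -mark_mass_fin//; exact: (mark_prob_itv nu s%:E mB).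
Qed.

Lemma measurable_mark_mass B : measurable B -> measurable_fun setT (mark_mass B).
Proof.
by move=> mB; apply: measurableT_comp => //; exact: measurable_kernel_section.
Qed.

Lemma mark_massC B s : measurable B -> mark_mass (~` B) s = 1 - mark_mass B s.
Proof.
move=> mB; have mBs : measurable (xsection B s) by exact: measurable_xsection.
apply: EFin_inj; rewrite EFinB -!mark_mass_fin//; last exact: measurableC.
have -> : xsection (~` B) s = ~` xsection B s.
  by rewrite !xsectionE.
have nuT : (nu s setT = 1)%E by exact: prob_kernel.
have nuToo : (nu s setT < +oo)%E by rewrite nuT ltry.
by rewrite -setTD measureD// setTI; congr (_ - _)%E; exact: nuT.
Qed.

(** Arrivals with intensity [rho] on [[0, T]] and marks drawn from [nu]. *)
Lemma marked_measure_exists (rho : R -> R) (K T : R) :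
  measurable_fun (`[0, T]%classic : set R) rho ->
  (forall s, s \in `[0, T] -> 0 <= rho s <= K) ->
  exists m : {finite_measure set (R * R)%type -> \bar R}, forall B, measurable B ->
    (m B = \int[mu]_(s in `[0%R, T]) (rho s * mark_mass B s)%:E)%E.
Proof.
move=> mrho rhoK; pose h : R -> R := rho \_ `[0, T].
have h0 s : 0 <= h s.
  by rewrite /h patchE; case: ifPn => //; rewrite inE => /rhoK /andP[].
have mh : measurable_fun setT h by exact/(measurable_restrictT _ _).1.
have mpair (s : R) : measurable_fun setT (pair s : R -> R * R).
  exact: pair1_measurable.
pose k (s : R) : {measure set (R * R) -> \bar R} := image_measure (nu s) (mpair s).
have kE s B : measurable B -> k s B = (mark_mass B s)%:E.
  by move=> mB; rewrite -mark_mass_fin// xsectionE.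
have mk B : measurable B -> measurable_fun setT (k ^~ B).
  move=> mB; rewrite (_ : k ^~ B = EFin \o mark_mass B); last first.
    by apply/funext => s; rewrite kE.
  by apply/measurable_EFinP; exact: measurable_mark_mass.
have int_h B : measurable B -> (\int[mu]_s ((h s)%:E * k s B) =
    \int[mu]_(s in `[0%R, T]) (rho s * mark_mass B s)%:E)%E.
  move=> mB; rewrite [RHS]integral_mkcond; apply: eq_integral => s _.
  by rewrite kE// /h !patchE; case: ifPn => // _; rewrite mul0e.
have hoo : (\int[mu]_s ((h s)%:E * k s setT) < +oo)%E.
  rewrite int_h//; rewrite ltey_eq (bounded_integral_fin_num (K := K))//.
    apply: measurable_funM => //; apply: measurable_funTS.
    exact: measurable_mark_mass.
  move=> s /rhoK /andP[rho0 rhoK'].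
  have /andP[m0 m1] := mark_mass01 s measurableT.
  by rewrite mulr_ge0//= -[leRHS]mulr1 ler_pM.
exists (mixture (S := measurableTypeR R) (mu := mu) (k := k) h0 mh mk hoo) => B mB.
exact: int_h.
Qed.

End marked_measure.

Section point_configuration.
Local Open Scope ereal_scope.
Context d (Om : measurableType d) (R : realType) (P : probability Om R).
Variables (nu : R.-pker R ~> R) (G : nat -> Om -> \bar R) (L : nat -> Om -> R).
Hypothesis mG : forall k, measurable_fun setT (G k).
Hypothesis mL : forall k, measurable_fun setT (L k).
Variable (T : R).
Local Notation mu := (@lebesgue_measure R).

Definition box : set (R * R) := `[0%R, T] `*` setT.

Definition points (w : Om) : config (R * R)%type :=
  [set x | box x /\ exists k, G k w = x.1%:E /\ L k w = x.2].

Lemma measurable_box : measurable box.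
Proof. exact: measurableX. Qed.

Lemma preimage_points_void B :
  points @^-1` void B = \bigcap_k mark_event G L (~` (B `&` box)) k.
Proof.
apply/seteqP; split => w.
  move=> wB k _ Gfin [Bw boxw].
  have : (points w `&` B) (fine (G k w), L k w).
    by split => //; split => //; exists k; rewrite fineK.
  by rewrite (wB : points w `&` B = set0).
move=> h; apply/seteqP; split => // -[s y] [[bx [k [/= Gk Lk]]] Bx].
have /= := h k I; rewrite /mark_event/= Gk Lk => /(_ isT); apply; exact: conj.
Qed.

Lemma measurable_points : measurable_fun setT points.
Proof.
apply: measurable_config => B mB; rewrite preimage_points_void.
apply: bigcapT_measurable => k; apply: (measurable_mark_event mG mL).
by apply/measurableC/measurableI => //; exact: measurable_box.
Qed.

(** Given the arrivals, the marked points avoid [B] with the probability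
    [\prod_k (1 - nu_(G_k) (B_(G_k)))], where [B_s] is the section of [B] at [s];
    the mean of such a product over a Poisson process is an exponential. *)
Lemma points_void_prob (mean : set R -> \bar R) (rho : R -> R) (K : R)
    (m : {finite_measure set (R * R)%type -> \bar R}) B :
  independent_services P nu G L ->
  poisson_point_process P mean (arrival_count G) ->
  measurable_fun (`[0%R, T]%classic : set R) rho ->
  (forall s, s \in `[0, T] -> 0 <= rho s <= K)%R ->
  (forall D, measurable D -> D `<=` `[0%R, T] ->
     mean D = \int[mu]_(s in `[0%R, T]) (rho s * \1_D s)%:E) ->
  (forall B, measurable B ->
     m B = \int[mu]_(s in `[0%R, T]) (rho s * mark_mass nu B s)%:E) ->
  measurable B ->
  P (points @^-1` void B) = (expR (- fine (m B)))%:E.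
Proof.
move=> indL PG mrho rhoK meanE mE mB.
have [kap kapE] := density_measure_exists mrho rhoK.
pose C := ~` (B `&` box).
have mBx : measurable (B `&` box) by apply: measurableI => //; exact: measurable_box.
have mC : measurable C by exact: measurableC.
pose h := mark_mass nu C.
have hE s : (1 - h s)%R = mark_mass nu (B `&` box) s.
  by rewrite /h mark_massC// opprB addrC subrK.
have mh : measurable_fun setT h by exact: measurable_mark_mass.
have h01 s : (0 <= h s <= 1)%R by exact: mark_mass01.
have box_out s : ~ `[0%R, T]%classic s -> mark_mass nu (B `&` box) s = 0%R.
  move=> ns; rewrite /mark_mass (_ : xsection _ _ = set0) ?measure0//.
  by apply/seteqP; split => // y /=; rewrite xsectionE => -[_ []].
have h1 s : ~ `[0%R, T]%classic s -> h s = 1%R.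
  move=> ns; have := hE s; rewrite box_out// => /eqP; rewrite subr_eq0 => /eqP.
  by move->.
have meanK D : measurable D -> D `<=` `[0%R, T]%classic -> mean D = kap D.
  by move=> mD Dsub; rewrite meanE// -[D in RHS]setIT -integral_indic// kapE.
have := cvg_arrival_product mG PG (measurable_itv `[0%R, T]%R) meanK mh h01 h1.
have -> : \int[kap]_s (1 - h s)%:E = m B.
  rewrite kapE//; last 2 first.
  - exact: measurable_funB.
  - by move=> s; rewrite subr_ge0; case/andP: (h01 s).
  rewrite mE//; apply: eq_integral => s; rewrite inE/= => sT; congr (_ * _)%:E.
  rewrite hE /mark_mass; congr (fine (nu s _)); rewrite !xsectionE.
  by apply/seteqP; split => y /=; [case|split].
move=> lim1.
have lim2 : P (\bigcap_(k < n) mark_event G L C k) @[n --> \oo] --> P (points @^-1` void B).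
  rewrite preimage_points_void.
  rewrite (_ : \bigcap_k _ = \bigcap_n \bigcap_(k < n) mark_event G L C k); last first.
    apply/seteqP; split => w h'; first by move=> n _ k _; exact: h'.
    by move=> k _; exact: (h' k.+1 I k (ltnSn k)).
  apply: nonincreasing_cvg_mu => //.
  - by rewrite -ge0_fin_numE//; apply: fin_num_measure; apply: bigcap_measurableType => k _; exact: measurable_mark_event.
  - by move=> n; apply: bigcap_measurableType => k _; exact: measurable_mark_event.
  - apply: bigcapT_measurable => n; apply: bigcap_measurableType => k _; exact: measurable_mark_event.
  - move=> n1 n2 n12; apply/subsetPset => w h' k /= kn1; apply: h' => /=.
    exact: leq_trans n12.
apply: (cvg_unique _ lim2) => //.
rewrite (_ : (fun n => _) = fun n => \int[P]_w (\prod_(k < n) at_arrival h (G k w))%:E)//.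
apply/funext => n; rewrite -[X in P X]setTI.
rewrite (marks_product mG mL indL n (C := fun=> C))//; last first.
  exact: (@measurableT _ (g_sigma_algebraType (\bigcup_(i in setT) preimage_set_system setT (G i) measurable))).
apply: eq_integral => w _; rewrite -prodEFin; apply: eq_bigr => k _.
by rewrite /mark_prob /at_arrival /h; case: (G k w) => // s; rewrite mark_mass_fin.
Qed.

(** Counting no marked point in [B] is the same event as [points] avoiding
    [B]. *)
Lemma points_void_prob_count (mean : set (R * R) -> \bar R) B :
  poisson_point_process P mean (marked_count G L) -> measurable B ->
  0 <= mean (B `&` box) -> mean (B `&` box) < +oo ->
  P (points @^-1` void B) = (expR (- fine (mean (B `&` box))))%:E.
Proof.
move=> PM mB m0 moo.
have mBx : measurable (B `&` box) by apply: measurableI => //; exact: measurable_box.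
have := poisson_count_eq PM 0 mBx m0 moo.
rewrite exp_coeffE/= fact0 invr1 expr0 !mulr1 => <-; congr (P _).
rewrite preimage_points_void; apply/seteqP; split => w.
  move=> h; rewrite /marked_count/=; apply: eseries0 => k _ _.
  rewrite indicE memNset// => -[[s y] [Bs bs] [/= Gk Lk]].
  by have := h k I; rewrite /mark_event/= -Gk -Lk => /(_ isT); apply.
rewrite /= /marked_count => h k _ Gfin Bx.
have : (\1_((fun p : R * R => (p.1%:E, p.2)) @` (B `&` box)) (G k w, L k w))%:E <= 0%:E :> \bar R.
  rewrite -[leRHS]h; apply: le_trans (nneseries_lim_ge k.+1 _) => //.
  by rewrite big_nat_recr//= leeDr// sume_ge0.
rewrite indicE mem_set ?lee_fin ?ler10//.
by exists (fine (G k w), L k w) => //=; rewrite fineK.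
Qed.

End point_configuration.

(** * Simple arrivals *)

Section simple_arrivals.
Context (R : realType).

Definition simple_arrivals (T : R) (G : nat -> \bar R) : Prop :=
  [/\ forall k s, G k = s%:E -> 0 <= s,
      exists N, forall k s, G k = s%:E -> s <= T -> (k < N)%N
    & forall k l s, G k = s%:E -> G l = s%:E -> s <= T -> k = l].

Context d (Om : measurableType d) (P : probability Om R).
Variables (mean : set R -> \bar R) (G : nat -> Om -> \bar R).
Hypothesis PG : poisson_point_process P mean (arrival_count G).

Let cell (T : R) (n i : nat) : set R :=
  `[0, T] `&` [set s | Num.truncn (s * n.+1%:R) = i].

Let cell_sub T n i : cell T n i `<=` `[i%:R / n.+1%:R, i.+1%:R / n.+1%:R].
Proof.
move=> s [/=]; rewrite !in_itv/= => /andP[s0 _] <-.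
rewrite ler_pdivrMr// ler_pdivlMr//.
have /andP[-> /ltW ->//] := truncn_itv (mulr_ge0 s0 (ler0n R n.+1)).
Qed.

Let measurable_cell T n i : measurable (cell T n i).
Proof.
rewrite (_ : cell T n i = `[0, T] `&` `[i%:R / n.+1%:R, i.+1%:R / n.+1%:R[%classic).
  exact: measurableI.
apply/seteqP; split => s [/=]; rewrite !in_itv/= ler_pdivrMr// ltr_pdivlMr//.
  move=> /andP[s0 sT] <-; split; first by rewrite s0.
  by apply: truncn_itv; rewrite mulr_ge0.
by move=> sT si; split => //; exact: truncn_def.
Qed.

(** A Poisson variable of mean [m] exceeds 1 with probability
    [1 - exp (- m) (1 + m)], at most [m ^ 2]. *)
Lemma poisson_count_ge2 D : measurable D -> (0 <= mean D)%E -> (mean D < +oo)%E ->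
  exists2 B, measurable B /\ (P B <= (fine (mean D) ^+ 2)%:E)%E &
    forall w, ~ B w -> arrival_count G D w = 0%E \/ arrival_count G D w = 1%E.
Proof.
move=> mD D0 Doo.
pose E n := [set w | arrival_count G D w = n%:R%:E].
have mE n : measurable (E n).
  have := measurable_count PG mD measurableT (emeasurable_set1 n%:R%:E).
  by rewrite setTI.
exists (~` (E 0%N `|` E 1%N)); last first.
  by move=> w /= /contrapT[h|h]; [left|right]; exact: h.
split; first by apply: measurableC; exact: measurableU.
rewrite probability_setC; last exact: measurableU.
rewrite measureU//; last first.
  apply/seteqP; split => // w []; rewrite /E/= => -> /eqP.
  by rewrite eqe eqr_nat.
rewrite (_ : (P (E 0%N) + P (E 1%N) = (expR (- fine (mean D)) * (1 + fine (mean D)))%:E)%E); last first.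
  rewrite mulrDr EFinD; congr (_ + _)%E.
    have := poisson_count_eq PG 0 mD D0 Doo.
    by rewrite exp_coeffE/= fact0 invr1 expr0 !mulr1.
  have := poisson_count_eq PG 1 mD D0 Doo.
  by rewrite exp_coeffE/= (_ : 1`! = 1%N)// invr1 expr1 mul1r.
rewrite -EFinB lee_fin; set x := fine (mean D).
have x0 : 0 <= x by exact: fine_ge0.
have : 1 - x <= expR (- x) by rewrite expR_ge1Dx.
nra.
Qed.

Let in_EFin x (D : set R) s : x = s%:E -> D s -> (x \in EFin @` D : nat) = 1%N.
Proof. by move=> -> Ds; rewrite mem_set//; exists s. Qed.

Let count_ge1 D w p k s : arrival_count G D w = p%:R%:E ->
  G k w = s%:E -> D s -> (0 < p)%N.
Proof.
move=> /arrival_count_eventually[N _ hN] Gk Ds.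
have <- := hN (maxn N k.+1) (leq_maxl _ _).
have kn : (k < maxn N k.+1)%N by rewrite leq_max ltnSn orbT.
by rewrite (bigD1 (Ordinal kn))//= (in_EFin Gk Ds) add1n.
Qed.

Let count_ge2 D w p k l s : arrival_count G D w = p%:R%:E ->
  G k w = s%:E -> G l w = s%:E -> D s -> k != l -> (1 < p)%N.
Proof.
move=> /arrival_count_eventually[N _ hN] Gk Gl Ds kl.
have <- := hN (maxn N (maxn k.+1 l.+1)) (leq_maxl _ _).
have kn : (k < maxn N (maxn k.+1 l.+1))%N by rewrite !leq_max ltnSn orbT.
have ln : (l < maxn N (maxn k.+1 l.+1))%N by rewrite !leq_max ltnSn !orbT.
rewrite (bigD1 (Ordinal kn))//= (in_EFin Gk Ds) (bigD1 (Ordinal ln))/=; last first.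
  by apply: contra kl => /eqP[->].
by rewrite (in_EFin Gl Ds).
Qed.

(** Cutting [[0, T]] into cells of length [1 / n], two arrivals share a cell with
    probability at most a sum of [O(n)] terms of order [1 / n ^ 2]. *)
Lemma simple_arrivals_ae (T c : R) : 0 <= T -> 0 <= c ->
  (forall D, measurable D -> D `<=` `[0, T] ->
     (0 <= mean D <= c%:E * @lebesgue_measure R D)%E) ->
  mean `]-oo, 0[%classic = 0%E ->
  {ae P, forall w, simple_arrivals T (G ^~ w)}.
Proof.
move=> T0 c0 mean_le mean_neg.
have fin_count : {ae P, forall w, exists p : nat, arrival_count G `[0, T] w = p%:R%:E}.
  apply: (poisson_count_nat PG) => //.
    by have /andP[] := mean_le _ (measurable_itv `[0, T]) (@subset_refl _ _).
  have /andP[_ /le_lt_trans] := mean_le _ (measurable_itv `[0, T]) (@subset_refl _ _); apply.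
  apply: lte_mul_pinfty; rewrite ?lee_fin//.
  by rewrite lebesgue_measure_itv/=; case: ifP; rewrite ?oppe0 ?adde0 ltry.
have neg_count : {ae P, forall w, arrival_count G `]-oo, 0[ w = 0%E}.
  have mneg : measurable (`]-oo, 0[%classic : set R) by [].
  have := poisson_count_eq PG 0 mneg; rewrite mean_neg => /(_ (lexx _) (ltry _)).
  rewrite oppr0 expR0 exp_coeffE/= fact0 invr1 expr0 !mulr1 => P1.
  have mE : measurable [set w | arrival_count G `]-oo, 0[%classic w = 0%:R%:E].
    have := measurable_count PG mneg measurableT (emeasurable_set1 0%:R%:E).
    by rewrite setTI.
  exists (~` [set w | arrival_count G `]-oo, 0[%classic w = 0%:R%:E]); split.
  - exact: measurableC.
  - by rewrite probability_setC// P1 subee.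
  - by move=> w /= h h'; apply: h.
pose M := T + 1.
have M0 : 0 < M by rewrite ltr_wpDl.
have bad n : exists B, [/\ measurable B, (P B <= (M * c ^+ 2 / n.+1%:R)%:E)%E &
    forall w, ~ B w -> forall k l s, G k w = s%:E -> G l w = s%:E -> 0 <= s <= T -> k = l].
  pose J := (Num.truncn (T * n.+1%:R)).+1.
  have mean_cell i : (0 <= mean (cell T n i))%E /\ (mean (cell T n i) <= (c / n.+1%:R)%:E)%E.
    have /andP[-> le1] := mean_le _ (@measurable_cell T n i) (@subIsetl _ _ _).
    split => //; apply: le_trans le1 _; rewrite EFinM lee_wpmul2l ?lee_fin//.
    apply: (@le_trans _ _ (lebesgue_measure `[i%:R / n.+1%:R, i.+1%:R / n.+1%:R]%classic)).
      apply: le_measure; rewrite ?inE; last exact: cell_sub.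
        exact: measurable_cell.
      exact: measurable_itv.
    rewrite lebesgue_measure_itv/= lte_fin ltr_pM2r ?invr_gt0// ltr_nat ltnSn.
    by rewrite -EFinB lee_fin -mulrBl -natr1 addrC addKr mul1r.
  have cell_oo i : (mean (cell T n i) < +oo)%E.
    by apply: le_lt_trans (mean_cell i).2 _; rewrite ltry.
  have /choice[B hB] : forall i, exists B, [/\ measurable B,
      (P B <= (fine (mean (cell T n i)) ^+ 2)%:E)%E &
      forall w, ~ B w -> arrival_count G (cell T n i) w = 0%E \/
        arrival_count G (cell T n i) w = 1%E].
    move=> i; have [B [mB PB] Bw] := poisson_count_ge2 (@measurable_cell T n i)
      (mean_cell i).1 (cell_oo i).
    by exists B.
  have mB i : measurable (B i) by case: (hB i).
  exists (\big[setU/set0]_(i < J) B i); split.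
  - by apply: bigsetU_measurable => i _.
  - apply: (@le_trans _ _ (\sum_(i < J) P (B i))%E).
      exact: (Boole_inequality P (fun i _ => mB i)).
    apply: (@le_trans _ _ (\sum_(i < J) ((c / n.+1%:R) ^+ 2)%:E)%E).
      apply: lee_sum => i _; case: (hB i) => _ /le_trans h _; apply: h.
      have [m0 m1] := mean_cell i.
      rewrite lee_fin lerXn2r ?nnegrE ?fine_ge0 ?divr_ge0//.
      by rewrite -lee_fin fineK// ge0_fin_numE.
    rewrite sumEFin sumr_const card_ord lee_fin -[X in X <= _]mulr_natl.
    have JM : J%:R <= M * n.+1%:R.
      rewrite /J -natr1 /M mulrDl mul1r lerD ?truncn_le ?mulr_ge0//.
      by rewrite ler1n.
    have -> : M * c ^+ 2 / n.+1%:R = (M * n.+1%:R) * (c / n.+1%:R) ^+ 2.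
      by move: n.+1%:R (ltr0Sn R n) => N N0; field; rewrite gt_eqF.
    by rewrite ler_wpM2r// sqr_ge0.
  - move=> w NB k l s Gk Gl s0T; apply/eqP; apply: contrapT => /negP kl.
    pose i := Num.truncn (s * n.+1%:R).
    have iJ : (i < J)%N.
      by rewrite ltnS; apply: le_truncn; rewrite ler_pM2r//; case/andP: s0T.
    have NBi : ~ B i w.
      move=> Bi; apply: NB; rewrite -bigcup_mkord; by exists i.
    have cs : cell T n i s by split => //=; rewrite in_itv.
    case: (hB i) => _ _ /(_ w NBi)[] /[dup] h.
      by have := @count_ge2 (cell T n i) w 0 k l s h Gk Gl cs kl.
    by have := @count_ge2 (cell T n i) w 1 k l s h Gk Gl cs kl.
have dup : {ae P, forall w k l s, G k w = s%:E -> G l w = s%:E -> 0 <= s <= T -> k = l}.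
  have /choice[B hB] := bad.
  have mB n : measurable (B n) by case: (hB n).
  exists (\bigcap_n B n); split.
  - exact: bigcapT_measurable.
  - apply/eqP; rewrite eq_le measure_ge0 andbT; apply/lee_addgt0Pr => e e0.
    rewrite add0e; pose n := Num.truncn (M * c ^+ 2 / e).
    apply: (@le_trans _ _ (P (B n))).
      apply: le_measure; rewrite ?inE//; last exact: bigcap_inf.
      exact: bigcapT_measurable.
    case: (hB n) => _ /le_trans h _; apply: h.
    rewrite lee_fin ler_pdivrMr// [e * _]mulrC -ler_pdivrMr//.
    by apply/ltW; exact: truncnS_gt.
  - move=> w /= hw n _; apply: contrapT => Bn; apply: hw.
    by case: (hB n) => _ _ /(_ w Bn).
move: fin_count neg_count dup; apply: filterS3 => w [p pE] neg dupw.
have nonneg k s : G k w = s%:E -> 0 <= s.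
  move=> Gk; rewrite leNgt; apply/negP => s0.
  have h := @count_ge1 `]-oo, 0[%classic w 0 k s neg Gk.
  by suff : (0 < 0)%N by []; apply: h; rewrite /= in_itv.
split=> //.
- have [N _ hN] := arrival_count_eventually pE; exists N => k s Gk sT.
  rewrite ltnNge; apply/negP => Nk.
  have := hN k.+1 (leqW Nk); rewrite big_ord_recr/= (hN k Nk) (in_EFin Gk).
    by move/eqP; rewrite addn1 -[X in _ == X]addn0 -addn1 eqn_add2l.
  by rewrite /= in_itv/= (nonneg k)// sT.
- move=> k l s Gk Gl sT; apply: (dupw k l s) => //.
  by rewrite sT (nonneg k).
Qed.

End simple_arrivals.

(** * The cumulated input as a functional of the points *)

Section supremum_of_sequence.
Context (R : realType).

Lemma measurable_sup_range d (S : measurableType d) (D : set S) (h : nat -> S -> R) :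
  (forall x, D x -> has_ubound (range (h ^~ x))) ->
  (forall n, measurable_fun D (h n)) ->
  measurable_fun D (fun x => sup (range (h ^~ x))).
Proof.
move=> ub mh; have := measurable_fun_sups 0%N ub mh.
rewrite (_ : (fun x => sups _ _) = fun x => sup (range (h ^~ x)))//.
apply/funext => x; congr (sup _); apply/seteqP.
by split => _ [n _ <-]; exists n.
Qed.

Lemma sup_dist_le (A : Type) (D : set A) (f g : A -> R) (e : R) : D !=set0 ->
  has_ubound (f @` D) -> has_ubound (g @` D) ->
  (forall a, D a -> `|f a - g a| <= e) -> `|sup (f @` D) - sup (g @` D)| <= e.
Proof.
move=> [a0 Da0]; wlog suff : f g / has_ubound (g @` D) ->
    (forall a, D a -> `|f a - g a| <= e) -> sup (f @` D) - sup (g @` D) <= e.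
  move=> h uf ug fg; rewrite ler_norml h// andbT lerNl opprB h// => a Da.
  by rewrite distrC fg.
move=> ug fg; rewrite lerBlDr; apply: ge_sup; first by exists (f a0), a0.
move=> _ [a Da <-].
have : g a <= sup (g @` D) by apply: ub_le_sup => //; exists a.
have := fg _ Da; rewrite ler_norml => /andP[]; lra.
Qed.

End supremum_of_sequence.

Section presence.
Context (R : realType).

(** The time that a job arriving at [x.1] with service [x.2] spends in the
    system before [t]. *)
Definition presence (t : R) (x : R * R) : R :=
  Num.max 0 (Num.min t (x.1 + x.2) - Num.max 0 x.1).

Lemma presence_ge0 t x : 0 <= presence t x.
Proof. by rewrite /presence le_max lexx. Qed.

Lemma presence_le t x : 0 <= t -> presence t x <= t.
Proof.
move=> t0; rewrite /presence ge_max t0/=.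
have : Num.min t (x.1 + x.2) <= t by rewrite ge_min lexx.
have : 0 <= Num.max 0 x.1 by rewrite le_max lexx.
lra.
Qed.

Lemma presence_dist t t' x : `|presence t x - presence t' x| <= `|t - t'|.
Proof.
wlog tt' : t t' / t' <= t.
  by move=> h; have [/h//|/ltW/h] := leP t' t; rewrite distrC [leRHS]distrC.
rewrite [leRHS]ger0_norm ?subr_ge0// /presence.
move: (x.1 + x.2) (Num.max 0 x.1) => a b; rewrite ler_norml.
have [?|?] := leP t a; have [?|?] := leP t' a; rewrite /Num.max;
  by case: ltP => ?; case: ltP => ?; lra.
Qed.

Lemma measurable_presence t : measurable_fun setT (presence t).
Proof.
apply: measurable_maxr => //; apply: measurable_funB.
  by apply: measurable_minr => //; apply: measurable_funD.
by apply: measurable_maxr.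
Qed.

End presence.

Section cumulated_input.
Context (R : realType) (T : R).
Implicit Types (t : R) (C : config (R * R)%type).

Definition cell (n i : nat) : set (R * R) :=
  [set x | i%:R <= x.1 * n.+1%:R < i.+1%:R].

Lemma measurable_cell n i : measurable (cell n i).
Proof.
have mf : measurable_fun setT (fun x : R * R => x.1 * n.+1%:R).
  exact: measurable_funM.
have := mf measurableT _ (measurable_itv `[i%:R, i.+1%:R[); rewrite setTI.
by congr measurable; apply/seteqP; split => x/=; rewrite in_itv.
Qed.

Definition cell_sup t n i C : R := sup ([set 0] `|` presence t @` (C `&` cell n i)).

(* Rewriting over an index set that does not depend on [t] allows the
   comparison of two values of [t]. *)
Let cell_sup_eq t n i C :
  cell_sup t n i C = sup ((fun o => oapp (presence t) 0 o) @`
     ([set None] `|` Some @` (C `&` cell n i))).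
Proof.
rewrite /cell_sup image_setU image_set1; congr (sup (_ `|` _)).
by rewrite image_comp.
Qed.

Let cell_sup_ub t n i C : 0 <= t ->
  has_ubound ([set 0] `|` presence t @` (C `&` cell n i)).
Proof.
move=> t0; exists t => _ [->//|[x _ <-]]; exact: presence_le.
Qed.

Lemma cell_sup_ge0 t n i C : 0 <= t -> 0 <= cell_sup t n i C.
Proof. by move=> t0; apply: ub_le_sup; [exact: cell_sup_ub|left]. Qed.

Lemma cell_sup_empty t n i C : void (cell n i) C -> cell_sup t n i C = 0.
Proof.
by rewrite /cell_sup /void/= => ->; rewrite image_set0 setU0 sup1.
Qed.

Lemma cell_sup_dist t t' n i C : 0 <= t -> 0 <= t' ->
  `|cell_sup t n i C - cell_sup t' n i C| <= `|t - t'|.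
Proof.
move=> t0 t'0; rewrite !cell_sup_eq; apply: sup_dist_le.
- by exists None; left.
- by rewrite image_setU image_set1 image_comp; exact: cell_sup_ub.
- by rewrite image_setU image_set1 image_comp; exact: cell_sup_ub.
- move=> _ [->|[x _ <-]]/=; first by rewrite subrr normr0.
  exact: presence_dist.
Qed.

(** The supremum exceeds [a] when some point of the cell has presence above
    [a], which is the complement of a void event. *)
Lemma measurable_cell_sup t n i : 0 <= t -> measurable_fun setT (cell_sup t n i).
Proof.
move=> t0 mD; apply: (measurability _ (RGenOInfty.measurableE R)) => //.
move=> _ [_ [a ->] <-]; rewrite setTI.
have [a0|a0] := ltP a 0.
  rewrite (_ : _ @^-1` _ = setT)//; apply/seteqP; split => // C _ /=.
  by rewrite in_itv/= andbT; apply: lt_le_trans a0 _; exact: cell_sup_ge0.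
have mB : measurable (cell n i `&` presence t @^-1` `]a, +oo[%classic).
  apply: measurableI; first exact: measurable_cell.
  by rewrite -[X in measurable X]setTI; apply: measurable_presence.
rewrite (_ : _ @^-1` _ = ~` void (cell n i `&` presence t @^-1` `]a, +oo[%classic)).
  by apply: measurableC; exact: measurable_void.
apply/seteqP; split => C /=; rewrite in_itv/= andbT.
  move=> /sup_gt[|_ [->|[x [Cx cx] <-]]]; first by exists 0; left.
    by rewrite ltNge a0.
  move=> ax; apply/eqP/set0P; exists x; split => //; split => //=.
  by rewrite in_itv/= ax.
move=> /eqP/set0P[x [Cx [cx /=]]]; rewrite in_itv/= andbT => /lt_le_trans; apply.
by apply: ub_le_sup; [exact: cell_sup_ub|right; exists x].
Qed.

Definition cells n := (Num.truncn (T * n.+1%:R)).+1.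

Definition occupied n C : R := \sum_(i < cells n) \1_(~` void (cell n i)) C.

Definition tame : set (config (R * R)%type) :=
  [set C | exists m : nat, forall n, occupied n C <= m%:R].

Lemma measurable_tame : measurable tame.
Proof.
rewrite (_ : tame = \bigcup_(m in setT) \bigcap_(n in setT) (occupied n @^-1` `]-oo, m%:R])).
  apply: bigcupT_measurable => m; apply: bigcapT_measurable => n.
  rewrite -[X in measurable X]setTI; suff mo : measurable_fun setT (occupied n) by apply: mo.
  apply: measurable_sum => i.
  by apply: measurable_indic; apply: measurableC; apply: measurable_void; exact: measurable_cell.
apply/seteqP; split => C.
  by move=> [m hm]; exists m => // n _ /=; rewrite in_itv/=.
by move=> [m _ hm]; exists m => n; have := hm n I; rewrite /= in_itv.
Qed.

Definition presence_sum t n C : R := \sum_(i < cells n) cell_sup t n i C.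

(** The sum of [presence t] over the points of [C], recovered from below by
    choosing the best point in each cell of ever finer partitions: this makes
    measurability with respect to the void events visible. The restriction to
    tame configurations makes the result Lipschitz in [t] everywhere. *)
Definition cumulated t : config (R * R)%type -> R :=
  (fun C => sup (range (fun n => presence_sum t n C))) \_ tame.

(** Only the occupied cells contribute. *)
Lemma presence_sum_dist t t' n C : 0 <= t -> 0 <= t' ->
  `|presence_sum t n C - presence_sum t' n C| <= occupied n C * `|t - t'|.
Proof.
move=> t0 t'0; rewrite /presence_sum -sumrB; apply: le_trans (ler_norm_sum _ _ _) _.
rewrite mulr_suml; apply: ler_sum => i _; rewrite indicE.
have [_|/negP] := boolP (C \in _).
  by rewrite mul1r; exact: cell_sup_dist.
rewrite inE => /contrapT vC.
by rewrite !(cell_sup_empty _ vC) subrr normr0 mul0r.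
Qed.

Lemma presence_sum0 n C : presence_sum 0 n C = 0.
Proof.
rewrite /presence_sum big1// => i _; apply/eqP; rewrite eq_le cell_sup_ge0// andbT.
by apply: ge_sup => [|_ [->//|[x _ <-]]]; [exists 0; left|exact: presence_le].
Qed.

Let presence_sum_ub t C : 0 <= t -> tame C ->
  has_ubound (range (fun n => presence_sum t n C)).
Proof.
move=> t0 [m hm]; exists (m%:R * t) => _ [n _ <-].
have := presence_sum_dist n C t0 (lexx 0).
rewrite presence_sum0 !subr0 [`|t|]ger0_norm// => h.
apply: le_trans (ler_norm _) _; apply: le_trans h _.
by rewrite ler_wpM2r.
Qed.

Lemma cumulated_lipschitz C : exists m : R, 0 <= m /\ forall t t', 0 <= t -> 0 <= t' ->
  `|cumulated t C - cumulated t' C| <= m * `|t - t'|.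
Proof.
rewrite /cumulated; have [/[!inE] tC|ntC] := boolP (C \in tame); last first.
  by exists 0; split => // t t' _ _; rewrite !patchE (negbTE ntC) subrr normr0 mul0r.
have [m hm] := tC; exists m%:R; split => // t t' t0 t'0.
rewrite !patchE mem_set//.
apply: sup_dist_le; [by exists 0%N|exact: presence_sum_ub|exact: presence_sum_ub|].
move=> n _; apply: le_trans (presence_sum_dist n C t0 t'0) _.
by rewrite ler_wpM2r.
Qed.

Lemma cumulated0 C : cumulated 0 C = 0.
Proof.
rewrite /cumulated patchE; case: ifPn => // _.
suff -> : range (fun n => presence_sum 0 n C) = [set 0] by rewrite sup1.
apply/seteqP; split => x.
  by move=> [n _ <-]; rewrite presence_sum0.
by move=> ->; exists 0%N => //; rewrite presence_sum0.
Qed.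

Lemma measurable_cumulated t : 0 <= t -> measurable_fun setT (cumulated t).
Proof.
move=> t0; apply/(measurable_restrictT _ measurable_tame).
apply: measurable_sup_range => [C|n]; first exact: presence_sum_ub.
apply: measurable_funTS; apply: measurable_sum => i; exact: measurable_cell_sup.
Qed.

End cumulated_input.

Section cumulated_finite.
Context (R : realType) (T : R).
Variables (N : nat) (a : pred nat) (x : nat -> R * R) (C : config (R * R)%type).
Hypothesis xT : forall k, (k < N)%N -> a k -> 0 <= (x k).1 <= T.
Hypothesis x_inj : forall k l, (k < N)%N -> (l < N)%N -> a k -> a l ->
  (x k).1 = (x l).1 -> k = l.
Hypothesis CE : C = [set x k | k in [set k | (k < N)%N && a k]].

Let index n k := Num.truncn ((x k).1 * n.+1%:R).

Let cell_index n k i : (k < N)%N -> a k -> cell n i (x k) <-> index n k = i.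
Proof.
move=> kN ak; have /andP[x0 _] := xT kN ak; split.
  by move=> h; apply: truncn_def.
by move=> <-; apply: truncn_itv; rewrite mulr_ge0.
Qed.

Let index_lt n k : (k < N)%N -> a k -> (index n k < cells T n)%N.
Proof.
move=> kN ak; have /andP[x0 xleT] := xT kN ak.
by rewrite ltnS; apply: le_truncn; rewrite ler_pM2r.
Qed.

Let sum_cells n (f : nat -> R) :
  \sum_(i < cells T n) \sum_(k < N | a k && (index n k == i)) f k =
  \sum_(k < N | a k) f k.
Proof.
rewrite (exchange_big_dep (fun k : 'I_N => a k))/=; last by move=> ? ? _ /andP[].
apply: eq_bigr => k ak; rewrite (bigD1 (Ordinal (index_lt n (ltn_ord k) ak)))/=.
  by rewrite big1 ?addr0// => i /andP[/andP[_ /eqP ki]] /eqP[]; exact/val_inj.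
by rewrite ak eqxx.
Qed.

Let cell_hit n i : ~ void (cell n i) C ->
  exists2 k, (k < N)%N && a k & index n k = i.
Proof.
move=> /eqP/set0P[y []]; rewrite CE => -[k kN <-] ci; exists k => //.
by case/andP: kN => kN ak; exact/cell_index.
Qed.

Lemma tame_finite : tame T C.
Proof.
exists N => n; apply: (@le_trans _ _ (\sum_(k < N | a k) 1)); last first.
  rewrite sumr_const ler_nat -[leqRHS]card_ord; exact: max_card.
rewrite -(sum_cells n (fun=> 1)) /occupied; apply: ler_sum => i _; rewrite indicE.
have [|_] := boolP (C \in _); last by apply: sumr_ge0.
rewrite inE => /cell_hit[k /andP[kN ak] ki].
rewrite (bigD1 (Ordinal kN))/= ?ak ?ki ?eqxx//.
by rewrite lerDl sumr_ge0.
Qed.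

Lemma presence_sum_le t n : 0 <= t ->
  presence_sum T t n C <= \sum_(k < N | a k) presence t (x k).
Proof.
move=> t0; rewrite -(sum_cells n (fun k => presence t (x k))); apply: ler_sum => i _.
apply: ge_sup => [|z [->|[y []]]]; first by exists 0; left.
  by apply: sumr_ge0 => k _; exact: presence_ge0.
rewrite CE => -[k /andP[kN ak] <-] /(cell_index _ _ kN ak) ki <-.
rewrite (bigD1 (Ordinal kN))/= ?ak ?ki ?eqxx//.
by rewrite lerDl sumr_ge0// => l _; exact: presence_ge0.
Qed.

(* The mesh is chosen below all the distances between arrival times. *)
Let separated : exists n, forall k l, (k < N)%N -> (l < N)%N -> a k -> a l ->
  index n k = index n l -> k = l.
Proof.
pose b := \sum_(k < N) \sum_(l < N) `|(x k).1 - (x l).1|^-1.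
exists (Num.truncn b) => k l kN lN ak al kl.
apply: (x_inj kN lN ak al); apply/eqP; rewrite -subr_eq0; apply/negPn/negP => d0.
have bD : `|(x k).1 - (x l).1|^-1 <= b.
  rewrite /b (bigD1 (Ordinal kN))//= (bigD1 (Ordinal lN))//= -addrA lerDl.
  by rewrite addr_ge0// ?sumr_ge0// => i _; rewrite sumr_ge0.
have := le_lt_trans bD (truncnS_gt b).
rewrite -[X in X < _ -> _]mulr1 ltr_pdivrMl ?normr_gt0// => dM.
have /andP[k1 k2] := (cell_index _ _ kN ak).2 (erefl (index (Num.truncn b) k)).
have /andP[l1 l2] := (cell_index _ _ lN al).2 (esym kl).
suff : `|(x k).1 - (x l).1| * (Num.truncn b).+1%:R < 1 by rewrite ltNge ltW.
rewrite -[X in _ * X]ger0_norm// -normrM mulrBl ltr_norml.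
move: k1 k2 l1 l2; rewrite -[(index _ _).+1%:R]natr1.
move: ((x k).1 * _) ((x l).1 * _) ((index _ _)%:R) => u v w; lra.
Qed.

Lemma cumulated_finite t : 0 <= t ->
  cumulated T t C = \sum_(k < N | a k) presence t (x k).
Proof.
move=> t0; rewrite /cumulated patchE mem_set; last exact: tame_finite.
apply/eqP; rewrite eq_le; apply/andP; split.
  by apply: ge_sup => [|_ [n _ <-]]; [exists (presence_sum T t 0 C), 0%N|exact: presence_sum_le].
have [n sep] := separated.
apply: (@le_trans _ _ (presence_sum T t n C)); last first.
  apply: ub_le_sup; last by exists n.
  by exists (\sum_(k < N | a k) presence t (x k)) => _ [m _ <-]; exact: presence_sum_le.
rewrite -(sum_cells n (fun k => presence t (x k))); apply: ler_sum => i _.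
have [[k /andP[kN ak] ki]|none] := pselect (exists2 k, (k < N)%N && a k & index n k = i).
  rewrite (bigD1 (Ordinal kN))/= ?ak ?ki ?eqxx// big1 ?addr0.
    apply: ub_le_sup; first by exists t => _ [->//|[y _ <-]]; exact: presence_le.
    right; exists (x k) => //; split; last exact/(cell_index _ _ kN ak).
    by rewrite CE; exists k => //=; rewrite kN.
  move=> l /andP[/andP[al /eqP li]] /eqP[]; apply/val_inj => /=.
  by apply: (sep _ _ (ltn_ord l) kN al ak); rewrite li.
rewrite big1; first exact: cell_sup_ge0.
move=> k /andP[ak /eqP ki]; case: none; exists k => //; by rewrite ltn_ord.
Qed.

End cumulated_finite.

Section queue_of_points.
Local Open Scope ereal_scope.
Context (R : realType).
Local Notation mu := (@lebesgue_measure R).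

Let in_service (x : R * R) (s : R) : R := (x.1 < s < x.1 + x.2)%R%:R.

Let in_serviceE x : in_service x = \1_(`]x.1, (x.1 + x.2)%R[%classic).
Proof.
by apply/funext => s; rewrite /in_service indicE mem_setE in_itv.
Qed.

Let measurable_in_service x : measurable_fun setT (in_service x).
Proof. by rewrite in_serviceE; apply: measurable_indic; exact: measurable_itv. Qed.

Lemma integral_presence t (x : R * R) : (0 <= x.1)%R ->
  \int[mu]_(s in `[0%R, t]) (in_service x s)%:E = (presence t x)%:E.
Proof.
move=> x0; rewrite in_serviceE integral_indic// setIC.
have max0 : Num.max 0%R x.1 = x.1 by rewrite /Num.max; case: ltP => // ?; apply/eqP; rewrite eq_le x0.
rewrite /presence max0; have [xt|tx] := ltP (x.1 + x.2)%R t.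
  rewrite (_ : _ `&` _ = `]x.1, (x.1 + x.2)%R[%classic); last first.
    apply/seteqP; split => [s []//|s sx]; split => //.
    by move: sx; rewrite /= !in_itv/= => /andP[/ltW/(le_trans x0)-> /lt_trans-/(_ _ xt)/ltW].
  rewrite [LHS](lebesgue_measure_itv `]x.1, (x.1 + x.2)%R[)/= lte_fin; case: ltP => h; rewrite -?EFinB; congr EFin;
    rewrite /Num.max; case: ltP => h'; lra.
rewrite (_ : _ `&` _ = if (t < x.1 + x.2)%R then `]x.1, t]%classic else `]x.1, t[%classic); last first.
  apply/seteqP; split => s.
    rewrite /= !in_itv/= => -[/andP[s1 s2] /andP[s3 s4]].
    case: ifPn => h; rewrite /= in_itv/= s3/= ?s2//.
    by apply: lt_le_trans s4 _; rewrite leNgt.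
  case: ifPn => h; rewrite /= !in_itv/= => /andP[s1 s2].
    by rewrite (le_trans x0 (ltW s1)) s2 s1 (le_lt_trans s2 h).
  by rewrite (le_trans x0 (ltW s1)) (ltW s2) s1 (lt_le_trans s2 tx).
transitivity (if (x.1 < t)%R then (t - x.1)%:E else 0); last first.
  case: ltP => h; congr EFin; rewrite /Num.max; case: ltP => h'; lra.
by case: ifP => _; [rewrite [LHS](lebesgue_measure_itv `]x.1, t])|
  rewrite [LHS](lebesgue_measure_itv `]x.1, t[)]; rewrite /= lte_fin; case: ifP.
Qed.

Context d (Om : measurableType d) (G : nat -> Om -> \bar R) (L : nat -> Om -> R).
Variables (T : R) (w : Om).
Hypothesis simpleG : simple_arrivals T (G ^~ w).

Let a k := (G k w \is a fin_num) && (G k w <= T%:E).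
Let x k := (fine (G k w), L k w).

(* Only the finitely many arrivals before [T] can be in the system at a time
   before [T]. *)
Let queue_finite : exists N, (forall k, a k -> (k < N)%N) /\
  forall t, (t <= T)%R ->
    queue G L t w = (\sum_(k < N | a k) in_service (x k) t)%:E.
Proof.
have [_ [N hN] _] := simpleG.
have aN k : a k -> (k < N)%N.
  move=> /andP[kfin kT]; apply: (hN k (fine (G k w))); first by rewrite fineK.
  by rewrite -lee_fin fineK.
exists N; split => // t tT.
have term k : ((G k w < t%:E < G k w + (L k w)%:E)%E%:R)%:E =
    if a k then (in_service (x k) t)%:E else 0 :> \bar R.
  rewrite /a /in_service /x/=; case: (G k w) => [s| |]//=.
    rewrite lee_fin -EFinD !lte_fin.
    by case: (leP s T) => // Ts; rewrite (_ : (s < t)%R = false)//; lra.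
  by rewrite addNye [X in _ && X]ltNge leNye andbF.
rewrite /queue (nneseries_split _ N)//.
rewrite eseries0 ?adde0; last first.
  move=> k Nk _; have -> := term k; case: ifPn => // /aN.
  by rewrite ltnNge Nk.
rewrite add0n big_mkord -sumEFin [RHS]big_mkcond/=.
by apply: eq_bigr => k _; exact: term.
Qed.

Lemma measurable_queue : measurable_fun `[0%R, T]%classic (fun t => queue G L t w).
Proof.
have [N [_ hN]] := queue_finite.
apply: (eq_measurable_fun (fun t => (\sum_(k < N | a k) in_service (x k) t)%:E)).
  by move=> t; rewrite inE/= in_itv/= => /andP[_ /hN].
apply/measurable_EFinP; apply: measurable_funTS.
under eq_fun do rewrite big_mkcond.
apply: measurable_sum => k; case: (a k); [exact: measurable_in_service|exact: measurable_cst].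
Qed.

Lemma queue_bounded : exists K : R,
  forall t, (0 <= t <= T)%R -> 0 <= queue G L t w <= K%:E.
Proof.
have [N [_ hN]] := queue_finite; exists N%:R => t /andP[_ /hN->].
rewrite !lee_fin sumr_ge0//=; apply: le_trans (_ : \sum_(k < N | a k) 1 <= _)%R.
  by apply: ler_sum => k _; rewrite /in_service; case: (_ && _).
by rewrite sumr_const ler_nat -[leqRHS]card_ord; exact: max_card.
Qed.

(** The integral of the queue length adds up the times spent in the system by
    the jobs. *)
Lemma integral_queue t : (0 <= t <= T)%R ->
  \int[mu]_(s in `[0%R, t]) queue G L s w = (cumulated T t (points G L T w))%:E.
Proof.
move=> /andP[t0 tT]; have [N [aN hN]] := queue_finite.
have [nonneg _ dist] := simpleG.
have aE k : a k -> G k w = (x k).1%:E by move=> /andP[kfin _]; rewrite /= fineK.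
have aT k : a k -> (0 <= (x k).1 <= T)%R.
  move=> ak; rewrite (nonneg k)//=; last exact: aE.
  by case/andP: ak => kfin; rewrite -{1}(fineK kfin).
rewrite (cumulated_finite (N := N) (a := a) (x := x))//; last 3 first.
- by move=> k _; exact: aT.
- move=> k l _ _ ak al kl; apply: (dist k l (x k).1); first exact: aE.
    by rewrite kl aE.
  by case/andP: (aT k ak).
- apply/seteqP; split => [[s y] [[/=sT _] [k [Gk Lk]]]|_ [k /andP[kN ak] <-]].
    have ak : a k.
      by rewrite /a Gk/= lee_fin; move: sT; rewrite in_itv/= => /andP[].
    by exists k; rewrite /= ?aN// /x Gk/= Lk.
  split; first by split=> //=; rewrite in_itv/= aT.
  by exists k; split=> //; exact: aE.
transitivity (\int[mu]_(s in `[0%R, t]) \sum_(k < N | a k) (in_service (x k) s)%:E).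
  apply: eq_integral => s; rewrite inE/= in_itv/= => /andP[_ st].
  by rewrite hN ?(le_trans st)// sumEFin.
under eq_integral do rewrite big_mkcond.
rewrite ge0_integral_sum//=; last 2 first.
- move=> k; case: (a k); last exact: measurable_cst.
  by apply/measurable_EFinP/measurable_funTS; exact: measurable_in_service.
- by move=> k s _; case: (a k) => //; rewrite lee_fin /in_service.
rewrite -sumEFin [RHS]big_mkcond; apply: eq_bigr => k _.
case: ifP => ak; last by rewrite integral0.
by apply: integral_presence; case/andP: (aT k ak).
Qed.

End queue_of_points.

(** * The reflected storage equation *)

Section clamp.
Context (R : realType).

Definition clamp (T t : R) : R := Num.max 0 (Num.min t T).

Let clampE T t : clamp T t = if T <= t then Num.max 0 T else Num.max 0 t.
Proof. by rewrite /clamp; have [tT|Tt] := leP T t; rewrite ?min_r ?min_l// ltW. Qed.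

Lemma clamp_itv T t : 0 <= T -> 0 <= clamp T t <= T.
Proof.
move=> T0; rewrite clampE; apply/andP.
by case: (leP T t) => ?; rewrite /Num.max; case: ltP => ?; split; lra.
Qed.

Lemma clamp_id T t : 0 <= t <= T -> clamp T t = t.
Proof.
move=> /andP[t0 tT].
by rewrite clampE; case: (leP T t) => ?; rewrite /Num.max; case: ltP => ?; lra.
Qed.

Lemma clamp_le T s t : s <= t -> clamp T s <= clamp T t.
Proof.
move=> st; rewrite !clampE.
by case: (leP T s) => ?; case: (leP T t) => ?; rewrite /Num.max; repeat case: ltP => ?; lra.
Qed.

Lemma clamp_dist T s t : `|clamp T s - clamp T t| <= `|s - t|.
Proof.
wlog st : s t / s <= t.
  by move=> h; have [/h//|/ltW/h] := leP s t; rewrite distrC [leRHS]distrC.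
rewrite [leRHS]distrC [leRHS]ger0_norm ?subr_ge0// distrC ger0_norm ?subr_ge0 ?clamp_le//.
rewrite !clampE.
by case: (leP T s) => ?; case: (leP T t) => ?; rewrite /Num.max; repeat case: ltP => ?; lra.
Qed.

Lemma lipschitz_cont (f : R -> R) (m : R) :
  (forall s t, `|f s - f t| <= m * `|s - t|) -> continuous f.
Proof.
move=> fm x; apply/(@cvgrPdist_le _ R^o) => e e0; near=> t.
apply: le_trans (fm _ _) _.
have m1 : 0 < `|m| + 1 by rewrite ltr_wpDl.
apply: (@le_trans _ _ ((`|m| + 1) * `|x - t|)).
  by rewrite ler_wpM2r// (le_trans (ler_norm _))// lerDl.
rewrite -ler_pdivlMl// mulrC; near: t.
by apply: cvgr_dist_le; [exact: cvg_id|rewrite divr_gt0].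
Unshelve. all: by end_near. Qed.

End clamp.

Section reflection.
Context (R : realType).

(** The smallest nondecreasing function that keeps [y] plus it nonnegative.
    The supremum over [[0, t]] is rescaled to a fixed index set, which gives its
    regularity in [t] and lets a fixed countable set of indices compute it. *)
Definition regulator (y : R -> R) (t : R) : R :=
  sup ((fun q => - y (t * q)) @` `[0, 1]).

Definition reflect_path (T : R) (y : R -> R) (t : R) : R :=
  y (clamp T t) + regulator y (clamp T t).

Variables (m : R) (y : R -> R).
Hypothesis m0 : 0 <= m.
Hypothesis y_lip : forall s t : R, 0 <= s -> 0 <= t -> `|y s - y t| <= m * `|s - t|.
Hypothesis y00 : y 0 = 0.

Let unit_itv0 : (`[0, 1]%classic : set R) !=set0.
Proof. by exists 0; rewrite /= in_itv/= lexx ler01. Qed.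

Lemma regulator_ub t : 0 <= t -> has_ubound ((fun q => - y (t * q)) @` `[0, 1]).
Proof.
move=> t0; exists (m * t) => _ [q /= + <-]; rewrite in_itv/= => /andP[q0 q1].
have := y_lip (mulr_ge0 t0 q0) (lexx 0).
rewrite y00 !subr0 => h; apply: le_trans (ler_norm _) _; rewrite normrN.
apply: le_trans h _; rewrite ler_wpM2l// ger0_norm ?mulr_ge0//.
by rewrite -[leRHS]mulr1 ler_wpM2l.
Qed.

Lemma le_regulator s t : 0 <= s <= t -> - y s <= regulator y t.
Proof.
move=> /andP[s0 st]; apply: ub_le_sup; first exact/regulator_ub/(le_trans s0).
have [t0|t0] := eqVneq t 0.
  exists 0; first by rewrite /= in_itv/= lexx ler01.
  by rewrite mulr0; congr (- y _); apply/eqP; rewrite eq_le s0 -t0 st.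
have tgt0 : 0 < t by rewrite lt_neqAle eq_sym t0 (le_trans s0).
exists (s / t); last by rewrite mulrCA divff// mulr1.
by rewrite /= in_itv/= divr_ge0 ?ler_pdivrMr ?mul1r// ltW.
Qed.

Lemma regulator_le t b : 0 <= t -> (forall s, 0 <= s <= t -> - y s <= b) ->
  regulator y t <= b.
Proof.
move=> t0 h; apply: ge_sup => [|_ [q /= + <-]]; first exact: image_nonempty.
rewrite in_itv/= => /andP[q0 q1]; apply: h.
by rewrite mulr_ge0//= -[leRHS]mulr1 ler_wpM2l.
Qed.

Lemma regulator_mono s t : 0 <= s <= t -> regulator y s <= regulator y t.
Proof.
move=> /andP[s0 st]; apply: regulator_le => // u /andP[u0 us].
by apply: le_regulator; rewrite u0 (le_trans us).
Qed.

Lemma regulator0 : regulator y 0 = 0.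
Proof.
apply/eqP; rewrite eq_le; apply/andP; split.
  apply: regulator_le => // s; rewrite -eq_le => /eqP <-.
  by rewrite y00 oppr0.
by have := @le_regulator 0 0; rewrite y00 oppr0; apply; rewrite lexx.
Qed.

Lemma regulator_dist s t : 0 <= s -> 0 <= t ->
  `|regulator y s - regulator y t| <= m * `|s - t|.
Proof.
move=> s0 t0; apply: sup_dist_le => //; [exact: regulator_ub|exact: regulator_ub|].
move=> q /=; rewrite in_itv/= => /andP[q0 q1].
rewrite opprK addrC distrC; apply: le_trans (y_lip _ _) _; rewrite ?mulr_ge0//.
rewrite ler_wpM2l// -mulrBl normrM -[leRHS]mulr1 ler_wpM2l//.
by rewrite ger0_norm.
Qed.

(** Where the reflected path is away from 0, the regulator does not increase:
    it increases only when [- y] reaches a new maximum. *)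
Lemma regulator_flat a b eta : 0 <= a <= b -> 0 < eta ->
  (forall s, a <= s <= b -> eta <= y s + regulator y s) ->
  regulator y b = regulator y a.
Proof.
move=> ab eta0 h; apply/eqP; rewrite eq_le (regulator_mono ab) andbT leNgt.
apply/negP => lab; have /andP[a0 ab'] := ab.
have b0 : 0 <= b by exact: le_trans ab'.
have : Num.max (regulator y a) (regulator y b - eta) < regulator y b.
  by rewrite gt_max lab ltrBlDr ltrDl.
move=> /sup_gt[|_ [q /= + <-]]; first exact: image_nonempty.
rewrite in_itv/= => /andP[q0 q1]; rewrite gt_max => /andP[h1 h2].
have bq0 : 0 <= b * q by rewrite mulr_ge0.
have bqb : b * q <= b by rewrite -[leRHS]mulr1 ler_wpM2l.
have aq : a <= b * q.
  rewrite leNgt; apply/negP => qa; move: h1; rewrite ltNge le_regulator//.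
  by rewrite bq0 ltW.
have := h (b * q); rewrite aq bqb => /(_ isT).
have : regulator y (b * q) <= regulator y b by rewrite regulator_mono// bq0.
lra.
Qed.

Variable T : R.
Hypothesis T0 : 0 <= T.

Lemma reflect_path_ge0 t : 0 <= reflect_path T y t.
Proof.
have /andP[c0 _] := clamp_itv t T0.
by rewrite /reflect_path addrC -lerBlDr sub0r le_regulator// c0 lexx.
Qed.

Lemma reflect_path_dist s t :
  `|reflect_path T y s - reflect_path T y t| <= (m + m) * `|s - t|.
Proof.
have /andP[s0 _] := clamp_itv s T0; have /andP[t0 _] := clamp_itv t T0.
rewrite /reflect_path.
rewrite (_ : y _ + _ - _ = (y (clamp T s) - y (clamp T t)) +
  (regulator y (clamp T s) - regulator y (clamp T t))); last by ring.
apply: le_trans (ler_normD _ _) _; rewrite mulrDl lerD//.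
  by apply: le_trans (y_lip _ _) _ => //; rewrite ler_wpM2l// clamp_dist.
by apply: le_trans (regulator_dist _ _) _ => //; rewrite ler_wpM2l// clamp_dist.
Qed.

End reflection.

Section storage_equation.
Context (R : realType).

Lemma lebesgue_stieltjes_oc (l : cumulative R R) (a b : R) : a <= b ->
  lebesgue_stieltjes_measure l `]a, b] = (l b - l a)%:E.
Proof.
move=> ab; rewrite /lebesgue_stieltjes_measure /measure_extension/=.
by rewrite measurable_mu_extE/= ?wlength_itv_bnd//; exact: is_ocitv.
Qed.

Variables (T r m : R) (y : R -> R) (n : R -> \bar R).
Hypothesis T0 : 0 <= T.
Hypothesis yE : forall t, 0 <= t <= T ->
  y t = fine (\int[lebesgue_measure]_(s in `[0%R, t]) n s) - r * t.

Section existence.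
Hypothesis m0 : 0 <= m.
Hypothesis y_lip : forall s t : R, 0 <= s -> 0 <= t -> `|y s - y t| <= m * `|s - t|.
Hypothesis y00 : y 0 = 0.

Let X := reflect_path T y.

Let X_clamp t : X (clamp T t) = X t.
Proof. by rewrite /X /reflect_path clamp_id// clamp_itv. Qed.

Let X_cont : continuous X.
Proof. exact: lipschitz_cont (reflect_path_dist m0 y_lip y00 T0). Qed.

Let measurable_X_gt0 : measurable [set s | 0 < X s].
Proof.
have /(_ measurableT _ (measurable_itv `]0, +oo[)) := continuous_measurable_fun X_cont.
by rewrite setTI; congr measurable; apply/seteqP; split => s /=; rewrite in_itv/= andbT.
Qed.

(* The open set where the path is positive is covered by countably many
   intervals with rational ends on which the regulator is constant. *)
Let positive_null (l : cumulative R R) : l =1 regulator y \o clamp T ->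
  lebesgue_stieltjes_measure l [set s | 0 < X s] = 0%E.
Proof.
move=> lE; pose B k : set R := if unpickle k is Some (p, q) then
  if (ratr p <= ratr q :> R) && (l (ratr p) == l (ratr q)) then `]ratr p, ratr q]%classic
  else set0 else set0.
apply: (@measure_negligible _ (measurableTypeR R) R (lebesgue_stieltjes_measure l)) => //.
apply: (@negligibleS _ (measurableTypeR R) R (lebesgue_stieltjes_measure l) (\bigcup_k B k)); last first.
  apply: negligible_bigcup => k; rewrite /B.
  case: unpickle => [[p q]|]; last exact: negligible_set0.
  case: ifPn => [/andP[pq /eqP lpq]|_]; last exact: negligible_set0.
  exists `]ratr p, ratr q]%classic; split => //.
  by have := lebesgue_stieltjes_oc l pq; rewrite lpq subrr.
move=> s /= Xs; pose d := X s / (2 * (m + m + 1)).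
have M0 : 0 < m + m + 1 by rewrite ltr_wpDl// addr_ge0.
have d0 : 0 < d by rewrite divr_gt0// mulr_gt0.
have near_s u : `|clamp T s - u| <= d -> X (clamp T s) / 2 <= X u.
  rewrite X_clamp => su; have := reflect_path_dist m0 y_lip y00 T0 (clamp T s) u.
  rewrite -/X X_clamp => h.
  have : `|X s - X u| <= X s / 2.
    apply: le_trans h _; apply: (@le_trans _ _ ((m + m + 1) * d)).
      by rewrite ler_pM// ?addr_ge0// lerDl.
    by rewrite (_ : _ * d = X s / 2)// /d; field; rewrite gt_eqF.
  rewrite ler_norml => /andP[_]; lra.
have [p] : exists p : rat, ratr p \in `]s - d, s[.
  by apply: rat_in_itvoo; rewrite ltrBlDr ltrDl.
rewrite in_itv/= => /andP[p1 p2].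
have [q] : exists q : rat, ratr q \in `]s, s + d[.
  by apply: rat_in_itvoo; rewrite ltrDl.
rewrite in_itv/= => /andP[q1 q2].
have [k kE] : exists k, unpickle k = Some (p, q).
  by exists (pickle (p, q)); exact: pickleK.
exists k => //; rewrite /B kE.
have pq : ratr p <= ratr q :> R by rewrite ltW// (lt_trans p2).
suff -> : l (ratr p) = l (ratr q) by rewrite pq eqxx/= in_itv/= p2 ltW.
rewrite !lE/=; apply/esym; apply: (regulator_flat m0 y_lip y00 (eta := X s / 2)).
- by have /andP[-> _] := clamp_itv (ratr p) T0; rewrite clamp_le.
- by rewrite divr_gt0.
- move=> u /andP[pu uq].
  have u0T : 0 <= u <= T.
    have /andP[p0 _] := clamp_itv (ratr p) T0; have /andP[_ qT] := clamp_itv (ratr q) T0.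
    by rewrite (le_trans p0)// (le_trans uq).
  have -> : y u + regulator y u = X u by rewrite /X /reflect_path clamp_id.
  rewrite -(X_clamp s); apply: near_s.
  have cps : clamp T (ratr p) <= clamp T s by rewrite clamp_le// ltW.
  have csq : clamp T s <= clamp T (ratr q) by rewrite clamp_le// ltW.
  have dp : clamp T s - clamp T (ratr p) <= s - ratr p.
    apply: le_trans (ler_norm _) _; apply: le_trans (clamp_dist _ _ _) _.
    by rewrite ger0_norm// subr_ge0 ltW.
  have dq : clamp T (ratr q) - clamp T s <= ratr q - s.
    apply: le_trans (ler_norm _) _; apply: le_trans (clamp_dist _ _ _) _.
    by rewrite ger0_norm// subr_ge0 ltW.
  by apply/ler_normlP; split; lra.
Qed.

Lemma reflect_path_solves :
  measurable_fun `[0, T] n ->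
  (exists K : R, forall t, 0 <= t <= T -> (0 <= n t <= K%:E)%E) ->
  solves_storage T r n X.
Proof.
move=> mn nK; split => //; first exact: continuous_subspaceT.
pose l := regulator y \o clamp T.
have l_dist s t : `|l s - l t| <= m * `|s - t|.
  have /andP[s0 _] := clamp_itv s T0; have /andP[t0 _] := clamp_itv t T0.
  by apply: le_trans (regulator_dist m0 y_lip y00 s0 t0) _; rewrite ler_wpM2l// clamp_dist.
have l_cont : continuous l by exact: lipschitz_cont l_dist.
have l_nd : nondecreasing l.
  move=> s t st; apply: (regulator_mono m0 y_lip y00).
  by have /andP[-> _] := clamp_itv s T0; rewrite clamp_le.
have l_rc : right_continuous l by exact: right_continuousW.
pose lc : cumulative R R := HB.pack l (isCumulative.Build R _ R l l_nd l_rc).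
exists lc; split => //=.
- by rewrite /l/= clamp_id ?lexx// (regulator0 m0 y_lip y00).
- move=> t tT; rewrite /X /l /reflect_path/= clamp_id// yE//.
  split => //; rewrite -yE//; have := reflect_path_ge0 m0 y_lip y00 T0 t.
  by rewrite /reflect_path clamp_id.
- rewrite integral_indic//=.
  apply/eqP; rewrite eq_le measure_ge0 andbT.
  rewrite -(positive_null (l := lc))//; apply: le_measure; rewrite ?inE//.
  exact: measurableI.
Qed.

End existence.

(** Two regulators cannot differ: at the last time where the given one is not
    above the smallest one the path would be positive afterwards, and the given
    one would then stay constant. *)
Lemma storage_unique (x : R -> R) : solves_storage T r n x ->
  forall t, 0 <= t <= T -> x t = reflect_path T y t.
Proof.
move=> [mn _ x_cont [l [l_cont l0 xE l_null]]].
have {}xE t : 0 <= t <= T -> x t = y t + l t /\ 0 <= x t.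
  by move=> tT; rewrite yE//; exact: xE.
have l_nd := cumulative_is_nondecreasing l.
have ler_l s t : 0 <= s <= t -> t <= T -> - y s <= l t.
  move=> /andP[s0 st] tT; apply: le_trans (l_nd _ _ st).
  by have [|-> ] := xE s; [rewrite s0 (le_trans st)|rewrite addrC -lerBlDr sub0r].
have reg_ub t : 0 <= t <= T -> has_ubound ((fun q => - y (t * q)) @` `[0, 1]).
  move=> /andP[t0 tT]; exists (l t) => _ [q /= + <-]; rewrite in_itv/= => /andP[q0 q1].
  by apply: ler_l => //; rewrite mulr_ge0//= -[leRHS]mulr1 ler_wpM2l.
have reg_le t : 0 <= t <= T -> regulator y t <= l t.
  by move=> /andP[t0 tT]; apply: regulator_le => // s st; exact: ler_l.
have le_reg s t : 0 <= s <= t -> t <= T -> - y s <= regulator y t.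
  move=> /andP[s0 st] tT; apply: ub_le_sup.
    by apply: reg_ub; rewrite (le_trans s0).
  have [t0|t0] := eqVneq t 0.
    exists 0; first by rewrite /= in_itv/= lexx ler01.
    by rewrite mulr0; congr (- y _); apply/eqP; rewrite eq_le s0 -t0 st.
  have tgt0 : 0 < t by rewrite lt_neqAle eq_sym t0 (le_trans s0).
  exists (s / t); last by rewrite mulrCA divff// mulr1.
  by rewrite /= in_itv/= divr_ge0 ?ler_pdivrMr ?mul1r// ltW.
have reg_mono s t : 0 <= s <= t -> t <= T -> regulator y s <= regulator y t.
  move=> /andP[s0 st] tT; apply: regulator_le => // u /andP[u0 us].
  by apply: le_reg => //; rewrite u0 (le_trans us).
have y0 : y 0 = 0.
  by rewrite yE ?lexx// set_itv1 integral_set1 mulr0 subr0.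
move=> t /[dup] t0T /andP[t0 tT]; rewrite /reflect_path clamp_id// (xE t t0T).1.
congr (_ + _); apply/eqP; rewrite eq_le reg_le// andbT leNgt; apply/negP => lt_l.
pose E := [set s | 0 <= s <= t /\ l s <= regulator y s].
have E0 : E 0.
  split; first by rewrite lexx.
  by rewrite l0; have := @le_reg 0 0; rewrite y0 oppr0; apply; rewrite ?lexx.
have Esup : has_sup E by split; [exists 0|exists t => s [/andP[]]].
pose u := sup E.
have u0 : 0 <= u by exact: sup_upper_bound.
have ut : u <= t by apply: ge_sup => [|s [/andP[]]//]; exists 0.
have uT : u <= T by exact: le_trans tT.
(* [l] is left continuous and the regulator nondecreasing, so the inequality
   passes to the supremum of [E]. *)
have Eu : l u <= regulator y u.
  apply/ler_addgt0Pr => e e0.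
  have /(@cvgrPdist_le _ R^o) /(_ _ e0) [d /= d0 hd] := l_cont u.
  have [s [/andP[s0 st] Es] us] := sup_adherent d0 Esup.
  have su : s <= u by apply: sup_upper_bound => //; split; rewrite ?s0.
  have := hd s; rewrite /ball/= ger0_norm ?subr_ge0// => /(_ _).
  rewrite ltrBlDr addrC -ltrBlDr us => /(_ isT); rewrite ger0_norm ?subr_ge0 ?l_nd//.
  have : regulator y s <= regulator y u by rewrite reg_mono ?s0.
  lra.
have x_gt0 s : u < s <= t -> 0 < x s.
  move=> /andP[us st]; have sT := le_trans st tT.
  have s0 : 0 <= s by rewrite (le_trans u0)// ltW.
  rewrite (xE s _).1 ?s0//.
  have : - y s <= regulator y s by rewrite le_reg ?s0 ?lexx.
  suff : regulator y s < l s by lra.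
  rewrite ltNge; apply/negP => ls; move: us; rewrite ltNge => /negP; apply.
  by apply: sup_upper_bound => //; split; rewrite ?s0.
have : (lebesgue_stieltjes_measure l `]u, t] <= 0)%E.
  rewrite -l_null.
  have <- : (\int[lebesgue_stieltjes_measure l]_(s in `]u, t])
      (\1_[set s | (0 < x s)%R] s)%:E = lebesgue_stieltjes_measure l `]u, t])%E.
    rewrite -[RHS]mul1e -integral_cst//; apply: eq_integral => s.
    by rewrite inE/= in_itv/= => /x_gt0 xs; rewrite indicE mem_set.
  apply: ge0_subset_integral => //.
  - apply/measurable_EFinP.
    have mx : measurable_fun `[0, T] x by exact: subspace_continuous_measurable_fun.
    rewrite (_ : \1_ _ = \1_(`]0%R, +oo[%classic : set R) \o x); last first.
      by apply/funext => s; rewrite /= !indicE !mem_setE in_itv/= andbT.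
    by apply: measurableT_comp => //; exact: measurable_indic.
  - by move=> s /=; rewrite !in_itv/= => /andP[/ltW/(le_trans u0)-> /le_trans->].
rewrite lebesgue_stieltjes_oc// lee_fin subr_le0.
have : regulator y u <= regulator y t by rewrite reg_mono// u0.
lra.
Qed.

End storage_equation.

(** * Random elements of the path space *)

Section measurable_reflection.
Context d (S : measurableType d) (R : realType).

Let unit_rat (k : nat) : R :=
  clamp 1 (ratr (if unpickle k is Some q then q else 0 : rat)).

Let unit_rat_dense (q e : R) : 0 <= q <= 1 -> 0 < e ->
  exists k, `|q - unit_rat k| <= e.
Proof.
move=> q01 e0.
have [p] : exists p : rat, ratr p \in `]q, q + e[ by apply: rat_in_itvoo; rewrite ltrDl.
rewrite in_itv/= => /andP[qp pqe].
have [k kE] : exists k, unpickle k = Some p by exists (pickle p); exact: pickleK.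
exists k; rewrite /unit_rat kE -[q in leLHS](clamp_id q01).
by apply: le_trans (clamp_dist _ _ _) _; apply/ler_normlP; split; lra.
Qed.

(** By continuity of the paths, the supremum is one over rational indices. *)
Lemma measurable_regulator (y : S -> R -> R) t : 0 <= t ->
  (forall s, 0 <= s -> measurable_fun setT (y ^~ s)) ->
  (forall w, y w 0 = 0) ->
  (forall w, exists m : R, 0 <= m /\
     forall s u : R, 0 <= s -> 0 <= u -> `|y w s - y w u| <= m * `|s - u|) ->
  measurable_fun setT (fun w => regulator (y w) t).
Proof.
move=> t0 my y0 ylip.
have u01 k : 0 <= unit_rat k <= 1 by exact: clamp_itv.
have tu0 k : 0 <= t * unit_rat k by rewrite mulr_ge0//; case/andP: (u01 k).
have sub w : range (fun k => - y w (t * unit_rat k)) `<=`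
    (fun q => - y w (t * q)) @` `[0, 1].
  by move=> _ [k _ <-]; exists (unit_rat k); rewrite /= ?in_itv/= ?u01.
have ub w : has_ubound ((fun q => - y w (t * q)) @` `[0, 1]).
  by have [m [m0 ym]] := ylip w; exact: (regulator_ub m0 ym (y0 w)).
have ub' w : has_ubound (range (fun k => - y w (t * unit_rat k))).
  exact: subset_has_ubound (sub w) (ub w).
have -> : (fun w => regulator (y w) t) =
    fun w => sup (range (fun k => - y w (t * unit_rat k))).
  apply/funext => w; apply/eqP; rewrite eq_le; apply/andP; split; last first.
    apply: sup_le; [|by exists (- y w (t * unit_rat 0%N)), 0%N|].
      by move=> x /sub xs; exists x; split.
    by split => //; exists (- y w (t * 0)); exists 0 => //=; rewrite in_itv/= lexx ler01.
  apply: ge_sup => [|_ [q /= + <-]].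
    by exists (- y w (t * 0)); exists 0 => //=; rewrite in_itv/= lexx ler01.
  rewrite in_itv/= => q01; apply/ler_addgt0Pr => e e0.
  have [m [m0 ym]] := ylip w.
  have M0 : 0 < m * t + 1 by rewrite ltr_wpDl// mulr_ge0.
  have [k qk] := unit_rat_dense q01 (divr_gt0 e0 M0).
  have tq0 : 0 <= t * q by rewrite mulr_ge0//; case/andP: q01.
  have h : `|y w (t * q) - y w (t * unit_rat k)| <= e.
    apply: le_trans (ym _ _ tq0 (tu0 k)) _.
    rewrite -mulrBr normrM (ger0_norm t0) mulrA.
    apply: (@le_trans _ _ ((m * t + 1) * (e / (m * t + 1)))).
      by rewrite ler_pM// ?mulr_ge0// lerDl.
    by rewrite mulrCA divff ?mulr1// gt_eqF.
  have : - y w (t * unit_rat k) <= sup (range (fun k => - y w (t * unit_rat k))).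
    by apply: ub_le_sup => //; exists k.
  move: h => /ler_normlP[]; lra.
apply: measurable_sup_range => [w _|k]; first exact: ub'.
by apply: measurableT_comp => //; exact: my.
Qed.

End measurable_reflection.

Section path_space_topology.
Context (R : realType) (T : R).
Hypothesis T0 : 0 <= T.

Lemma open_path_space (U : set (path_space T)) (x : path_space T) : open U -> U x ->
  exists2 e, 0 < e & forall y : path_space T,
    (forall t, 0 <= t <= T -> `|x t - y t| < e) -> U y.
Proof.
move=> oU Ux; have /uniform_nbhs[E [entE EU]] : nbhs x U by exact: open_nbhs_nbhs.
move: entE; rewrite -entourage_from_ballE => -[e /= e0 eE].
exists e => // y xy; apply: EU => t; rewrite /= in_itv/= => tT.
by apply: eE; rewrite /ball/=; exact: xy.
Qed.

Context d (S : measurableType d) (X : S -> path_space T).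

Lemma measurable_comp_random_element (f : path_space T -> R) :
  random_element_CT X -> {within @CT _ T, continuous f} ->
  measurable_fun setT (f \o X).
Proof.
move=> [XC mX] fc; have /continuousP fo := fc.
move=> mD; apply: (measurability _ (RGenOpens.measurableE R)) => //.
move=> _ [_ [a [b ->] <-]]; rewrite setTI.
have oab : open (`]a, b[%classic : set R) by exact: interval_open.
have /open_subspaceP[W oW WE] := fo _ oab.
rewrite (_ : _ @^-1` _ = X @^-1` W); first exact: mX.
have WfE w : W (X w) <-> `]a, b[%classic (f (X w)).
  have XCw := XC w; split=> h.
    by have [] : (f @^-1` `]a, b[ `&` @CT _ T) (X w) by rewrite -WE.
  by have [] : (W `&` @CT _ T) (X w) by rewrite WE.
by apply/seteqP; split => w /= /WfE.
Qed.

(** Paths that agree on [[0, T]] lie in the same open sets. *)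
Lemma functional_eq (f : path_space T -> R) (x y : path_space T) :
  {within @CT _ T, continuous f} -> CT x -> CT y ->
  (forall t, 0 <= t <= T -> x t = y t) -> f x = f y.
Proof.
move=> fc Cx Cy xy; have /subspace_continuousP/(_ _ Cx) fx := fc.
apply/eqP; rewrite -subr_eq0 -normr_le0; apply/ler_addgt0Pr => e e0; rewrite add0r.
have /(@cvgrPdist_le _ R^o)/(_ _ e0) := fx.
rewrite /prop_near1 /within/= => /uniform_nbhs[E [entE EU]].
apply: EU => // t; rewrite /= in_itv/= => /xy ->; exact: entourage_refl.
Qed.

Hypothesis XC : forall w, CT (X w).
Hypothesis X_lip : forall w, exists m : R, 0 <= m /\
  forall s t, 0 <= s <= T -> 0 <= t <= T -> `|X w s - X w t| <= m * `|s - t|.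
Hypothesis mX : forall t, 0 <= t <= T -> measurable_fun setT (fun w => X w t).

Let grid n i : R := i%:R / n.+1%:R.

Let step_path n (c : {ffun 'I_(cells T n) -> int}) : path_space T :=
  fun t => (c (inord (Num.truncn (t * n.+1%:R))))%:~R / n.+1%:R.

Let code n w : {ffun 'I_(cells T n) -> int} :=
  [ffun i : 'I_(cells T n) => Num.floor (n.+1%:R * X w (grid n i))].

Let grid_itv n (i : 'I_(cells T n)) : 0 <= grid n i <= T.
Proof.
rewrite /grid divr_ge0//= ler_pdivrMr//.
apply: (@le_trans _ _ (Num.truncn (T * n.+1%:R))%:R); last by rewrite truncn_le mulr_ge0.
by rewrite ler_nat -ltnS.
Qed.

(* There are countably many codes, so every set of step paths, however wild, has
   a measurable preimage. *)
Let measurable_code n (V : set (path_space T)) :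
  measurable [set w | V (step_path (code n w))].
Proof.
pose E (c : {ffun 'I_(cells T n) -> int}) := [set w | code n w = c].
have mE c : measurable (E c).
  rewrite (_ : E c = \bigcap_(i in [set: 'I_(cells T n)])
      (fun w => X w (grid n i)) @^-1` `[(c i)%:~R / n.+1%:R, (c i + 1)%:~R / n.+1%:R[).
    apply: fin_bigcap_measurable => // i _.
    by rewrite -[X in measurable X]setTI; exact: (mX (grid_itv i)).
  apply/seteqP; split => w.
    move=> cE i _; rewrite /= in_itv/= ler_pdivrMr// ltr_pdivlMr// mulrC.
    by have /ffunP/(_ i) := cE; rewrite ffunE => <-; exact: floor_itv.
  move=> h; apply/ffunP => i; rewrite ffunE; apply: floor_def.
  by have := h i I; rewrite /= in_itv/= ler_pdivrMr// ltr_pdivlMr// mulrC.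
rewrite (_ : [set w | _] = \bigcup_k (if unpickle k is Some c then
    if `[< V (step_path c) >] then E c else set0 else set0)).
  apply: bigcupT_measurable => k; case: unpickle => // c; case: ifP => // _.
apply/seteqP; split => w /=.
  move=> Vw; have [k kE] : exists k, unpickle k = Some (code n w).
    by exists (pickle (code n w)); exact: pickleK.
  by exists k => //; rewrite kE; case: asboolP.
by move=> [k _]; case: unpickle => // c; case: asboolP => // Vc; rewrite /E/= => ->.
Qed.

Let code_cvg w (e : R) : 0 < e ->
  exists N, forall n, (N <= n)%N -> forall t, 0 <= t <= T ->
    `|X w t - step_path (code n w) t| < e.
Proof.
move=> e0; have [m [m0 Xm]] := X_lip w.
exists (Num.truncn ((m + 1) / e)) => n Nn t tT; have /andP[t0 t1] := tT.
have tn0 : 0 <= t * n.+1%:R by rewrite mulr_ge0.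
have iJ : (Num.truncn (t * n.+1%:R) < cells T n)%N.
  by rewrite ltnS; apply: le_truncn; rewrite ler_pM2r.
rewrite /step_path ffunE inordK//.
set v := X w (grid n _).
have := @grid_itv n (Ordinal iJ); rewrite /= => gT.
have h1 : `|X w t - v| <= m / n.+1%:R.
  apply: le_trans (Xm _ _ tT gT) _; rewrite ler_wpM2l//.
  have /andP[h2 h3] := truncn_itv tn0.
  rewrite ger0_norm /grid ?subr_ge0 ?ler_pdivrMr// lerBlDl -[X in _ + X]mul1r -mulrDl natr1.
  by rewrite ler_pdivlMr// ltW.
have h2 : `|v - (Num.floor (n.+1%:R * v))%:~R / n.+1%:R| <= n.+1%:R^-1.
  have /andP[f1 f2] := floor_itv (n.+1%:R * v).
  rewrite ger0_norm; last by rewrite subr_ge0 ler_pdivrMr// [v * _]mulrC.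
  rewrite lerBlDl -[X in _ + X]mul1r -mulrDl ler_pdivlMr// [v * _]mulrC.
  by move: f2; rewrite intrD1 => /ltW.
have h3 : (m + 1) / n.+1%:R < e.
  rewrite ltr_pdivrMr// mulrC -ltr_pdivrMr//.
  by apply: lt_le_trans (truncnS_gt _) _; rewrite ler_nat.
apply: le_lt_trans h3; rewrite mulrDl mul1r.
by apply: le_trans (ler_distD v _ _) _; exact: lerD.
Qed.

(** Lipschitz paths are uniform limits of step paths with countably many
    values, so the Borel sets of the uniform topology are generated by the
    evaluations. *)
Lemma random_element_of_coordinates : random_element_CT X.
Proof.
split => // U oU.
pose V (j : nat) : set (path_space T) := [set x | forall y : path_space T,
  (forall t, 0 <= t <= T -> `|x t - y t| < j.+1%:R^-1) -> U y].
rewrite (_ : X @^-1` U = \bigcup_j \bigcup_N \bigcap_n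
    [set w | (N <= n)%N -> V j (step_path (code n w))]).
  apply: bigcupT_measurable => j; apply: bigcupT_measurable => N.
  apply: bigcapT_measurable => n; have [Nn|nN] := leqP N n.
    have := measurable_code n (V j); congr measurable.
    by apply/seteqP; split => w //=; apply.
  rewrite (_ : [set w | _] = setT)//; apply/seteqP; split => // w _ Nn; move: nN; rewrite ltnNge Nn.
apply/seteqP; split => w.
  move=> /= Uw; have [e e0 eU] := open_path_space oU Uw.
  have [N hN] := code_cvg w (divr_gt0 e0 (ltr0Sn _ 1)).
  exists (Num.truncn (2 / e)) => //; exists N => // n _ Nn y hy.
  apply: eU => t tT; apply: le_lt_trans (ler_distD (step_path (code n w) t) _ _) _.
  rewrite [e in _ < e](splitr e) ltrD//; first exact: hN.
  apply: lt_trans (hy t tT) _; rewrite invf_plt ?posrE ?divr_gt0// invf_div.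
  exact: truncnS_gt.
move=> [j _ [N _ h]]; have j0 : 0 < j.+1%:R^-1 :> R by rewrite invr_gt0.
have [N' hN'] := code_cvg w j0.
apply: (h (maxn N N') I (leq_maxl _ _)) => t tT.
by rewrite distrC; apply: hN' => //; exact: leq_maxr.
Qed.

End path_space_topology.

(** * The storage path of a point configuration *)

Section storage_path.
Context (R : realType) (T r : R).
Hypothesis T0 : 0 <= T.

Definition storage_path (C : config (R * R)%type) : path_space T :=
  reflect_path T (fun t => cumulated T t C - r * t).

Let net_lip C : exists m : R, 0 <= m /\ forall s t : R, 0 <= s -> 0 <= t ->
  `|(cumulated T s C - r * s) - (cumulated T t C - r * t)| <= m * `|s - t|.
Proof.
have [m [m0 cm]] := cumulated_lipschitz T C.
exists (m + `|r|); split => [|s t s0 t0]; first by rewrite addr_ge0.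
rewrite (_ : _ - _ = (cumulated T s C - cumulated T t C) - r * (s - t)); last by ring.
by apply: le_trans (ler_normB _ _) _; rewrite mulrDl normrM lerD// cm.
Qed.

Let net0 C : cumulated T 0 C - r * 0 = 0.
Proof. by rewrite cumulated0 mulr0 subr0. Qed.

Lemma storage_path_random_element d (S : measurableType d)
    (p : S -> config (R * R)%type) :
  measurable_fun setT p -> random_element_CT (fun w => storage_path (p w)).
Proof.
move=> mp; have mnet s : 0 <= s ->
    measurable_fun setT (fun w => cumulated T s (p w) - r * s).
  move=> s0; apply: measurable_funB => //.
  by apply: (measurableT_comp (measurable_cumulated T s0)).
have lip w : exists m : R, 0 <= m /\ forall s t,
    `|storage_path (p w) s - storage_path (p w) t| <= m * `|s - t|.
  have [m [m0 ym]] := net_lip (p w); exists (m + m); split; first exact: addr_ge0.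
  by move=> s t; exact: (reflect_path_dist m0 ym (net0 _) T0).
apply: (random_element_of_coordinates T0).
- move=> w; have [m [_ hm]] := lip w.
  by apply: continuous_subspaceT; exact: lipschitz_cont hm.
- by move=> w; have [m [m0 hm]] := lip w; exists m; split.
- move=> t tT; have /andP[c0 _] := clamp_itv t T0.
  apply: measurable_funD; first exact: mnet.
  apply: (measurable_regulator (y := fun w s => cumulated T s (p w) - r * s)) => //.
Qed.

Context d (Om : measurableType d) (G : nat -> Om -> \bar R) (L : nat -> Om -> R).
Variable w : Om.
Hypothesis simpleG : simple_arrivals T (G ^~ w).

Let netE t : 0 <= t <= T -> cumulated T t (points G L T w) - r * t =
  fine (\int[lebesgue_measure]_(s in `[0%R, t]) queue G L s w) - r * t.
Proof. by move=> tT; rewrite (@integral_queue _ _ _ _ L _ _ simpleG). Qed.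

Lemma storage_path_solves :
  solves_storage T r (fun t => queue G L t w) (storage_path (points G L T w)).
Proof.
have [m [m0 ym]] := net_lip (points G L T w).
apply: (reflect_path_solves T0 netE m0 ym (net0 _)).
- exact: (measurable_queue L simpleG).
- exact: (queue_bounded L simpleG).
Qed.

Lemma storage_path_unique (x : R -> R) :
  solves_storage T r (fun t => queue G L t w) x ->
  forall t, 0 <= t <= T -> x t = storage_path (points G L T w) t.
Proof. by move=> sx; exact: (storage_unique T0 netE sx). Qed.

End storage_path.

Section law_of_points.
Context d (Om : measurableType d) (R : realType) (P : probability Om R).

Lemma law_exists (p : Om -> config (R * R)%type) : measurable_fun setT p ->
  exists m : {finite_measure set (config (R * R)%type) -> \bar R},
    (forall A, measurable A -> m A = P (p @^-1` A)) /\
    forall H : config (R * R)%type -> R, measurable_fun setT H -> (forall C, 0 <= H C) ->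
      (\int[m]_C (H C)%:E = \int[P]_w (H (p w))%:E)%E.
Proof.
move=> mp; pose X : {mfun Om >-> config (R * R)%type} :=
  HB.pack_for {mfun Om >-> config (R * R)%type} p (isMeasurableFun.Build _ _ _ _ p mp).
exists (distribution P X); split => // H mH H0.
rewrite ge0_integral_pushforward//; last by move=> C _; rewrite lee_fin.
exact/measurable_EFinP.
Qed.

Lemma expectation_bounded_fin_num (Y : Om -> R) (K : R) :
  measurable_fun setT Y -> (forall w, `|Y w| <= K) -> ('E_P[Y])%E \is a fin_num.
Proof.
move=> mY YK; rewrite unlock; apply: integrable_fin_num => //.
have int_c : P.-integrable setT (fun=> K%:E) by exact: finite_measure_integrable_cst.
apply: (le_integrable measurableT _ _ int_c); first exact/measurable_EFinP.
by move=> w _; rewrite lee_fin/=; apply: le_trans (YK w) _; exact: ler_norm.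
Qed.

Variables (T r : R).
Hypothesis T0 : 0 <= T.

(** The constant [K] makes the functional nonnegative, so that its expectation
    is that of a nonnegative function under the law [m] of the points. *)
Lemma expectation_storage_path (X : Om -> path_space T)
    (p : Om -> config (R * R)%type)
    (m : {finite_measure set (config (R * R)%type) -> \bar R})
    (f : path_space T -> R) (K : R) :
  random_element_CT X -> measurable_fun setT p ->
  {ae P, forall w t, 0 <= t <= T -> X w t = storage_path T r (p w) t} ->
  (forall H : config (R * R)%type -> R, measurable_fun setT H -> (forall C, 0 <= H C) ->
      (\int[m]_C (H C)%:E = \int[P]_w (H (p w))%:E)%E) ->
  {within @CT _ T, continuous f} -> (forall x, CT x -> `|f x| <= K) ->
  ('E_P[f \o X] = \int[m]_C (f (storage_path T r C) + K)%:E - K%:E)%E.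
Proof.
move=> XR mp Xp mE fc fK; rewrite unlock.
have FR : random_element_CT (fun C : config (R * R)%type => storage_path T r C).
  by apply: storage_path_random_element => //; exact: measurable_id.
have mfF := measurable_comp_random_element FR fc.
have mfX := measurable_comp_random_element XR fc.
have fF C : - K <= f (storage_path T r C) <= K by rewrite -ler_norml fK//; exact: FR.1.
rewrite (mE (fun C => f (storage_path T r C) + K)); last 2 first.
- by apply: measurable_funD.
- by move=> C; have /andP[] := fF C; lra.
have mfFp : measurable_fun setT (fun w => f (storage_path T r (p w))).
  exact: (measurableT_comp mfF).
transitivity (\int[P]_w (f (storage_path T r (p w)))%:E)%E.
  apply: ae_eq_integral => //; [exact/measurable_EFinP|exact/measurable_EFinP|].
  apply: filterS Xp => w Xw _ /=; congr EFin.
  by apply: functional_eq => //; [exact: XR.1|exact: FR.1].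
have int_c (c : R) : P.-integrable setT (fun=> c%:E).
  exact: finite_measure_integrable_cst.
have intf : P.-integrable setT (fun w => (f (storage_path T r (p w)))%:E).
  apply: (le_integrable measurableT _ _ (int_c K)); first exact/measurable_EFinP.
  move=> w _; rewrite lee_fin/= [leRHS]ger0_norm ?ler_norml//.
  by have := fF (p w) => /andP[]; lra.
under [in RHS]eq_integral do rewrite EFinD.
rewrite integralD//= integral_cst//= probability_setT mule1 addeK//.
Qed.

End law_of_points.

(** * The quenched limit *)

Section intensities.
Local Open Scope ereal_scope.
Context (R : realType) (nu : R.-pker R ~> R).
Local Notation mu := (@lebesgue_measure R).

Lemma arrival_mean_itv (T : R) (lam z : R -> R) D : D `<=` `[0%R, T] ->
  arrival_mean lam z D = \int[mu]_(s in `[0%R, T]) (lam s * z s * \1_D s)%:E.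
Proof.
move=> DT; rewrite /arrival_mean integral_mkcond [RHS]integral_mkcond.
apply: eq_integral => s _; rewrite !patchE indicE.
have [sD|nsD] := boolP (s \in D).
  have sT : s \in `[0%R, T]%classic by rewrite inE; move: sD; rewrite inE => /DT.
  rewrite sT mulr1 mem_set//; split; first by rewrite inE in sD.
  by move: sT; rewrite inE/= !in_itv/= andbT => /andP[].
rewrite mulr0 if_same memNset// => -[]; by rewrite notin_setE in nsD.
Qed.

Lemma arrival_mean_neg (lam z : R -> R) : arrival_mean lam z `]-oo, 0%R[ = 0.
Proof.
rewrite /arrival_mean (_ : _ `&` _ = set0) ?integral_set0//.
by apply/seteqP; split => // s []; rewrite /= !in_itv/= andbT; lra.
Qed.

Lemma limit_mean_box (zbar T : R) (lam : R -> R) B : measurable B ->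
  limit_mean zbar lam nu (B `&` box T) =
  \int[mu]_(s in `[0%R, T]) (zbar * lam s * mark_mass nu B s)%:E.
Proof.
move=> mB; rewrite /limit_mean integral_mkcond [RHS]integral_mkcond.
apply: eq_integral => s _; rewrite !patchE.
have [sT|nsT] := boolP (s \in `[0%R, T]%classic).
  have s0 : s \in `[0%R, +oo[%classic.
    by move: sT; rewrite !inE/= !in_itv/= andbT => /andP[].
  rewrite s0 [in RHS]EFinM -mark_mass_fin//; congr (_ * nu s _).
  rewrite !xsectionE; apply/seteqP; split => y /=; first by case.
  by move=> ?; split => //; split => //=; rewrite inE in sT.
case: ifP => // _; rewrite (_ : xsection _ _ = set0) ?measure0 ?mule0//.
apply/seteqP; split => y //=; rewrite xsectionE/= => -[_ []] /=.
by rewrite notin_setE in nsT.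
Qed.

Let xsection_cylinder (D : set R) s :
  nu s (xsection (D `*` setT) s) = (\1_D s)%:E.
Proof.
have -> : xsection (D `*` setT : set (R * R)) s = if s \in D then setT else set0.
  rewrite xsectionE; apply/seteqP; split => y /=.
    by case => /= Ds _; rewrite mem_set.
  by case: ifPn => // + _; rewrite inE.
by rewrite indicE; case: ifP => _; [exact: prob_kernel|rewrite measure0].
Qed.

Lemma limit_mean_cylinder (zbar T : R) (lam : R -> R) D : D `<=` `[0%R, T] ->
  limit_mean zbar lam nu (D `*` setT) =
  \int[mu]_(s in `[0%R, T]) (zbar * lam s * \1_D s)%:E.
Proof.
move=> DT; rewrite /limit_mean integral_mkcond [RHS]integral_mkcond.
apply: eq_integral => s _; rewrite !patchE xsection_cylinder [in RHS]EFinM indicE.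
have [sD|nsD] := boolP (s \in D); last by rewrite !mule0 !if_same.
have sT : s \in `[0%R, T]%classic by rewrite inE; move: sD; rewrite inE => /DT.
rewrite sT mem_set//; move: sT; rewrite inE/= !in_itv/= andbT => /andP[]//.
Qed.

Lemma limit_mean_neg (zbar : R) (lam : R -> R) :
  limit_mean zbar lam nu (`]-oo, 0%R[ `*` setT) = 0.
Proof.
rewrite /limit_mean; apply: integral0_eq => s.
rewrite /= in_itv/= andbT => s0; rewrite xsection_cylinder indicE memNset ?mule0//=.
by rewrite in_itv/= ltNge s0.
Qed.

Context d (Om : measurableType d) (P : probability Om R).
Variables (G : nat -> Om -> \bar R) (L : nat -> Om -> R).

(** Counting arrivals in [D] is counting points in the cylinder over [D]. *)
Lemma arrivals_poisson (mean : set (R * R) -> \bar R) :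
  poisson_point_process P mean (marked_count G L) ->
  poisson_point_process P (fun D => mean (D `*` setT)) (arrival_count G).
Proof.
have -> : arrival_count G = fun D => marked_count G L (D `*` setT).
  apply/funext => D; apply/funext => w; rewrite /arrival_count /marked_count.
  congr (limn _); apply/funext => n; apply: eq_bigr => k _.
  rewrite !indicE; congr ((nat_of_bool _)%:R%:E); apply/idP/idP; rewrite !inE.
    by move=> [s Ds <-]; exists (s, L k w).
  by move=> [[s y] [/= Ds _] [<- _]]; exists s.
have mX D : measurable D -> measurable (D `*` setT : set (R * R)).
  by move=> mD; exact: measurableX.
move=> [mxi xiE xiI]; split.
- by move=> D mD; apply: mxi; exact: mX.
- by move=> D n mD; apply: xiE; exact: mX.
- move=> m D A mD mA DI; apply: (xiI m (fun i => D i `*` setT)) => //.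
    by move=> i; exact: mX.
  move=> i j _ _ [[s y] [[/= Dis _] [/= Djs _]]].
  by apply: (DI i j I I); exists s.
Qed.

Lemma simple_arrivals_density (mean : set R -> \bar R) (rho : R -> R) (T c : R) :
  poisson_point_process P mean (arrival_count G) -> (0 <= T)%R ->
  measurable_fun `[0%R, T]%classic rho ->
  (forall s, s \in `[0, T] -> 0 <= rho s <= c)%R ->
  (forall D, measurable D -> D `<=` `[0%R, T] ->
     mean D = \int[mu]_(s in `[0%R, T]) (rho s * \1_D s)%:E) ->
  mean `]-oo, 0%R[%classic = 0 ->
  {ae P, forall w, simple_arrivals T (G ^~ w)}.
Proof.
move=> PG T0 mrho rhoc meanE mean0.
have c0 : (0 <= c)%R.
  by have /andP[] := rhoc 0%R ltac:(by rewrite in_itv/= lexx); exact: le_trans.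
apply: (simple_arrivals_ae PG T0 c0) => // D mD DT; rewrite meanE//.
apply/andP; split.
  apply: integral_ge0 => s /= sT; rewrite lee_fin mulr_ge0//.
  by case/andP: (rhoc s sT).
have mI : measurable_fun (`[0%R, T]%classic : set R) (\1_D : R -> R).
  by apply: measurable_funTS; exact: measurable_indic.
have -> : lebesgue_measure D = \int[mu]_(s in `[0%R, T]) (\1_D s)%:E.
  by rewrite integral_indic// (setIidl DT).
rewrite -ge0_integralZl//; last exact/measurable_EFinP.
apply: ge0_le_integral => //.
- move=> s sT; rewrite lee_fin mulr_ge0//.
  by case/andP: (rhoc s sT).
- by apply/measurable_EFinP; exact: measurable_funM mrho mI.
- by apply/measurable_EFinP; exact: measurable_funM (measurable_cst c) mI.
- move=> s sT; rewrite -EFinM lee_fin ler_wpM2r//.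
  by case/andP: (rhoc s sT).
Qed.

End intensities.

Section quenched_limit.
Context (R : realType) (dO : measure_display) (Om : measurableType dO).
Variables (P Q : probability Om R) (nu : R.-pker R ~> R).
Variables (K kappa C zbar T r : R) (lam z : R -> R).
Hypotheses (kappa0 : 0 < kappa) (C0 : 0 < C) (zbar0 : 0 <= zbar) (T0 : 0 <= T).
Hypothesis mlam : measurable_fun (`[0, T]%classic : set R) lam.
Hypothesis lamK : forall s : R, 0 <= s -> 0 <= lam s <= K.
Hypothesis mz : measurable_fun [set u : R | 0 <= u] z.
Hypothesis zK : forall u : R, 0 <= u -> 0 <= z u <= K.
Hypothesis z_erg : forall t : R, 0 < t ->
  `|t^-1 * \int[lebesgue_measure]_(u in `[0, t]) z u - zbar| <= C / (1 + t) `^ kappa.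

Variables (Geps : R -> nat -> Om -> \bar R) (Leps : R -> nat -> Om -> R).
Variable Xeps : R -> Om -> path_space T.
Hypothesis mGeps : forall (e : R) k, 0 < e -> measurable_fun setT (Geps e k).
Hypothesis mLeps : forall (e : R) k, 0 < e -> measurable_fun setT (Leps e k).
Hypothesis arrivals_eps : forall e : R, 0 < e ->
  poisson_point_process Q (arrival_mean lam (fun s => z (s / e)))
    (arrival_count (Geps e)).
Hypothesis services_eps : forall e : R, 0 < e ->
  independent_services Q nu (Geps e) (Leps e).
Hypothesis XepsR : forall e : R, 0 < e -> random_element_CT (Xeps e).
Hypothesis Xeps_sol : forall e : R, 0 < e -> {ae Q, forall w,
  solves_storage T r (fun t => queue (Geps e) (Leps e) t w) (Xeps e w)}.

Variables (G : nat -> Om -> \bar R) (L : nat -> Om -> R).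
Hypothesis mG : forall k, measurable_fun setT (G k).
Hypothesis mL : forall k, measurable_fun setT (L k).
Hypothesis marks : poisson_point_process P (limit_mean zbar lam nu) (marked_count G L).

Let K0 : 0 <= K.
Proof. by have /andP[z0] := zK (lexx 0); exact: le_trans. Qed.

Let rho (e s : R) := lam s * z (s / e).

Let mrho e : 0 < e -> measurable_fun (`[0, T]%classic : set R) (rho e).
Proof.
move=> e0; apply: measurable_funM => //.
apply: (measurable_comp (F := [set u : R | 0 <= u])) => //.
- exact: measurable_nneg.
- by move=> _ [s /= + <-]; rewrite in_itv/= => /andP[s0 _]; rewrite divr_ge0// ltW.
- exact: measurable_funM.
Qed.

Let rhoK e : 0 < e -> forall s, s \in `[0, T] -> 0 <= rho e s <= K * K.
Proof.
move=> e0 s; rewrite in_itv/= => /andP[s0 _].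
have /andP[l0 lK] := lamK s0.
have /andP[z0 zK'] := zK (divr_ge0 s0 (ltW e0)).
by rewrite mulr_ge0//= ler_pM.
Qed.

Let mean_itv e D : D `<=` `[0, T] ->
  (arrival_mean lam (fun s => z (s / e)) D =
   \int[lebesgue_measure]_(s in `[0%R, T]) (rho e s * \1_D s)%:E)%E.
Proof. exact: arrival_mean_itv. Qed.

(* The prelimit path is the storage functional of its own points, by uniqueness
   for the storage equation. *)
Let X_points e : 0 < e -> {ae Q, forall w t, 0 <= t <= T ->
  Xeps e w t = storage_path T r (points (Geps e) (Leps e) T w) t}.
Proof.
move=> e0; have simple_eps := simple_arrivals_density (arrivals_eps e0) T0
  (mrho e0) (rhoK e0) (fun D mD => @mean_itv e D) (arrival_mean_neg _ _).
move: (Xeps_sol e0) simple_eps; apply: filterS2 => w sol sG t tT.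
exact: (storage_path_unique T0 sG sol).
Qed.

Let mrho0 : measurable_fun (`[0, T]%classic : set R) (fun s => zbar * lam s).
Proof. exact: measurable_funM. Qed.

Let rho0K s : s \in `[0, T] -> 0 <= zbar * lam s <= zbar * K.
Proof.
rewrite in_itv/= => /andP[s0 _]; have /andP[l0 lK] := lamK s0.
by rewrite mulr_ge0//= ler_wpM2l.
Qed.

(* Ergodicity gives the convergence of the intensities [mu_ n], all bounded by
   the one with the constant rate [K * K], so the laws of the points converge. *)
Let cvg_sequence (e_ : nat -> R) (f : path_space T -> R) (Kf : R) :
  (forall n, 0 < e_ n) -> e_ n @[n --> \oo] --> 0 ->
  {within @CT _ T, continuous f} -> (forall x, CT x -> `|f x| <= Kf) ->
  ('E_Q[f \o Xeps (e_ n)] @[n --> \oo] -->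
    'E_P[f \o (fun w => storage_path T r (points G L T w))])%E.
Proof.
move=> e0 ecvg fc fK.
have mp := measurable_points mG mL T.
have mpe n := measurable_points (fun k => mGeps k (e0 n)) (fun k => mLeps k (e0 n)) T.
have [m [mE mI]] := law_exists P mp.
have /choice[m_ m_P] := fun n => law_exists Q (mpe n).
have [mu muE] := marked_measure_exists nu mrho0 rho0K.
have /choice[mu_ mu_E] := fun n => marked_measure_exists nu (mrho (e0 n)) (rhoK (e0 n)).
have KK : forall s, s \in `[0, T] -> 0 <= K * K <= K * K by move=> s _; rewrite mulr_ge0//= lexx.
have [mubar mubarE] := marked_measure_exists nu
  (measurable_cst (K * K) : measurable_fun `[0, T]%classic _) KK.
pose F C := storage_path T r C.
have FR : random_element_CT (F : config (R * R)%type -> path_space T).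
  by apply: storage_path_random_element => //; exact: measurable_id.
pose H C := f (F C) + Kf.
have mH : measurable_fun setT H.
  by apply: measurable_funD => //; exact: measurable_comp_random_element FR fc.
have H0 C' : 0 <= H C' <= Kf + Kf.
  have : `|f (F C')| <= Kf by apply: fK; exact: FR.1.
  by rewrite /H ler_norml; lra.
have refl_ae : {ae P, forall w t, 0 <= t <= T -> storage_path T r (points G L T w) t =
    storage_path T r (points G L T w) t} by apply: aeW.
have EP := expectation_storage_path T0 (storage_path_random_element r T0 mp) mp
  refl_ae mI fc fK.
have EQ n := expectation_storage_path T0 (XepsR (e0 n)) (mpe n) (X_points (e0 n))
  (m_P n).2 fc fK.
have cvg_intensity B : measurable B -> fine (mu_ n B) @[n --> \oo] --> fine (mu B).
  move=> mB; apply: fine_cvg; rewrite fineK ?fin_num_measure// muE//.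
  pose h s := (lam \_ `[0, T]) s * mark_mass nu B s.
  have mh : measurable_fun setT h.
    apply: measurable_funM; last exact: measurable_mark_mass.
    exact/(measurable_restrictT _ (measurable_itv _)).
  have hK s : 0 <= h s <= K.
    have /andP[m0 m1] := mark_mass01 nu s mB; rewrite /h patchE.
    case: ifPn => [|_]; last by rewrite mul0r lexx.
    rewrite inE/= in_itv/= => /andP[s0 _]; have /andP[l0 lK] := lamK s0.
    by rewrite mulr_ge0//= -[leRHS]mulr1 ler_pM.
  have := cvg_integral_time_average mz zK C0 kappa0 T0 zbar0 z_erg e0 ecvg mh hK.
  have -> : (\int[lebesgue_measure]_(s in `[0%R, T]) (zbar * h s)%:E =
      \int[lebesgue_measure]_(s in `[0%R, T]) (zbar * lam s * mark_mass nu B s)%:E)%E.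
    by apply: eq_integral => s sT; rewrite /h patchE sT mulrA.
  suff -> : (fun n => \int[lebesgue_measure]_(s in `[0%R, T]) (z (s / e_ n) * h s)%:E)%E =
      (fun n => mu_ n B) by [].
  apply/funext => n; rewrite mu_E//.
  by apply: eq_integral => s sT; rewrite /h patchE sT mulrCA mulrA.
have HM : (\int[m]_C (H C)%:E)%E \is a fin_num.
  by apply: (integral_bounded_fin_num _ (M := Kf + Kf)).
rewrite EP (_ : (fun n => _) = fun n => (\int[m_ n]_C (H C)%:E - Kf%:E)%E); last first.
  by apply/funext => n; exact: EQ.
apply: cvgeB; [by rewrite fin_num_adde_defr|  |exact: cvg_cst].
have mu_fin (nu' : {finite_measure set (R * R)%type -> \bar R}) B :
    measurable B -> nu' B = (fine (nu' B))%:E.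
  by move=> mB; rewrite fineK// fin_num_measure.
apply: (poisson_law_cvg (mu_ := mu_) (mu := mu) (mubar := mubar) _ _ _ _ mH H0).
- move=> n B mB; rewrite mu_E// mubarE//.
  have mmass : measurable_fun (`[0, T]%classic : set R) (mark_mass nu B).
    by apply: measurable_funTS; exact: measurable_mark_mass.
  apply: ge0_le_integral => //.
  + move=> s sT; have /andP[r0 _] := rhoK (e0 n) sT.
    by rewrite lee_fin mulr_ge0//; case/andP: (mark_mass01 nu s mB).
  + by apply/measurable_EFinP; exact: measurable_funM (mrho (e0 n)) mmass.
  + by apply/measurable_EFinP; exact: measurable_funM (measurable_cst _) mmass.
  + move=> s sT; have /andP[_ r1] := rhoK (e0 n) sT.
    by rewrite lee_fin ler_wpM2r//; case/andP: (mark_mass01 nu s mB).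
- move=> B mB; exact: cvg_intensity.
- move=> n B mB; rewrite (m_P n).1; last exact: measurable_void.
  exact: (points_void_prob (fun k => mGeps k (e0 n)) (fun k => mLeps k (e0 n))
    (services_eps (e0 n)) (arrivals_eps (e0 n)) (mrho (e0 n)) (rhoK (e0 n))
    (fun D _ => @mean_itv (e_ n) D) (mu_E n) mB).
- move=> B mB; rewrite mE; last exact: measurable_void.
  have muB : limit_mean zbar lam nu (B `&` box T) = mu B.
    by rewrite limit_mean_box// muE.
  have := points_void_prob_count (T := T) marks mB; rewrite muB; apply.
    exact: measure_ge0.
  by rewrite -ge0_fin_numE ?measure_ge0// fin_num_measure.
Qed.

Lemma quenched_cvg : cvg_in_distribution_CT 0^'+ Q Xeps P
  (fun w => storage_path T r (points G L T w)).
Proof.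
move=> f fc [Kf fK].
have fin (P' : probability Om R) (X : Om -> path_space T) :
    random_element_CT X -> ('E_P'[f \o X])%E \is a fin_num.
  move=> XR; apply: (@expectation_bounded_fin_num _ _ _ _ _ Kf).
    exact: measurable_comp_random_element XR fc.
  by move=> w; apply: fK; exact: XR.1.
have EPfin := fin P _ (storage_path_random_element r T0 (measurable_points mG mL T)).
rewrite -(fineK EPfin); apply/fine_cvgP; split.
  near=> e; have epos : 0 < e by near: e; exact: nbhs_right_gt.
  exact/fin/XepsR.
apply/cvg_at_rightP => u [u0 ucvg].
apply: fine_cvg; rewrite fineK//.
exact: cvg_sequence u0 ucvg fc fK.
Unshelve. all: by end_near. Qed.

End quenched_limit.

Theorem proposition4p8
  (R : realType) (d : nat)
  (dO : measure_display) (Om : measurableType dO) (P : probability Om R)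
  (* environment *)
  (Z : R -> Om -> Rd R d) (p : R -> R.-pker (Rd R d) ~> (Rd R d))
  (rho0 pi : probability (Rd R d) R) (kappa : R)
  (* arrivals *)
  (K : R) (lam : R -> R) (psi : 'rV[R]_d -> R)
  (* services *)
  (nu : R.-pker R ~> R) (alpha c : R)
  (* quenched probability P_Z *)
  (Q : Om -> probability Om R)
  (* prelimit and limit systems *)
  (Geps : R -> nat -> Om -> \bar R) (Leps : R -> nat -> Om -> R)
  (G : nat -> Om -> \bar R) (L : nat -> Om -> R)
  (* storage *)
  (T r : R) (Xeps : R -> Om -> path_space T)

  (HZ : forall t : R, 0 <= t -> measurable_fun [set: Om] (Z t))
  (HZpath : {ae P, forall w, measurable_fun [set t : R | 0 <= t] (Z ^~ w)})
  (Hrho0 : forall B, measurable B -> P (Z 0 @^-1` B) = rho0 B)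
  (Hp : transition_kernels P p Z)
  (Hpi : unique_invariant_probability p pi)
  (Hkappa : 0 < kappa)
  (Herg : strongly_ergodic P Z psi pi kappa)

  (HQ : regular_conditional_probability P
          (sigma_family [set t : R | 0 <= t] Z) Q)

  (HK : 0 < K)
  (Hlam : {within [set s : R | 0 <= s], continuous lam})
  (HlamK : forall s : R, 0 <= s -> 0 <= lam s <= K)
  (Hpsi : continuous psi)
  (HpsiK : forall z, 0 < psi z <= K)
  (Hpsilip : lipschitz (psi : 'rV[R]_d -> R^o))
  (HGeps : forall (e : R) k, 0 < e -> measurable_fun [set: Om] (Geps e k))
  (Harr : {ae P, forall w, forall e : R, 0 < e ->
     poisson_point_process (Q w)
       (arrival_mean lam (fun s => psi (Z (s / e) w)))
       (arrival_count (Geps e))})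

  (Hnu : forall s : R, 0 <= s -> nu s `]-oo, 0[%classic = 0%E)
  (Halpha : 0 < alpha) (Hc : 0 < c)
  (Htail : forall y s : R, 0 < y -> 0 < s ->
     Fbar nu s y <= c * Num.min (y `^ (- alpha)) 1)
  (Htime : forall s t y : R, 0 < s -> s < t -> 0 < y ->
     `|Fbar nu s y - Fbar nu t y| <= c * (1 + y) `^ (- 1 - alpha) * (t - s))
  (HLeps : forall (e : R) k, 0 < e -> measurable_fun [set: Om] (Leps e k))
  (Hserv : {ae P, forall w, forall e : R, 0 < e ->
     independent_services (Q w) nu (Geps e) (Leps e)})

  (HG : forall k, measurable_fun [set: Om] (G k))
  (HL : forall k, measurable_fun [set: Om] (L k))
  (HM : poisson_point_process P
          (limit_mean (\int[pi]_z psi z) lam nu) (marked_count G L))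
  (Hindep : forall e : R, 0 < e ->
     independent_sigma_fields P
       (sigma_family [set t : R | 0 <= t] (queue G L))
       (sigma_family [set t : R | 0 <= t] (queue (Geps e) (Leps e))))

  (HT : 0 < T) (Hr : 0 < r)
  (HXeps : forall e : R, 0 < e -> random_element_CT (Xeps e))
  (HXsol : {ae P, forall w, forall e : R, 0 < e ->
     {ae Q w, forall w',
        solves_storage T r (fun t => queue (Geps e) (Leps e) t w')
          (Xeps e w')}}) :

  exists X : Om -> path_space T,
    [/\ random_element_CT X,
        {ae P, forall w,
           solves_storage T r (fun t => queue G L t w) (X w)}
      & {ae P, forall w,
           cvg_in_distribution_CT 0^'+ (Q w) Xeps P X}].
Proof.
have T0 : 0 <= T by exact: ltW.
have zbar0 : 0 <= \int[pi]_z psi z.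
  by apply: Rintegral_ge0 => x _; have /andP[/ltW] := HpsiK x.
have mlam : measurable_fun (`[0, T]%classic : set R) lam.
  apply: (measurable_funS (@measurable_nneg R)).
    by move=> s /=; rewrite in_itv/= => /andP[].
  by apply: subspace_continuous_measurable_fun => //; exact: measurable_nneg.
have mpsi : measurable_fun [set: Rd R d] psi.
  move=> mD; apply: (measurability _ (RGenOpens.measurableE R)) => //.
  move=> _ [_ [a [b ->] <-]]; rewrite setTI.
  apply: sub_sigma_algebra; have /continuousP := Hpsi; apply.
  exact: interval_open.
have simpleG : {ae P, forall w, simple_arrivals T (G ^~ w)}.
  apply: (simple_arrivals_density (arrivals_poisson HM) T0
    (rho := fun s => (\int[pi]_z psi z) * lam s) (c := (\int[pi]_z psi z) * K)).
  - exact: measurable_funM.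
  - move=> s; rewrite in_itv/= => /andP[s0 _]; have /andP[l0 lK] := HlamK s s0.
    by rewrite mulr_ge0//= ler_wpM2l.
  - by move=> D _; exact: limit_mean_cylinder.
  - exact: limit_mean_neg.
exists (fun w => storage_path T r (points G L T w)); split.
- exact: (storage_path_random_element r T0 (measurable_points HG HL T)).
- by apply: filterS simpleG => w sG; exact: storage_path_solves.
- have [C [C0 erg]] := Herg.
  apply: (filterS _ (filterI (filterI HZpath erg) (filterI Harr (filterI Hserv HXsol)))).
  move=> w [[mZ ergw] [arrw [servw solw]]].
  have mz : measurable_fun [set u : R | 0 <= u] (fun u => psi (Z u w)).
    exact: (measurableT_comp mpsi mZ).
  apply: (quenched_cvg Hkappa (C0 w) zbar0 T0 mlam HlamK mz _ ergw HGeps HLeps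
    arrw servw HXeps solw HG HL HM).
  by move=> u _; have /andP[/ltW -> ->] := HpsiK (Z u w).
Qed.
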